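(* Let $n\ge 1$ and $p>0$. Let $u:\mathbb{R}^n\to(-\infty,+\infty]$ be a convex function whose effective domain $\operatorname{dom}u=\{x: u(x)<+\infty\}$ is compact, such that $u$ is Lipschitz on $\operatorname{int}(\operatorname{dom}u)$, and such that $u$ is of class $C^2_+$ in $\operatorname{int}(\operatorname{dom}u)$. Let $\omega:\mathbb{R}^{n+1}\to\mathbb{R}$ be continuous and positive. Then there exists a constant $\delta_{p,n}$, depending only on $n$ and $p$, such that \[ \lim_{m\to+\infty} m^{\frac{2p}{n}}\,\triangle_p(u,P^c_{(m)},\omega)=\frac{\delta_{p,n}}{2^p}\left(\int_{\operatorname{dom}u}(\det D^2u(x))^{\frac{p}{n+2p}}\,\omega(x,u(x))^{\frac{n}{n+2p}}\,\mathrm{d}x\right)^{\frac{n+2p}{n}}. \]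
   Context: $C^2_+$ means twice continuously differentiable with positive definite Hessian $D^2u$. $P^c_{(m)}=P^c_{(m)}(u)$ is the class of functions $l_m:\mathbb{R}^n\to\mathbb{R}$ of the form $l_m(x)=\max_{1\le j\le m}\psi_j(x)$ for at most $m$ affine functions $\psi_j:\mathbb{R}^n\to\mathbb{R}$, satisfying $l_m(x)\le u(x)$ for all $x\in\operatorname{dom}u$. For $m$ sufficiently large, \[ \triangle_p(u,P^c_{(m)},\omega)=\inf\Big\{\int_{\operatorname{dom}u}(u(x)-l_m(x))^p\,\omega(x,u(x))\,\mathrm{d}x:\ l_m\in P^c_{(m)}\Big\}. \] (The constant $\delta_{p,n}$ is the one arising from Zador's quantization theorem: for every Jordan measurable compact $J\subset\mathbb{R}^n$ of positive volume, $\lim_{m\to\infty}m^{2p/n}\inf_{S\subset J,\#S=m}\int_J\min_{s\in S}\|x-s\|^{2p}\,\mathrm{d}x=\delta_{p,n}V_n(J)^{(n+2p)/n}$.) *)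

(* Defs.v *)
From HB Require Import structures.
From mathcomp Require Import all_boot all_order all_algebra.
From mathcomp Require Import all_classical all_reals all_analysis.
Set Implicit Arguments. Unset Strict Implicit. Unset Printing Implicit Defensive.
Import Order.TTheory GRing.Theory Num.Theory.
Import numFieldNormedType.Exports.
Local Open Scope classical_set_scope.
Local Open Scope ring_scope.

Section Defs.
Variable R : realType.

(* Lebesgue integral over R^n of a nonnegative extended-real function,
   computed as the iterated one-dimensional Lebesgue integral (Tonelli).
   R^0 is a point of mass 1. *)
Fixpoint iint (n : nat) : ('rV[R]_n -> \bar R) -> \bar R :=
  match n return ('rV[R]_n -> \bar R) -> \bar R with
  | 0 => fun f => f 0
  | n'.+1 => fun f =>
      (\int[@lebesgue_measure R]_t
         iint (fun y : 'rV[R]_n' => f (row_mx (const_mx t : 'rV[R]_1) y)))%E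
  end.

Definition iint_on n (D : set 'rV[R]_n) (f : 'rV[R]_n -> \bar R) : \bar R :=
  iint (fun x => if `[< D x >] then f x else 0%E).

Definition vol n (D : set 'rV[R]_n) : \bar R := iint_on D (fun _ => 1%E).

Definition dotr n (x y : 'rV[R]_n) : R := \sum_(i < n) x 0 i * y 0 i.
Definition enorm n (x : 'rV[R]_n) : R := Num.sqrt (dotr x x).

Definition jordan_compact n (J : set 'rV[R]_n) : Prop :=
  compact J /\ vol (closure J `\` interior J) = 0%E.

Definition quant_err n (p : R) (J : set 'rV[R]_n) (m : nat) : \bar R :=
  ereal_inf [set e | exists S : 'I_m.+1 -> 'rV[R]_n,
     injective S /\ (forall i, J (S i)) /\
     e = iint_on J (fun x => (\big[Num.min/enorm (x - S ord0) `^ (2 * p)]_(i < m.+1)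
                               (enorm (x - S i) `^ (2 * p)))%:E)].

Definition zador_constant n (p delta : R) : Prop :=
  forall J : set 'rV[R]_n, jordan_compact J -> (0 < vol J)%E ->
    ((fun m : nat => ((m.+1)%:R `^ (2 * p / n%:R))%:E * quant_err p J m) @ \oo
       --> (delta * fine (vol J) `^ ((n%:R + 2 * p) / n%:R))%:E)%E.

Definition dom n (u : 'rV[R]_n -> \bar R) : set 'rV[R]_n := [set x | (u x < +oo)%E].

(* convexity of an extended-real valued function with values in (-oo,+oo] *)
Definition convex_ext n (u : 'rV[R]_n -> \bar R) : Prop :=
  forall (x y : 'rV[R]_n) (t : R), 0 < t < 1 ->
    (u ((t *: x + (1 - t) *: y)%R) <= t%:E * u x + (1 - t)%:E * u y)%E.

Definition lip_on n (f : 'rV[R]_n -> R) (A : set 'rV[R]_n) : Prop :=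
  exists L : R, forall x y, A x -> A y -> `|f x - f y| <= L * `|x - y|.

Definition ebase n (i : 'I_n) : 'rV[R]_n := delta_mx 0 i.

Definition pderiv n (f : 'rV[R]_n -> R) (i : 'I_n) : 'rV[R]_n -> R :=
  fun x => derive f x (ebase i).
Definition hessian n (f : 'rV[R]_n -> R) (x : 'rV[R]_n) : 'M[R]_n :=
  \matrix_(i, j) pderiv (pderiv f j) i x.

Definition C2_on n (f : 'rV[R]_n -> R) (O : set 'rV[R]_n) : Prop :=
  open O /\
  (forall i x, O x -> derivable f x (ebase i)) /\
  (forall i, {in O, continuous (pderiv f i)}) /\
  (forall i j x, O x -> derivable (pderiv f j) x (ebase i)) /\
  (forall i j, {in O, continuous (pderiv (pderiv f j) i)}).

Definition posdef n (A : 'M[R]_n) : Prop :=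
  forall v : 'rV[R]_n, v != 0 -> 0 < (v *m A *m v^T) 0 0.

Definition C2plus_on n (f : 'rV[R]_n -> R) (O : set 'rV[R]_n) : Prop :=
  C2_on f O /\ forall x, O x -> posdef (hessian f x).

Definition maxaff n k (a : 'I_k.+1 -> 'rV[R]_n) (b : 'I_k.+1 -> R) (x : 'rV[R]_n) : R :=
  \big[Num.max/(dotr (a ord0) x + b ord0)]_(i < k.+1) (dotr (a i) x + b i).

Definition Pc n (u : 'rV[R]_n -> \bar R) (m : nat) : set ('rV[R]_n -> R) :=
  [set l | exists k (a : 'I_k.+1 -> 'rV[R]_n) (b : 'I_k.+1 -> R),
     (k.+1 <= m)%N /\ l = maxaff a b /\
     forall x, dom u x -> ((l x)%:E <= u x)%E].

Definition tri n (p : R) (u : 'rV[R]_n -> \bar R) (m : nat)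
  (omega : 'rV[R]_n * R -> R) : \bar R :=
  ereal_inf [set e | exists l, Pc u m l /\
     e = iint_on (dom u)
           (fun x => ((fine (u x) - l x) `^ p * omega (x, fine (u x)))%:E)].

End Defs.

(* Main.v *)
Require Import Defs.
From HB Require Import structures.
From mathcomp Require Import all_boot all_order all_algebra.
From mathcomp Require Import all_classical all_reals all_analysis.
From mathcomp Require Import measurable_realfun ring lra.
Set Implicit Arguments. Unset Strict Implicit. Unset Printing Implicit Defensive.
Import Order.TTheory GRing.Theory Num.Theory.
Import numFieldNormedType.Exports.
Import HBNNSimple.
Local Open Scope classical_set_scope.
Local Open Scope ring_scope.

(** A family of pieces with error functions [e q] is given, and the error of a finite family at a
    point is the smallest [e q x]. If near each [x] the best error of [k] pieces on a small cube [Q]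
    is about [(v x * |Q|)^(1+r) * k^(-r)], if no single piece is good on two disjoint cubes, and if [k]
    pieces always achieve a uniform error [O(k^(-r))], then distributing [m] pieces optimally among
    the cubes of a packing, proportionally to [v x * |Q|], shows that [m^r] times the best error
    converges to [(\int v)^(1+r)]. This principle is used twice, with [r = 2p/n].

    First, the pieces are points and [e z x = |x - z|^(2p)]: self-similarity of the cube makes
    [m^r * error] converge to its infimum [delta] there, and Zador's theorem follows for Jordan sets.
    Secondly, the pieces are affine minorants [psi] of [u], with [e psi x = (u x - psi x)^p omega(x, u x)].
    Near [x0] write [D^2 u(x0) = B B^T]: a tangent at [z] misses [u] by about [|(x - z) B|^2 / 2], and
    any minorant misses it at least by about that much for [z] the minimizer of [u - psi] on [Q], so
    that the local hypothesis is Zador's theorem on the parallelepiped [Q B]. Separation is strict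
    convexity; the uniform bound is obtained from tangents at the points of a net for
    [z |-> z + grad u z], as [u x - tangent_z x <= (grad u x - grad u z).(x - z)]. *)

(** * Lebesgue measure on row vectors as an iterated integral *)

Lemma measurable_forall d (T : measurableType d) (I : countType) (A : I -> set T) :
  (forall i, measurable (A i)) -> measurable [set x | forall i, A i x].
Proof.
move=> mA; rewrite (_ : mkset _ = ~` \bigcup_i ~` A i).
  apply: measurableC; apply: countable_bigcupT_measurable => [|i]; first exact: countableP.
  exact: measurableC.
rewrite setC_bigcup; apply/seteqP; split=> x Ax i; first by move=> _; rewrite setCK.
by have := Ax i Logic.I; rewrite setCK.
Qed.

Section matrix_norm.
Context {R : realType} (m n : nat).
Implicit Types (x : 'M[R]_(m, n)).

Lemma mx_norm_leP x (e : R) : 0 <= e -> reflect (forall i j, `|x i j| <= e) (`|x| <= e).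
Proof.
move=> e0; apply: (iffP idP) => [|xe]; rewrite /Num.norm/= mx_normrE.
  by move=> /bigmax_leP[_ xe] i j; exact: (xe (i, j)).
by apply/bigmax_leP; split=> // -[i j] _; exact: xe.
Qed.

Lemma mx_entry_le_norm x i j : `|x i j| <= `|x|.
Proof. exact: (mx_norm_leP x (normr_ge0 _) (lexx _)). Qed.

Lemma ex_rat_mx_ball x (e : R) : 0 < e -> exists c : 'M[rat]_(m, n), ball (map_mx ratr c : 'M[R]_(m, n)) e x.
Proof.
move=> e0; have /choice[q xq] (ij : 'I_m * 'I_n) : exists q : rat, `|ratr q - x ij.1 ij.2| < e.
  have /rat_in_itvoo[q] : x ij.1 ij.2 - e < x ij.1 ij.2 + e by lra.
  by rewrite in_itv/= => /andP[? ?]; exists q; rewrite ltr_norml; apply/andP; split; lra.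
by exists (\matrix_(i, j) q (i, j)); split=> // i j; rewrite !mxE; exact: (xq (i, j)).
Qed.

Lemma open_mx_bigcup_rat_ball (U : set 'M[R]_(m, n)) : open U ->
  let rat_ball (ck : 'M[rat]_(m, n) * nat) := ball (map_mx ratr ck.1 : 'M[R]_(m, n)) ck.2.+1%:R^-1 in
  U = \bigcup_(ck in [set ck | rat_ball ck `<=` U]) rat_ball ck.
Proof.
move=> oU rat_ball; apply/seteqP; split=> [x Ux|x [ck] /= + ?]; last exact.
have /nbhs_ballP[e /= e0 eU] : nbhs x U by exact: open_nbhs_nbhs.
have [k _ /(_ _ (leqnn _))/= ke] := near_infty_natSinv_lt (PosNum (divr_gt0 e0 (ltr0n _ 2))).
have k0 : 0 < k.+1%:R^-1 :> R by rewrite invr_gt0.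
have [c xc] := ex_rat_mx_ball x k0; exists (c, k) => //= y cy; apply: eU.
have ball_half (z z' : 'M[R]_(m, n)) : ball z k.+1%:R^-1 z' -> ball z (e / 2) z'.
  by apply: le_ball; exact: ltW.
rewrite /= (splitr e).
exact: (ball_triangle (ball_half x (map_mx ratr c) (ball_sym xc)) (ball_half (map_mx ratr c) y cy)).
Qed.

End matrix_norm.

Definition mx_display : measure_display.
Proof. exact: default_measure_display. Qed.

Section borel_mx.
Context {R : realType} {m n : nat}.
HB.instance Definition _ := @isMeasurable.Build mx_display 'M[R]_(m, n)
  <<s @open 'M[R]_(m, n) >> (@sigma_algebra0 _ _ _) (@sigma_algebraC _ _)
  (@sigma_algebra_bigcup _ _ _).
End borel_mx.

Section borel_mx_theory.
Context {R : realType} (m n : nat).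

Lemma open_measurable_mx (U : set 'M[R]_(m, n)) : open U -> measurable U.
Proof. exact: sub_sigma_algebra. Qed.

Lemma closed_measurable_mx (U : set 'M[R]_(m, n)) : closed U -> measurable U.
Proof.
move=> cU; rewrite -(setCK U); apply: measurableC; apply: open_measurable_mx.
exact: closed_openC.
Qed.

Lemma compact_measurable_mx (K : set 'M[R]_(m, n)) : compact K -> measurable K.
Proof. by move=> cK; apply: closed_measurable_mx; exact: compact_closed. Qed.

Lemma measurable_fun_mx d (T : measurableType d) (g : T -> 'M[R]_(m, n)) :
  (forall i j, measurable_fun setT (fun x => g x i j)) -> measurable_fun setT g.
Proof.
move=> mg; apply: (measurability (@open 'M[R]_(m, n))) => // _ [U oU <-].
rewrite setTI (open_mx_bigcup_rat_ball oU) preimage_bigcup bigcup_mkcond.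
apply: countable_bigcupT_measurable => [|[c k]]; first exact: countableP.
case: ifPn => // _; rewrite (_ : _ @^-1` _ = [set x | forall ij : 'I_m * 'I_n,
    ((fun x => g x ij.1 ij.2) @^-1` ball (ratr (c ij.1 ij.2) : R) (k.+1%:R^-1 : R)) x]).
  apply: measurable_forall => -[i j] /=; rewrite -[X in measurable X]setTI.
  by apply: mg => //; exact: measurable_ball.
apply/seteqP; split=> x /=; first by move=> [_ xc] [i j] /=; have := xc i j; rewrite mxE.
by move=> xc; split=> [|i j]; [rewrite invr_gt0|rewrite mxE; exact: (xc (i, j))].
Qed.

Lemma open_continuous_measurable_fun_mx (f : 'M[R]_(m, n) -> R) (O : set 'M[R]_(m, n)) :
  open O -> {in O, continuous f} -> measurable_fun O f.
Proof.
move=> oO cf; apply: (measurability _ (RGenOpens.measurableE R)).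
move=> _ [_ [a [b ->] <-]]; apply: open_measurable_mx.
rewrite openE => x [Ox fx]; apply: filterI; first exact: open_nbhs_nbhs.
apply: (cf x); first by rewrite inE.
by apply: open_nbhs_nbhs; split => //; exact: itv_open.
Qed.

Lemma measurable_entry i j : measurable_fun setT (fun x : 'M[R]_(m, n) => x i j).
Proof.
apply: open_continuous_measurable_fun_mx => [|x _]; first exact: openT.
exact: coord_continuous.
Qed.

End borel_mx_theory.

Local Notation row_cons t y := (row_mx (const_mx t : 'rV[_]_1) y).

Lemma row_cons0 {R : realType} n (t : R) (y : 'rV[R]_n) :
  (row_cons t y : 'rV[R]_n.+1) 0 ord0 = t.
Proof. by rewrite mxE; case: splitP => k //=; rewrite mxE. Qed.

Lemma row_consS {R : realType} n (t : R) (y : 'rV[R]_n) j :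
  (row_cons t y : 'rV[R]_n.+1) 0 (lift ord0 j) = y 0 j.
Proof.
rewrite mxE; case: splitP => k /=; first by rewrite ord1.
by move=> jk; congr (y _ _); apply/val_inj; case: jk.
Qed.

Lemma row_cons_eta {R : realType} n (x : 'rV[R]_n.+1) :
  x = row_cons (x 0 ord0) (\row_j x 0 (lift ord0 j)).
Proof.
apply/rowP => i; have [k ->|->] := unliftP ord0 i; last by rewrite row_cons0.
by rewrite row_consS mxE.
Qed.

Section iterated_integral.
Context {R : realType}.
Implicit Types (n : nat).
Local Notation leb := (@lebesgue_measure R).

Lemma measurable_row_cons n : measurable_fun setT
  (fun z : R * 'rV[R]_n => row_cons z.1 z.2 : 'rV[R]_n.+1).
Proof.
apply: measurable_fun_mx => i j; rewrite (ord1 i); have [k ->|->] := unliftP ord0 j.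
  under eq_fun do rewrite row_consS.
  by apply: (measurableT_comp (measurable_entry _ _)); exact: measurable_snd.
by under eq_fun do rewrite row_cons0; exact: measurable_fst.
Qed.

Lemma measurable_section n (f : 'rV[R]_n.+1 -> \bar R) (t : R) :
  measurable_fun setT f -> measurable_fun setT (fun y : 'rV[R]_n => f (row_cons t y)).
Proof.
move=> mf; apply: (measurableT_comp mf).
have mt : measurable_fun setT (fun y : 'rV[R]_n => (t, y)) by exact: measurable_fun_pair.
exact: (measurableT_comp (@measurable_row_cons n) mt).
Qed.

Lemma iint_ge0 n (f : 'rV[R]_n -> \bar R) : (forall x, 0 <= f x)%E -> (0 <= iint f)%E.
Proof.
elim: n f => [f f0|n IH f f0] /=; first exact: f0.
by apply: integral_ge0 => t _; apply: IH.
Qed.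

Lemma ge0_le_integralT d (T : measurableType d) (mu : {measure set T -> \bar R})
    (f g : T -> \bar R) : (forall x, 0 <= f x)%E -> (forall x, f x <= g x)%E ->
  (\int[mu]_x f x <= \int[mu]_x g x)%E.
Proof.
move=> f0 fg; rewrite !ge0_integralTE//; last by move=> x; exact: le_trans (fg x).
apply: ereal_sup_le => _ [h hf <-]; exists h => // x.
exact: le_trans (hf x) (fg x).
Qed.

Lemma ge0_le_iint n (f g : 'rV[R]_n -> \bar R) : (forall x, 0 <= f x)%E ->
  (forall x, f x <= g x)%E -> (iint f <= iint g)%E.
Proof.
elim: n f g => [f g f0 fg|n IH f g f0 fg] /=; first exact: fg.
apply: ge0_le_integralT => t; first exact: iint_ge0.
by apply: IH.
Qed.

Lemma measurable_iint n : forall d (T : measurableType d) (f : T * 'rV[R]_n -> \bar R),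
  measurable_fun setT f -> (forall z, 0 <= f z)%E ->
  measurable_fun setT (fun x => iint (fun y => f (x, y))).
Proof.
elim: n => [|n IH] d T f mf f0 /=.
  by apply: (measurableT_comp mf); exact: measurable_fun_pair.
pose h (z : T * R) := iint (fun y => f (z.1, row_cons z.2 y)).
apply: (@measurable_fun_fubini_tonelli_F _ _ _ _ R leb h); last by move=> z; exact: iint_ge0.
apply: (IH _ (T * R)%type (fun w => f (w.1.1, row_cons w.1.2 w.2))) => //.
apply: (measurableT_comp mf); apply: measurable_fun_pair.
  by apply: measurableT_comp; exact: measurable_fst.
have m12 : measurable_fun setT (fun w : (T * R) * 'rV[R]_n => (w.1.2, w.2)).
  apply: measurable_fun_pair; last exact: measurable_snd.
  by apply: (measurableT_comp measurable_snd); exact: measurable_fst.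
exact: (measurableT_comp (@measurable_row_cons n) m12).
Qed.

Lemma measurable_iint_section n (f : 'rV[R]_n.+1 -> \bar R) :
  measurable_fun setT f -> (forall z, 0 <= f z)%E ->
  measurable_fun setT (fun t : R => iint (fun y : 'rV[R]_n => f (row_cons t y))).
Proof.
move=> mf f0; apply: (@measurable_iint n _ R (fun w => f (row_cons w.1 w.2))) => //.
by apply: (measurableT_comp mf); exact: measurable_row_cons.
Qed.

Lemma ge0_iintD n (f g : 'rV[R]_n -> \bar R) :
  measurable_fun setT f -> measurable_fun setT g ->
  (forall z, 0 <= f z)%E -> (forall z, 0 <= g z)%E ->
  iint (fun x => f x + g x)%E = (iint f + iint g)%E.
Proof.
elim: n f g => [|n IH] f g mf mg f0 g0 //=.
rewrite -ge0_integralD//; last 4 first.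
- by move=> x _; exact: iint_ge0.
- exact: measurable_iint_section.
- by move=> x _; exact: iint_ge0.
- exact: measurable_iint_section.
by apply: eq_integral => t _; rewrite IH//; exact: measurable_section.
Qed.

Lemma ge0_iintZl n (c : R) (f : 'rV[R]_n -> \bar R) : 0 <= c ->
  measurable_fun setT f -> (forall z, 0 <= f z)%E ->
  iint (fun x => c%:E * f x)%E = (c%:E * iint f)%E.
Proof.
move=> c0; elim: n f => [|n IH] f mf f0 //=.
rewrite -ge0_integralZl//; last 2 first.
- exact: measurable_iint_section.
- by move=> x _; exact: iint_ge0.
by apply: eq_integral => t _; rewrite IH//; exact: measurable_section.
Qed.

Lemma iint0 n : iint (fun _ : 'rV[R]_n => 0%E) = 0%E :> \bar R.
Proof. by elim: n => //= n IH; apply: integral0_eq => t _. Qed.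

Lemma ge0_iint_sum n I (s : seq I) (f : I -> 'rV[R]_n -> \bar R) :
  (forall i, measurable_fun setT (f i)) -> (forall i z, 0 <= f i z)%E ->
  iint (fun x => \sum_(i <- s) f i x)%E = (\sum_(i <- s) iint (f i))%E.
Proof.
move=> mf f0; elim: s => [|i s IH].
  by rewrite big_nil -[RHS](iint0 n); congr iint; apply/funext => x; rewrite big_nil.
rewrite big_cons -IH -ge0_iintD//.
- by congr iint; apply/funext => x; rewrite big_cons.
- exact: emeasurable_sum.
- by move=> z; exact: sume_ge0.
Qed.

Lemma iint_monotone_convergence n (g : nat -> 'rV[R]_n -> \bar R) (f : 'rV[R]_n -> \bar R) :
  (forall k, measurable_fun setT (g k)) -> (forall k x, 0 <= g k x)%E ->
  (forall x, {homo g ^~ x : a b / (a <= b)%N >-> (a <= b)%E}) ->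
  (forall x, g k x @[k --> \oo] --> f x) ->
  iint (g k) @[k --> \oo] --> iint f.
Proof.
elim: n g f => [|n IH] g f mg g0 ndg gf /=; first exact: gf.
have iintf t : iint (fun y : 'rV[R]_n => f (row_cons t y)) =
   limn (fun k => iint (fun y : 'rV[R]_n => g k (row_cons t y))).
  by apply/esym/cvg_lim => //; apply: IH => // k; exact: measurable_section.
under [X in _ --> X]eq_integral do rewrite iintf.
apply: cvg_monotone_convergence => //.
- by move=> k; exact: measurable_iint_section.
- by move=> k x _; exact: iint_ge0.
- by move=> x _ a b ab; apply: ge0_le_iint => // y; exact: ndg.
Qed.

Definition leb_mx n (A : set 'rV[R]_n) : \bar R := iint (fun x => (\1_A x)%:E).

Section leb_mx_measure.
Variable n : nat.

Let leb_mx0 : @leb_mx n set0 = 0%E.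
Proof.
by rewrite /leb_mx -[RHS](iint0 n); congr iint; apply/funext => x; rewrite indic0.
Qed.

Let leb_mx_ge0 (A : set 'rV[R]_n) : (0 <= leb_mx A)%E.
Proof. by apply: iint_ge0 => x; rewrite lee_fin. Qed.

Let leb_mx_sigma_additive : semi_sigma_additive (@leb_mx n).
Proof.
move=> F mF tF mUF; rewrite /leb_mx.
have mindic i : measurable_fun setT (fun x => (\1_(F i) x)%:E : \bar R).
  by apply/measurable_EFinP; exact: measurable_indic.
rewrite (_ : (fun _ => _) = fun k => iint (fun x => \sum_(0 <= i < k) (\1_(F i) x)%:E)%E).
  apply: iint_monotone_convergence.
  - by move=> k; exact: emeasurable_sum.
  - by move=> k x; apply: sume_ge0 => i _; rewrite lee_fin.
  - by move=> x a b ab; apply: lee_sum_nneg_natr => // k _ _; rewrite lee_fin.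
  - by move=> x; rewrite indic_bigcup//; apply: is_cvg_nneseries => i _ _; rewrite lee_fin.
by apply/funext => k; rewrite ge0_iint_sum// => i x; rewrite lee_fin.
Qed.

HB.instance Definition _ := isMeasure.Build _ _ _ (@leb_mx n)
  leb_mx0 leb_mx_ge0 leb_mx_sigma_additive.

End leb_mx_measure.

Lemma iint_nnsfun n (h : {nnsfun 'rV[R]_n >-> R}) :
  iint (fun x => (h x)%:E) = sintegral (@leb_mx n) h.
Proof.
have mpre r : measurable_fun setT (fun x => (\1_(h @^-1` [set r]) x)%:E : \bar R).
  by apply/measurable_EFinP; apply: measurable_indic; exact: measurable_sfunP.
rewrite sintegralE.
transitivity (iint (fun x => \sum_(r \in range h) (`|r|%:E * (\1_(h @^-1` [set r]) x)%:E))%E).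
  congr iint; apply/funext => x; rewrite fsumEFin// [in LHS](fimfunE h).
  congr EFin; apply: eq_fsbigr => r; rewrite inE => -[y _ <-].
  by rewrite ger0_norm.
rewrite fsbig_finite//=; under eq_fun do rewrite fsbig_finite//=.
rewrite ge0_iint_sum.
- rewrite big_seq [RHS]big_seq; apply: eq_bigr => r.
  rewrite in_fset_set// inE => -[y _ <-].
  by rewrite ge0_iintZl//; first by rewrite ger0_norm.
- by move=> r; exact: measurable_funeM.
- by move=> r z; rewrite mule_ge0// lee_fin.
Qed.

Lemma iintE n (f : 'rV[R]_n -> \bar R) : measurable_fun setT f ->
  (forall x, 0 <= f x)%E -> iint f = (\int[@leb_mx n]_x f x)%E.
Proof.
move=> mf f0; pose g := nnsfun_approx measurableT mf.
have gf x : (g k x)%:E @[k --> \oo] --> f x by exact: cvg_nnsfun_approx.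
have ndg x : {homo (fun k => (g k x)%:E) : a b / (a <= b)%N >-> (a <= b)%E}.
  by move=> a b ab; rewrite lee_fin; exact/lefP/nd_nnsfun_approx.
have mg k : measurable_fun setT (fun x => (g k x)%:E) by exact/measurable_EFinP.
have cvg_iint : iint (fun x => (g k x)%:E) @[k --> \oo] --> iint f.
  by apply: iint_monotone_convergence => // k x; rewrite lee_fin.
have cvg_int : (\int[@leb_mx n]_x (g k x)%:E)%E @[k --> \oo] --> (\int[@leb_mx n]_x f x)%E.
  rewrite [X in _ --> X](_ : _ = \int[@leb_mx n]_x limn (fun k => (g k x)%:E))%E; last first.
    by apply: eq_integral => x _; apply/esym/cvg_lim => //; exact: gf.
  by apply: cvg_monotone_convergence => // k x _; rewrite lee_fin.
have E k : iint (fun x => (g k x)%:E) = (\int[@leb_mx n]_x (g k x)%:E)%E.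
  by rewrite integralT_nnsfun -iint_nnsfun.
by move: cvg_iint; rewrite (funext E) => cvg_iint; exact: cvg_unique cvg_iint cvg_int.
Qed.

Lemma iint_onE n (D : set 'rV[R]_n) (f : 'rV[R]_n -> \bar R) : measurable D ->
  measurable_fun D f -> (forall x, D x -> 0 <= f x)%E ->
  iint_on D f = (\int[@leb_mx n]_(x in D) f x)%E.
Proof.
move=> mD mf f0; rewrite /iint_on [RHS]integral_mkcond.
have -> : (fun x => if `[< D x >] then f x else 0%E) = f \_ D.
  by apply/funext => x; rewrite /patch; case: asboolP => Dx; [rewrite mem_set|rewrite memNset].
rewrite iintE//; first exact/(measurable_restrictT _ mD).
by move=> x; rewrite /patch; case: ifPn => //; rewrite inE => /f0.
Qed.

Lemma volE n (D : set 'rV[R]_n) : measurable D -> vol D = leb_mx D.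
Proof. by move=> mD; rewrite /vol iint_onE// integral_cst// mul1e. Qed.

End iterated_integral.

(** * Change of variables *)

Section change_of_variables.
Context {R : realType}.
Implicit Types (n : nat).
Local Notation leb := (@lebesgue_measure R).

Let affine_map (b c : R) (t : R) : measurableTypeR R := b * t + c.

Let measurable_affine_map (b c : R) : measurable_fun setT (affine_map b c).
Proof. by apply: measurable_funD => //; exact: measurable_funM. Qed.

Let preimage_affine_map_itv (b c x y : R) : b != 0 ->
  affine_map b c @^-1` `]x, y] =
  [set` if 0 < b then `](x - c) / b, (y - c) / b] else `[(y - c) / b, (x - c) / b[].
Proof.
move=> b0; have [bp|bn] := ltP 0 b; apply/seteqP; split=> t /=; rewrite !in_itv/= /affine_map.
- by rewrite ltr_pdivrMr// ler_pdivlMr// mulrC; lra.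
- by rewrite ltr_pdivrMr// ler_pdivlMr// mulrC; lra.
- have b_lt0 : b < 0 by rewrite lt_neqAle b0.
  by rewrite ler_ndivrMr// ltr_ndivlMr// [t * b]mulrC; lra.
- have b_lt0 : b < 0 by rewrite lt_neqAle b0.
  by rewrite ler_ndivrMr// ltr_ndivlMr// [t * b]mulrC; lra.
Qed.

Lemma lebesgue_measure_affine (b c : R) (A : set R) : b != 0 -> measurable A ->
  pushforward (mscale (NngNum (normr_ge0 b)) leb) (fun t => b * t + c : measurableTypeR R) A =
  leb A.
Proof.
move=> b0 mA; have maff := measurable_affine_map b c.
apply/esym/lebesgue_measure_unique => //= _ [[x y] _ <-].
rewrite /pushforward /mscale /= (preimage_affine_map_itv c x y b0).
have [bp|bn] := ltP 0 b; rewrite !lebesgue_measure_itv/= !lte_fin.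
  rewrite ltr_pM2r ?invr_gt0// ltrD2r (gtr0_norm bp).
  by case: ifPn => _; rewrite ?mule0// -!EFinD -EFinM; congr EFin; field.
have b_lt0 : b < 0 by rewrite lt_neqAle b0.
rewrite ltr_nM2r ?invr_lt0// ltrD2r (ler0_norm bn).
by case: ifPn => _; rewrite ?mule0// -!EFinD -EFinM; congr EFin; field.
Qed.

Lemma ge0_integral_affine (b c : R) (f : R -> \bar R) : b != 0 ->
  measurable_fun setT f -> (forall x, 0 <= f x)%E ->
  (\int[leb]_t f (b * t + c)%R = `|b|^-1%:E * \int[leb]_t f t)%E.
Proof.
move=> b0 mf f0; have maff := measurable_affine_map b c.
have <- : (\int[mscale (NngNum (normr_ge0 b)) leb]_(t in affine_map b c @^-1` setT)
    (f \o affine_map b c) t = \int[leb]_t f t)%E.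
  rewrite -ge0_integral_pushforward//.
  by apply: eq_measure_integral => A mA _; exact: lebesgue_measure_affine.
rewrite preimage_setT ge0_integral_mscale//=; last exact: (measurableT_comp mf maff).
by rewrite muleA -EFinM mulVf ?normr_eq0// mul1e.
Qed.

Let row_cons_mul_block n (b t : R) (v y : 'rV[R]_n) (B : 'M[R]_n) (c : 'rV[R]_n.+1) :
  row_cons t y *m (block_mx (b%:M : 'M[R]_1) v 0 B) + c =
  row_cons (b * t + c 0 0) (y *m B + (t *: v + @rsubmx _ 1 1 n c)).
Proof.
rewrite -[in LHS](@hsubmxK _ 1 1 n c) mul_row_block mulmx0 addr0 add_row_mx; congr row_mx.
  by rewrite mul_mx_scalar; apply/rowP => i; rewrite !mxE ord1; congr (_ + c _ _); exact/val_inj.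
rewrite (_ : const_mx t = t%:M); last by apply/rowP => i; rewrite !mxE !ord1.
by rewrite mul_scalar_mx addrA [y *m B + _]addrC.
Qed.

Let trig_tr_block n (B : 'M[R]_(1 + n)) : is_trig_mx B^T ->
  exists b v (B' : 'M[R]_n), B = block_mx b%:M v 0 B' /\ is_trig_mx B'^T.
Proof.
rewrite -[B]submxK tr_block_mx is_trig_block_mx// => /and3P[/eqP dl0 _ trB'].
exists ((ulsubmx B) 0 0), (ursubmx B), (drsubmx B); split=> //.
by rewrite -mx11_scalar -[dlsubmx B]trmxK dl0 trmx0.
Qed.

Lemma ge0_iint_mulmx_trig n (B : 'M[R]_n) c f : is_trig_mx B^T -> B \in unitmx ->
  measurable_fun setT f -> (forall x, 0 <= f x)%E ->
  iint (fun x => f (x *m B + c)) = (`|\det B|^-1%:E * iint f)%E.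
Proof.
elim: n B c f => [|n IH] B c f + + mf f0.
  by move=> _ _; rewrite det_mx00 normr1 invr1 mul1e /=; congr f; apply/rowP; case.
move=> /trig_tr_block[b [v [B' [-> trB']]]].
have detE : \det (block_mx (b%:M : 'M[R]_1) v 0 B') = b * \det B' by rewrite det_ublock det_scalar1.
rewrite unitmxE unitfE detE mulf_eq0 => /norP[b0 detB'0] /=.
have uB' : B' \in unitmx by rewrite unitmxE unitfE.
under eq_integral => t _.
  under eq_fun do rewrite row_cons_mul_block.
  rewrite (IH B' _ (fun y => f (row_cons (b * t + c 0 0) y)))//; last exact: measurable_section.
  over.
have mi := measurable_iint_section mf f0.
rewrite ge0_integralZl//.
- rewrite (ge0_integral_affine _ b0 mi); last by move=> t; exact: iint_ge0.
  by rewrite muleA -EFinM normrM invfM mulrC.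
- exact: (measurableT_comp mi (measurable_affine_map b (c 0 0))).
- by move=> t _; exact: iint_ge0.
Qed.

Lemma measurable_mulmx_add m n (B : 'M[R]_(m, n)) (c : 'rV[R]_n) :
  measurable_fun setT (fun x : 'rV[R]_m => x *m B + c).
Proof.
apply: measurable_fun_mx => i j; rewrite (ord1 i); under eq_fun do rewrite !mxE.
apply: measurable_funD; last exact: measurable_cst.
apply: measurable_sum => k; apply: measurable_funM; last exact: measurable_cst.
exact: measurable_entry.
Qed.

Lemma ge0_integral_mulmx_trig n (B : 'M[R]_n) (c : 'rV[R]_n) (D : set 'rV[R]_n)
    (f : 'rV[R]_n -> \bar R) :
  is_trig_mx B^T -> B \in unitmx -> measurable D -> measurable_fun setT f ->
  (forall x, 0 <= f x)%E ->
  (\int[@leb_mx R n]_(x in D) f x =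
   `|\det B|%:E * \int[@leb_mx R n]_(x in [set x | D (x *m B + c)%R]) f (x *m B + c)%R)%E.
Proof.
move=> tB uB mD mf f0.
have mfD : measurable_fun setT (f \_ D).
  by apply/(measurable_restrictT _ mD); exact: measurable_funTS.
have fD0 x : (0 <= (f \_ D) x)%E by rewrite /patch; case: ifPn.
rewrite integral_mkcond -iintE// [in RHS]integral_mkcond.
have -> : (fun x => f (x *m B + c)) \_ [set x | D (x *m B + c)] = fun x => (f \_ D) (x *m B + c).
  by apply/funext => x; rewrite /patch; congr (if _ then _ else _).
rewrite -iintE//; last exact: (measurableT_comp mfD (measurable_mulmx_add B c)).
rewrite ge0_iint_mulmx_trig// muleA -EFinM mulfV ?mul1e// normr_eq0.
by rewrite -unitfE -unitmxE.
Qed.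

End change_of_variables.

Section cholesky.
Context {R : realType}.

Lemma posdef_schur n (a : 'M[R]_1) (v : 'rV[R]_n) (B : 'M[R]_n) : B \in unitmx ->
  let c := v *m invmx B^T in
  posdef (block_mx a v v^T (B *m B^T)) -> 0 < (a - c *m c^T) 0 0.
Proof.
move=> uB c pA; pose z := - (c *m invmx B).
have uBt : B^T \in unitmx by rewrite unitmx_tr.
have vE : v = c *m B^T by rewrite /c -mulmxA mulVmx// mulmx1.
have := pA (row_mx (1%:M : 'M[R]_1) z).
rewrite mul_row_block tr_row_mx mul_row_col !mul1mx.
have -> : z *m (B *m B^T) = - v by rewrite /z mulmxA mulNmx mulmxKV// mulNmx -vE.
rewrite subrr mul0mx addr0 trmx1 mulmx1.
have -> : z *m v^T = - (c *m c^T) by rewrite vE trmx_mul trmxK /z mulNmx mulmxA mulmxKV.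
apply; apply/eqP => /(congr1 (@lsubmx _ 1 1 n)); rewrite row_mxKl => /matrixP/(_ 0 0).
by rewrite !mxE => /eqP; rewrite oner_eq0.
Qed.

Lemma cholesky n (A : 'M[R]_n) : A^T = A -> posdef A ->
  exists B : 'M[R]_n, [/\ is_trig_mx B^T, B \in unitmx & A = B *m B^T].
Proof.
elim: n A => [|n IH] A sA pA.
  by exists 0; split; [rewrite trmx0 mx0_is_trig|rewrite unitmxE det_mx00 unitr1|apply/matrixP => -[]].
pose A1 : 'M[R]_(1 + n) := A; pose a := ulsubmx A1; pose v := ursubmx A1; pose A' := drsubmx A1.
have AE : A1 = block_mx a v v^T A'.
  by rewrite -[LHS]submxK; congr block_mx; rewrite /v trmx_ursub; congr dlsubmx.
have pA1 : posdef A1 by exact: pA.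
have sA' : A'^T = A' by rewrite /A' trmx_drsub; congr drsubmx.
have pA' : posdef A'.
  move=> w w0; have := pA1 (row_mx (0 : 'M[R]_1) w).
  rewrite AE mul_row_block tr_row_mx mul_row_col !mul0mx !add0r trmx0 mulmx0 add0r; apply.
  apply: contra w0 => /eqP/(congr1 (@rsubmx _ 1 1 n)); rewrite row_mxKr => ->.
  by apply/eqP/rowP => i; rewrite !mxE.
have [B [tB uB A'E]] := IH A' sA' pA'.
pose c := v *m invmx B^T; pose b2 := (a - c *m c^T) 0 0.
have vE : v = c *m B^T by rewrite /c -mulmxA mulVmx ?mulmx1// unitmx_tr.
have b2_gt0 : 0 < b2 by apply: posdef_schur => //; rewrite -A'E -AE.
suff [B1 [tB1 uB1 A1E]] : exists B1 : 'M[R]_(1 + n),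
    [/\ is_trig_mx B1^T, B1 \in unitmx & A1 = B1 *m B1^T] by exists B1.
exists (block_mx (Num.sqrt b2)%:M c 0 B); split.
- by rewrite tr_block_mx is_trig_block_mx// trmx0 eqxx tr_scalar_mx scalar_mx_is_trig.
- rewrite unitmxE det_ublock det_scalar1 unitrM -unitmxE uB andbT unitfE.
  by rewrite gt_eqF// sqrtr_gt0.
rewrite AE tr_block_mx mulmx_block; congr block_mx.
- rewrite tr_scalar_mx -scalar_mxM -expr2 sqr_sqrtr ?ltW// /b2.
  by apply/matrixP => i j; rewrite !ord1 !mxE /= mulr1n subrK.
- by rewrite trmx0 mulmx0 add0r.
- by rewrite mul0mx add0r vE trmx_mul trmxK.
- by rewrite trmx0 mulmx0 add0r.
Qed.

End cholesky.

(** * Boundaries of convex sets *)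

Section convex.
Context {R : realType} {V : lmodType R}.

Lemma convex_setP (A : set V) : convex_set A <->
  forall x y (t : R), A x -> A y -> 0 < t < 1 -> A (t *: x + (1 - t) *: y).
Proof.
split=> [cA x y t Ax Ay /andP[t0 t1]|cA].
  have := cA x y (Itv01 (ltW t0) (ltW t1)).
  by rewrite !inE; apply.
apply/convex_setW => x y; rewrite !inE => Ax Ay k k0 k1.
rewrite inE; apply: (cA x y k%:num Ax Ay); by rewrite k0.
Qed.

End convex.

Section null_sets.
Context {R : realType}.
Implicit Types (n : nat).
Local Notation leb := (@lebesgue_measure R).

Lemma ge0_ae_le_integralT d (T : measurableType d) (mu : {measure set T -> \bar R})
    (f g : T -> \bar R) : (forall x, 0 <= f x)%E -> (forall x, 0 <= g x)%E ->
  {ae mu, forall x, f x <= g x}%E -> (\int[mu]_x f x <= \int[mu]_x g x)%E.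
Proof.
move=> f0 g0 [N [mN N0 fgN]]; rewrite [leLHS]ge0_integralTE//.
apply: ge_ereal_sup => _ [h hf <-]; rewrite -integralT_nnsfun.
rewrite (@ge0_negligible_integral _ _ _ mu setT N)//; last 2 first.
- exact/measurable_EFinP.
- by move=> x _; rewrite lee_fin.
rewrite integral_mkcond; apply: ge0_le_integralT => x; rewrite /patch; case: ifPn => //.
  by rewrite lee_fin.
rewrite inE => -[_ Nx]; apply: (le_trans (hf x)); apply: contrapT => fgx.
by apply: Nx; exact: fgN.
Qed.

(* Integrands that agree outside such a set have the same iterated integral even if they are not
   measurable; the integrand of [tri] need not be measurable on the boundary of [dom u]. *)
Fixpoint iterated_null n : set 'rV[R]_n -> Prop :=
  match n return set 'rV[R]_n -> Prop with
  | 0 => fun N => ~ N 0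
  | n'.+1 => fun N =>
      {ae leb, forall t, iterated_null (fun y : 'rV[R]_n' => N (row_cons t y))}
  end.

Lemma sub_iterated_null n (N N' : set 'rV[R]_n) : N `<=` N' ->
  iterated_null N' -> iterated_null N.
Proof.
elim: n N N' => [N N' NN' /= h /NN'//|n IH N N' NN' /=].
apply: filterS; first exact: (ae_filter_ringOfSetsType leb).
by move=> t; apply: IH => y; exact: NN'.
Qed.

Lemma le_iint_iterated_null n (f g : 'rV[R]_n -> \bar R) (N : set 'rV[R]_n) : iterated_null N ->
  (forall x, 0 <= f x)%E -> (forall x, 0 <= g x)%E ->
  (forall x, ~ N x -> (f x <= g x)%E) -> (iint f <= iint g)%E.
Proof.
elim: n f g N => [f g N /= N0 _ _|n IH f g N /= nullN f0 g0 fg]; first exact.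
apply: ge0_ae_le_integralT => [t|t|]; [exact: iint_ge0|exact: iint_ge0|].
apply: filterS nullN; first exact: (ae_filter_ringOfSetsType leb).
by move=> t nullNt; apply: (IH _ _ _ nullNt) => // y; exact: fg.
Qed.

Lemma eq_iint_iterated_null n (f g : 'rV[R]_n -> \bar R) (N : set 'rV[R]_n) : iterated_null N ->
  (forall x, 0 <= f x)%E -> (forall x, 0 <= g x)%E ->
  (forall x, ~ N x -> f x = g x) -> iint f = iint g.
Proof.
move=> nullN f0 g0 fg; apply/eqP; rewrite eq_le.
by apply/andP; split; apply: (le_iint_iterated_null nullN) => // x /fg ->.
Qed.

End null_sets.

Section convex_boundary.
Context {R : realType}.
Implicit Types (n : nat).
Local Notation leb := (@lebesgue_measure R).

Lemma near_row_cons n (t : R) (y : 'rV[R]_n) (A : set 'rV[R]_n.+1) :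
  (\forall p \near (t, y), A (row_cons p.1 p.2)) ->
  \forall x \near (row_cons t y : 'rV[R]_n.+1), A x.
Proof.
move=> [[B C] /= [/nbhs_ballP[e /= e0 eB] /nbhs_ballP[d /= d0 dC]] BCA].
apply/nbhs_ballP; exists (Num.min e d); first by rewrite /= lt_min e0.
move=> x [_ xty]; rewrite (row_cons_eta x).
apply: (BCA (x 0 ord0, \row_j x 0 (lift ord0 j))); split=> /=.
  apply: eB; apply: le_ball (_ : ball t (Num.min e d) _); first by rewrite ge_min lexx.
  by have := xty 0 ord0; rewrite row_cons0.
apply: dC; split=> // i j; rewrite (ord1 i) mxE.
apply: le_ball (_ : ball (y 0 j) (Num.min e d) _); first by rewrite ge_min lexx orbT.
by have := xty 0 (lift ord0 j); rewrite row_consS.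
Qed.

Lemma row_cons_conv n (t s l : R) (y z : 'rV[R]_n) :
  row_cons (l * s + (1 - l) * t) (l *: z + (1 - l) *: y) =
  l *: row_cons s z + (1 - l) *: row_cons t y.
Proof.
by rewrite !scale_row_mx add_row_mx; congr row_mx; apply/rowP => i; rewrite !mxE.
Qed.

(* A point near [row_cons t y] on the side of [z] lies on a segment from [row_cons s z] to a point
   of the slice over [t] near [y]. *)
Lemma convex_near_row_cons n (K : set 'rV[R]_n.+1) (t s : R) (y z : 'rV[R]_n) :
  convex_set K -> s != t -> K (row_cons s z) ->
  (\forall w \near y, K (row_cons t w)) ->
  \forall p \near (t, y), 0 <= (p.1 - t) / (s - t) -> K (row_cons p.1 p.2).
Proof.
move=> /convex_setP cK st Ks Kt; have st0 : s - t != 0 by rewrite subr_eq0.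
pose l (p : R * 'rV[R]_n) := (p.1 - t) / (s - t).
have cl : l p @[p --> (t, y)] --> 0.
  rewrite (_ : 0 = (t - t) / (s - t)); last by rewrite subrr mul0r.
  exact: (cvgM (cvgB cvg_fst (cvg_cst _)) (cvg_cst _)).
have cw : (1 - l p)^-1 *: (p.2 - l p *: z) @[p --> (t, y)] --> y.
  rewrite [X in _ --> X](_ : _ = (1 - 0)^-1 *: (y - 0 *: z)); last first.
    by rewrite subr0 invr1 scale1r scale0r subr0.
  have c1 : 1 - l p @[p --> (t, y)] --> (1 - 0 : R) by exact: (cvgB (cvg_cst _) cl).
  apply: (cvgZ (cvgV _ c1)); first by rewrite subr0.
  exact: (cvgB cvg_snd (cvgZ cl (cvg_cst _))).
near=> p => lp0; have lp1 : l p < 1 by near: p; exact: (cvgr_lt _ cl _ ltr01).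
have Kw : K (row_cons t ((1 - l p)^-1 *: (p.2 - l p *: z))) by near: p; exact: (cw _ Kt).
have l1 : 1 - l p != 0 by rewrite subr_eq0 gt_eqF.
have {1}-> : p.1 = l p * s + (1 - l p) * t by rewrite /l; field.
have -> : p.2 = l p *: z + (1 - l p) *: ((1 - l p)^-1 *: (p.2 - l p *: z)).
  by rewrite scalerA mulfV// scale1r addrC subrK.
rewrite row_cons_conv; have [l0|l0] := eqVneq (l p) 0; last first.
  by apply: cK => //; rewrite lt_neqAle eq_sym l0 lp1 lp0.
by rewrite {1 2}l0 scale0r add0r subr0 scale1r.
Unshelve. all: end_near. Qed.

Lemma convex_interior_slice n (K : set 'rV[R]_n.+1) (s t s' : R) (y z z' : 'rV[R]_n) :
  convex_set K -> s < t < s' ->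
  K (row_cons s z) -> K (row_cons s' z') -> (\forall w \near y, K (row_cons t w)) ->
  \forall x \near (row_cons t y : 'rV[R]_n.+1), K x.
Proof.
move=> cK /andP[st ts'] Ks Ks' Kt; apply: near_row_cons.
have st0 : s != t by rewrite lt_eqF.
have ts'0 : s' != t by rewrite gt_eqF.
apply: filterS2 (convex_near_row_cons cK st0 Ks Kt) (convex_near_row_cons cK ts'0 Ks' Kt).
move=> p left_p right_p; have [tp|pt] := leP t p.1.
  by apply: right_p; rewrite divr_ge0 ?subr_ge0// ltW.
by apply: left_p; rewrite -mulrNN -invrN divr_ge0// oppr_ge0 subr_le0 ltW.
Qed.

Lemma between_not_sup_inf (E : set R) (t : R) : E t -> t != sup E -> t != inf E ->
  exists s s', [/\ E s, E s' & s < t < s'].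
Proof.
move=> Et tsup tinf; have E0 : E !=set0 by exists t.
have [s' Es' ts'] : exists2 s', E s' & t < s'.
  apply: contrapT => max_t; have ubt : ubound E t.
    by move=> s Es; rewrite leNgt; apply/negP => ts; apply: max_t; exists s.
  move/eqP: tsup; apply; apply/eqP; rewrite eq_le ge_sup// andbT.
  by apply: ub_le_sup => //; exists t.
have [s Es st] : exists2 s, E s & s < t.
  apply: contrapT => min_t; have lbt : lbound E t.
    by move=> s Es; rewrite leNgt; apply/negP => ts; apply: min_t; exists s.
  move/eqP: tinf; apply; apply/eqP; rewrite eq_le lb_le_inf//=.
  by apply: ge_inf => //; exists t.
by exists s, s'; rewrite st.
Qed.

Lemma convex_boundary_iterated_null n (K : set 'rV[R]_n) :
  convex_set K -> iterated_null (K `\` K°).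
Proof.
elim: n K => [|n IH] K cK.
  move=> [K0 []]; apply: filterS (filterT : nbhs (0 : 'rV[R]_0) setT) => y _.
  by rewrite (_ : y = 0)//; apply/rowP => -[].
pose E := [set t | exists y : 'rV[R]_n, K (row_cons t y)].
have null_ends : leb.-negligible [set sup E; inf E].
  have fin_ends : finite_set [set sup E; inf E] by rewrite finite_setU; split.
  have ? : @measurable _ (measurableTypeR R) [set sup E; inf E].
    by apply: countable_measurable => //; exact: finite_set_countable.
  apply/negligibleP => //.
  by apply: countable_lebesgue_measure0; exact: finite_set_countable.
apply: negligibleS null_ends => t /=; apply: contra_notP => /not_orP[/eqP tsup /eqP tinf].
have cKt : convex_set [set y : 'rV[R]_n | K (row_cons t y)].
  move/convex_setP : cK => cK; apply/convex_setP => x y l Kx Ky l01 /=.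
  by rewrite [X in row_cons X _](_ : t = l * t + (1 - l) * t) ?row_cons_conv; [exact: cK|ring].
apply: sub_iterated_null (IH _ cKt) => y [Ky Kty]; split=> // Kt; apply: Kty.
have [|s [s' [[z Ks] [z' Ks'] sts']]] := between_not_sup_inf (_ : E t) tsup tinf; first by exists y.
exact: convex_interior_slice cK sts' Ks Ks' Kt.
Qed.

Lemma convex_interior n (K : set 'rV[R]_n) : convex_set K ->
  convex_set K°.
Proof.
move=> /convex_setP cK; apply/convex_setP => x y t Kx Ky t01.
have translate (w : 'rV[R]_n) : K° w ->
    \forall z \near t *: x + (1 - t) *: y, K (w + (z - (t *: x + (1 - t) *: y))).
  move=> Kw; have : w + (z - (t *: x + (1 - t) *: y)) @[z --> t *: x + (1 - t) *: y] -->
      w + ((t *: x + (1 - t) *: y) - (t *: x + (1 - t) *: y)).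
    exact: (cvgD (cvg_cst _) (cvgB cvg_id (cvg_cst _))).
  by rewrite subrr addr0; apply.
apply: filterS2 (translate x Kx) (translate y Ky) => z Kx' Ky'.
have := cK _ _ t Kx' Ky' t01; congr K.
by apply/rowP => j; rewrite !mxE; ring.
Qed.

Lemma convex_boundary_null n (K : set 'rV[R]_n) : convex_set K ->
  leb_mx (K `\` K°) = 0%E.
Proof.
move=> cK; rewrite /leb_mx -[RHS](iint0 n).
apply: (eq_iint_iterated_null (convex_boundary_iterated_null cK)) => // x Nx.
by rewrite indicE memNset.
Qed.

Lemma ge0_integral_interior n (K : set 'rV[R]_n) (f : 'rV[R]_n -> \bar R) :
  measurable K -> leb_mx (K `\` K°) = 0%E -> measurable_fun K f -> (forall x, K x -> 0 <= f x)%E ->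
  (\int[@leb_mx R n]_(x in K) f x = \int[@leb_mx R n]_(x in K°) f x)%E.
Proof.
move=> mK N0 mf f0; rewrite (ge0_negligible_integral _ mK mf _ N0)//.
  by rewrite setDD setIidr//; exact: interior_subset.
by apply: measurableD => //; apply: open_measurable_mx; exact: open_interior.
Qed.

Lemma leb_mx_interior n (K : set 'rV[R]_n) : measurable K -> leb_mx (K `\` K°) = 0%E ->
  leb_mx K = leb_mx K°.
Proof.
move=> mK N0; have := ge0_integral_interior mK N0 (f := cst 1%E) (measurable_cst _) (fun _ _ => lee01).
by rewrite !integral_cst ?mul1e//; apply: open_measurable_mx; exact: open_interior.
Qed.

End convex_boundary.

(** * Cubes *)

Section cubes.
Context {R : realType}.
Implicit Types (n : nat).
Local Notation leb := (@lebesgue_measure R).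

Definition box n (I : 'I_n -> set R) : set 'rV[R]_n := [set x | forall j, I j (x 0 j)].

Lemma measurable_box n (I : 'I_n -> set R) : (forall j, measurable (I j)) -> measurable (box I).
Proof.
move=> mI; apply: measurable_forall => j; rewrite -[X in measurable X]setTI.
by apply: (measurable_entry (R := R) (0 : 'I_1) j) => //; exact: mI.
Qed.

Lemma leb_mx_box n (I : 'I_n -> set R) : (forall j, measurable (I j)) ->
  leb_mx (box I) = (\prod_(j < n) leb (I j))%E.
Proof.
elim: n I => [|n IH] I mI.
  by rewrite big_ord0 /leb_mx /= indicE mem_set//; case.
pose J j := I (lift ord0 j).
have mJ : measurable (box J) by apply: measurable_box => j; exact: mI.
have indic_cons t (y : 'rV[R]_n) :
    (\1_(box I) (row_cons t y))%:E = ((\1_(I ord0) t)%:E * (\1_(box J) y)%:E)%E :> \bar R.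
  rewrite -EFinM !indicE -natrM mulnb; congr (_%:R%:E); congr nat_of_bool.
  apply/idP/andP; rewrite !inE.
    move=> Iy; split; first by have := Iy ord0; rewrite row_cons0.
    by move=> j; have := Iy (lift ord0 j); rewrite row_consS.
  by move=> [I0 Jy] j; have [k ->|->] := unliftP ord0 j; [rewrite row_consS; exact: Jy|rewrite row_cons0].
rewrite big_ord_recl -IH// /leb_mx /=.
under eq_integral => t _.
  under eq_fun do rewrite indic_cons.
  rewrite ge0_iintZl//; last by apply/measurable_EFinP; exact: measurable_indic.
  over.
rewrite ge0_integralZr//.
- congr (_ * _)%E.
  by rewrite (@integral_indic _ (measurableTypeR R) R leb setT measurableT (I ord0) (mI ord0)) setIT.
- by apply/measurable_EFinP; apply: measurable_indic; exact: mI.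
- by apply: iint_ge0 => x; rewrite lee_fin.
Qed.

Lemma leb_mx_box_cst n (I : 'I_n -> set R) (h : R) : (forall j, measurable (I j)) ->
  (forall j, leb (I j) = h%:E) -> leb_mx (box I) = (h ^+ n)%:E.
Proof.
move=> mI lebI; rewrite leb_mx_box//; elim: n I mI lebI => [|n IH] I mI lebI.
  by rewrite big_ord0 expr0.
by rewrite big_ord_recl lebI IH// exprS EFinM.
Qed.

Definition ccube n (a : 'rV[R]_n) (h : R) : set 'rV[R]_n :=
  [set x | forall j, a 0 j <= x 0 j <= a 0 j + h].
Definition hcube n (a : 'rV[R]_n) (h : R) : set 'rV[R]_n :=
  [set x | forall j, a 0 j <= x 0 j < a 0 j + h].

Lemma ccubeE n (a : 'rV[R]_n) (h : R) : ccube a h = box (fun j => `[a 0 j, a 0 j + h]%classic).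
Proof. by apply/seteqP; split=> x xa j; have := xa j; rewrite /= in_itv. Qed.

Lemma hcubeE n (a : 'rV[R]_n) (h : R) : hcube a h = box (fun j => `[a 0 j, a 0 j + h[%classic).
Proof. by apply/seteqP; split=> x xa j; have := xa j; rewrite /= in_itv. Qed.

Lemma measurable_ccube n (a : 'rV[R]_n) (h : R) : measurable (ccube a h).
Proof. by rewrite ccubeE; apply: measurable_box => j; exact: measurable_itv. Qed.

Lemma measurable_hcube n (a : 'rV[R]_n) (h : R) : measurable (hcube a h).
Proof. by rewrite hcubeE; apply: measurable_box => j; exact: measurable_itv. Qed.

Lemma leb_mx_ccube n (a : 'rV[R]_n) (h : R) : 0 <= h -> leb_mx (ccube a h) = (h ^+ n)%:E.
Proof.
move=> h0; rewrite ccubeE; apply: leb_mx_box_cst => j; first exact: measurable_itv.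
rewrite lebesgue_measure_itv/= lte_fin ltrDl -EFinD addrAC subrr add0r.
by case: ltgtP h0 => // <-.
Qed.

Lemma leb_mx_hcube n (a : 'rV[R]_n) (h : R) : 0 <= h -> leb_mx (hcube a h) = (h ^+ n)%:E.
Proof.
move=> h0; rewrite hcubeE; apply: leb_mx_box_cst => j; first exact: measurable_itv.
rewrite lebesgue_measure_itv/= lte_fin ltrDl -EFinD addrAC subrr add0r.
by case: ltgtP h0 => // <-.
Qed.

Lemma compact_ccube n (a : 'rV[R]_n) (h : R) : compact (ccube a h).
Proof.
rewrite ccubeE; apply: (@rV_compact R n (fun j => `[a 0 j, a 0 j + h]%classic)) => j.
exact: segment_compact.
Qed.

Lemma convex_ccube n (a : 'rV[R]_n) (h : R) : convex_set (ccube a h).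
Proof.
apply/convex_setP => x y t xa ya /andP[t0 t1] j; rewrite !mxE.
have /andP[x1 x2] := xa j; have /andP[y1 y2] := ya j.
by apply/andP; split; nra.
Qed.

Lemma sub_hcube_ccube n (a : 'rV[R]_n) (h : R) : hcube a h `<=` ccube a h.
Proof. by move=> x xa j; have /andP[-> /ltW ->] := xa j. Qed.

Lemma sub_ccube_hcube n (a : 'rV[R]_n) (h h' : R) : h < h' -> ccube a h `<=` hcube a h'.
Proof.
move=> hh' x xa j; have /andP[-> xh] := xa j.
by rewrite (le_lt_trans xh)// ltrD2l.
Qed.

Lemma sub_ccube n (a : 'rV[R]_n) (h h' : R) : h <= h' -> ccube a h `<=` ccube a h'.
Proof.
by move=> hh' x xa j; have /andP[-> xh] := xa j; rewrite (le_trans xh)// lerD2l.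
Qed.

Lemma ccube_corner n (a : 'rV[R]_n) (h : R) : 0 <= h -> ccube a h a.
Proof. by move=> h0 j; rewrite lexx lerDl. Qed.

Lemma ccube_dist_le n (a : 'rV[R]_n) (h : R) x y : 0 <= h -> ccube a h x -> ccube a h y ->
  `|x - y| <= h.
Proof.
move=> h0 xa ya; apply/(mx_norm_leP _ h0) => i j; rewrite (ord1 i) !mxE.
have /andP[x1 x2] := xa j; have /andP[y1 y2] := ya j.
by rewrite ler_norml; apply/andP; split; lra.
Qed.

Lemma sub_bounded_set (V : normedModType R) (A B : set V) :
  A `<=` B -> bounded_set B -> bounded_set A.
Proof. by move=> AB; apply: sub_boundedr => P BP x /AB; exact: BP. Qed.

Lemma bounded_sub_hcube n (A : set 'rV[R]_n) : bounded_set A ->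
  exists (a : 'rV[R]_n) (L : R), 0 < L /\ A `<=` hcube a L.
Proof.
move=> /ex_strict_bound_gt0[M M0 AM]; exists (const_mx (- M)), (2 * M).
split=> [|x /AM/= xM j]; first by rewrite mulr_gt0.
have := le_lt_trans (mx_entry_le_norm x 0 j) xM; rewrite !mxE ltr_norml => /andP[? ?].
by apply/andP; split; lra.
Qed.

Lemma bounded_leb_mx_lty n (A : set 'rV[R]_n) : measurable A -> bounded_set A ->
  (leb_mx A < +oo)%E.
Proof.
move=> mA /bounded_sub_hcube[a [L [L0 AL]]].
apply: (@le_lt_trans _ _ (leb_mx (hcube a L))).
  by apply: le_measure => //; rewrite inE//; exact: measurable_hcube.
by rewrite leb_mx_hcube ?ltW// ltry.
Qed.

Definition small_cubes n (x : 'rV[R]_n) : set_system ('rV[R]_n * R) :=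
  filter_from [set rho : R | 0 < rho]
    (fun rho => [set ah | 0 < ah.2 /\ ccube ah.1 ah.2 `<=` ball x rho]).

Global Instance small_cubes_filter n (x : 'rV[R]_n) : Filter (small_cubes x).
Proof.
apply: filter_from_filter => [|r1 r2 /= r10 r20]; first by exists 1 => /=.
exists (Num.min r1 r2) => /= [|[a h] /= [h0 ball_min]]; first by rewrite lt_min r10.
by split; split=> // y /ball_min; apply: le_ball; rewrite ge_min lexx ?orbT.
Qed.

Lemma near_small_cubes_sub n (x : 'rV[R]_n) (A : set 'rV[R]_n) : nbhs x A ->
  \forall ah \near small_cubes x, 0 < ah.2 /\ ccube ah.1 ah.2 `<=` A.
Proof.
move=> /nbhs_ballP[rho /= rho0 rhoA]; exists rho => // -[a h] /= [h0 ball_rho].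
by split=> // y /ball_rho; exact: rhoA.
Qed.

Lemma near_small_cubes_shrink n (x : 'rV[R]_n) (G : 'rV[R]_n -> R -> Prop) :
  (\forall ah \near small_cubes x, G ah.1 ah.2) ->
  \forall ah \near small_cubes x, forall t, 0 < t -> t < 1 -> G ah.1 (t * ah.2).
Proof.
move=> [rho rho0 rhoG]; exists rho => // -[a h] /= [h0 ball_rho] t t0 t1.
apply: (rhoG (a, t * h)) => /=; split; first exact: mulr_gt0.
apply: subset_trans ball_rho; apply: sub_ccube.
by rewrite ger_pMl// ltW.
Qed.

End cubes.

(** * Grids and packings by cubes *)

Section grids.
Context {R : realType}.
Implicit Types (n N : nat).

Lemma grid_index N (h t : R) : 0 < h -> 0 <= t < h * N%:R ->
  exists k : 'I_N, h * k%:R <= t < h * k%:R + h.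
Proof.
move=> h0 /andP[t0 tN]; have th0 : 0 <= t / h by rewrite divr_ge0// ltW.
have kN : (Num.truncn (t / h)%R < N)%N by rewrite truncn_lt_nat// ltr_pdivrMr// mulrC.
exists (Ordinal kN) => /=; have /andP[] := truncn_itv th0.
by rewrite ler_pdivlMr// ltr_pdivrMr// -natr1 => ? ?; apply/andP; split; lra.
Qed.

Lemma grid_index_closed N (h t : R) : (0 < N)%N -> 0 < h -> 0 <= t <= h * N%:R ->
  exists k : 'I_N, h * k%:R <= t <= h * k%:R + h.
Proof.
move=> N0 h0 /andP[t0]; rewrite le_eqVlt => /predU1P[->|tN].
  case: N N0 => // N _; exists ord_max; rewrite -natr1 mulrDr mulr1 lexx andbT.
  by rewrite lerDl ltW.
have [|k /andP[? /ltW ?]] := @grid_index N h t h0; first by rewrite t0.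
by exists k; apply/andP.
Qed.

Definition gridpt n (a : 'rV[R]_n) (h : R) N (k : 'rV['I_N]_n) : 'rV[R]_n :=
  \row_j (a 0 j + h * (k 0 j)%:R).

Lemma hcube_grid n (a : 'rV[R]_n) (h : R) N x : 0 < h -> hcube a (h * N%:R) x ->
  exists k : 'rV['I_N]_n, hcube (gridpt a h k) h x.
Proof.
move=> h0 xa; have /choice[k xk] j : exists k : 'I_N, h * k%:R <= x 0 j - a 0 j < h * k%:R + h.
  by apply: grid_index => //; have /andP[? ?] := xa j; apply/andP; split; lra.
exists (\row_j k j) => j; rewrite !mxE.
by have /andP[? ?] := xk j; apply/andP; split; lra.
Qed.

Lemma ccube_grid n (a : 'rV[R]_n) (h : R) N x : (0 < N)%N -> 0 < h -> ccube a (h * N%:R) x ->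
  exists k : 'rV['I_N]_n, ccube (gridpt a h k) h x.
Proof.
move=> N0 h0 xa; have /choice[k xk] j : exists k : 'I_N, h * k%:R <= x 0 j - a 0 j <= h * k%:R + h.
  by apply: grid_index_closed => //; have /andP[? ?] := xa j; apply/andP; split; lra.
exists (\row_j k j) => j; rewrite !mxE.
by have /andP[? ?] := xk j; apply/andP; split; lra.
Qed.

Lemma hcube_grid_inj n (a : 'rV[R]_n) (h : R) N (k k' : 'rV['I_N]_n) x : 0 < h ->
  hcube (gridpt a h k) h x -> hcube (gridpt a h k') h x -> k = k'.
Proof.
move=> h0 xk xk'; apply/rowP => j; apply/val_inj => /=.
have := xk j; have := xk' j; rewrite !mxE => /andP[a1 a2] /andP[b1 b2].
have lt1 : h * (k 0 j)%:R < h * ((k' 0 j)%:R + 1) by lra.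
have lt2 : h * (k' 0 j)%:R < h * ((k 0 j)%:R + 1) by lra.
move: lt1 lt2; rewrite !ltr_pM2l// !natr1 !ltr_nat !ltnS => lt1 lt2.
by apply/eqP; rewrite eqn_leq lt1 lt2.
Qed.

Lemma gridpt_inj n (a : 'rV[R]_n) (h : R) N : 0 < h -> injective (gridpt a h (N := N)).
Proof.
move=> h0 k k' kk'; have corner (b : 'rV[R]_n) : hcube b h b by move=> j; rewrite lexx ltrDl.
apply: (@hcube_grid_inj n a h N k k' (gridpt a h k)) => //.
by rewrite kk'; exact: corner.
Qed.

Lemma card_grid n N : #|{: 'rV['I_N]_n}| = (N ^ n)%N.
Proof. by rewrite card_mx card_ord mul1n. Qed.

Definition cubes n (s : seq 'rV[R]_n) (h : R) : set 'rV[R]_n :=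
  [set x | exists2 a, a \in s & ccube a h x].

Lemma cubesE n (s : seq 'rV[R]_n) (h : R) : cubes s h = \big[setU/set0]_(a <- s) ccube a h.
Proof. by rewrite -bigcup_seq; apply/seteqP; split=> x [a ? ?]; exists a. Qed.

Lemma measurable_cubes n (s : seq 'rV[R]_n) (h : R) : measurable (cubes s h).
Proof. by rewrite cubesE; apply: bigsetU_measurable => a _; exact: measurable_ccube. Qed.

Definition packing n (O : set 'rV[R]_n) (s : seq 'rV[R]_n) (h : R) :=
  [/\ 0 < h, uniq s, forall a, a \in s -> ccube a h `<=` O & trivIset [set` s] (fun a => ccube a h)].

Section packing_existence.
Variables (n : nat) (O : set 'rV[R]_n) (a : 'rV[R]_n) (L : R) (G : 'rV[R]_n -> R -> Prop).
Hypotheses (oO : open O) (L0 : 0 < L) (OL : O `<=` hcube a L).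
Hypothesis nearG : forall x, O x -> \forall ah \near small_cubes x, G ah.1 ah.2.

Let H N : R := L / N.+1%:R.
Let H0 N : 0 < H N. Proof. by rewrite divr_gt0. Qed.
Let H_N N : H N * N.+1%:R = L. Proof. by rewrite /H mulfVK. Qed.
Let cell N (k : 'rV['I_N.+1]_n) := gridpt a (H N) k.
Let good N := [set k : 'rV['I_N.+1]_n | ccube (cell k) (H N) `<=` O /\
  forall t, 0 < t -> t < 1 -> G (cell k) (t * H N)].
Let good_cells N := \bigcup_(k in @good N) hcube (cell k) (H N).

Let measurable_good_cells N : measurable (good_cells N).
Proof.
by apply: fin_bigcup_measurable => [|k _]; [exact: finite_finset|exact: measurable_hcube].
Qed.

Let near_good_cells x : O x -> \forall N \near \oo, good_cells N x.
Proof.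
move=> Ox; have nbhsO : nbhs x O by exact: open_nbhs_nbhs.
have [rho /= rho0 rho_good] :=
  filterI (near_small_cubes_sub nbhsO) (near_small_cubes_shrink (nearG Ox)).
have := @near_infty_natSinv_lt R (PosNum (divr_gt0 rho0 L0)); apply: filterS => N /= Nrho.
have Hrho : H N < rho by rewrite /H mulrC -ltr_pdivlMr.
have [k xk] : exists k, hcube (@cell N k) (H N) x.
  by apply: hcube_grid => //; rewrite H_N; exact: OL.
exists k => //; have [|[_ kO] kG] := rho_good (cell k, H N); last by split.
split=> //= y yk; rewrite -ball_normE /=; apply: le_lt_trans Hrho.
by apply: ccube_dist_le yk; [exact: ltW|exact: sub_hcube_ccube].
Qed.

Let leb_rest_cvg0 : leb_mx (O `\` good_cells N) @[N --> \oo] --> (0 : \bar R).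
Proof.
have mO : measurable O by exact: open_measurable_mx.
have mrest N : measurable (O `\` good_cells N) by exact: measurableD.
have := @dominated_convergence _ _ R (@leb_mx R n) O mO
  (fun N x => (\1_(O `\` good_cells N) x)%:E) (cst 0%E) (cst 1%E).
case.
- by move=> N; apply: measurable_funTS; apply/measurable_EFinP; exact: measurable_indic.
- exact: measurable_cst.
- apply: aeW => x Ox; apply: cvg_near_cst.
  have := near_good_cells Ox; apply: filterS => N xN.
  by rewrite indicE memNset//= => -[].
- apply/integrableP; split; first exact: measurable_cst.
  under eq_integral do rewrite abse1.
  rewrite integral_cst//= mul1e.
  apply: (@le_lt_trans _ _ (leb_mx (hcube a L))); last by rewrite leb_mx_hcube ?ltry ?ltW.
  by apply: le_measure => //; rewrite inE//; exact: measurable_hcube.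
- apply: aeW => x N Ox; rewrite /= ger0_norm// lee_fin indicE.
  by case: (_ \in _); rewrite ?ler01.
move=> _ _; rewrite integral0; apply: cvg_trans; apply: near_eq_cvg.
by apply: nearW => N /=; rewrite integral_indic// setIC setIidr//.
Qed.

Let leb_cell_border N (k : 'rV['I_N.+1]_n) (t : R) : 0 < t -> t < 1 ->
  leb_mx (hcube (cell k) (H N) `\` ccube (cell k) (t * H N)) = ((1 - t ^+ n) * H N ^+ n)%:E.
Proof.
move=> t0 t1; have tH0 : 0 <= t * H N by rewrite mulr_ge0// ltW.
have mcell := measurable_hcube (cell k) (H N); have mtcell := measurable_ccube (cell k) (t * H N).
rewrite measureD//=; last by rewrite leb_mx_hcube ?ltW// ltry.
rewrite setIidr; last by apply: sub_ccube_hcube; rewrite gtr_pMl.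
by rewrite leb_mx_hcube ?ltW// leb_mx_ccube// -EFinB (exprMn n t) mulrBl mul1r.
Qed.

Let leb_borders N (s : seq 'rV['I_N.+1]_n) (t : R) : uniq s -> 0 < t -> t < 1 ->
  (leb_mx (\big[setU/set0]_(k <- s) (hcube (cell k) (H N) `\` ccube (cell k) (t * H N))) <=
   (L ^+ n * (1 - t ^+ n))%:E)%E.
Proof.
move=> us t0 t1.
have mborder (k : 'rV['I_N.+1]_n) : measurable (hcube (cell k) (H N) `\` ccube (cell k) (t * H N)).
  by apply: measurableD; [exact: measurable_hcube|exact: measurable_ccube].
apply: (@le_trans _ _ (\sum_(k <- s) ((1 - t ^+ n) * H N ^+ n)%:E)%E).
  elim: s {us} => [|k s IH]; first by rewrite !big_nil measure0.
  rewrite !big_cons (le_trans (measureU2 _ _ _))//; first by apply: bigsetU_measurable.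
  by apply: leeD; [rewrite [leLHS]leb_cell_border|exact: IH].
have border0 : 0 <= (1 - t ^+ n) * H N ^+ n.
  by rewrite mulr_ge0 ?exprn_ge0 ?(ltW (H0 N))// subr_ge0 exprn_ile1// ltW.
rewrite sumEFin lee_fin big_const_seq iter_addr_0 count_predT.
have sN : (size s <= N.+1 ^ n)%N by rewrite -card_grid -(card_uniqP us) max_card.
apply: (@le_trans _ _ (((1 - t ^+ n) * H N ^+ n) *+ (N.+1 ^ n))).
  by rewrite -[leLHS]mulr_natr -[leRHS]mulr_natr ler_wpM2l// ler_nat.
by rewrite -mulr_natr natrX -mulrA -exprMn H_N mulrC.
Qed.

Lemma ex_shrink_factor (c e : R) : 0 < e ->
  exists t, [/\ 0 < t, t < 1 & c * (1 - t ^+ n) <= e].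
Proof.
move=> e0; have cvg1 : c * (1 - t ^+ n) @[t --> (1 : R)^'-] --> c * (1 - 1 ^+ n).
  apply: cvg_at_left_filter; apply: cvgM; first exact: cvg_cst.
  by apply: cvgB; [exact: cvg_cst|exact: exprn_continuous].
near (1 : R)^'- => t; exists t; split.
- by near: t; exact: nbhs_left_gt.
- by near: t; exact: nbhs_left_lt.
by near: t; apply: (cvgr_le _ cvg1); rewrite expr1n subrr mulr0.
Unshelve. all: end_near. Qed.

Lemma grid_packing (eta : R) : 0 < eta -> exists s h, [/\ packing O s h,
  forall b, b \in s -> G b h & (leb_mx (O `\` cubes s h) <= eta%:E)%E].
Proof.
move=> eta0; have eta2 : 0 < eta / 2 by rewrite divr_gt0.
have [N _ /(_ _ (leqnn N))/= restN] : \forall N \near \oo,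
    (leb_mx (O `\` good_cells N) < (eta / 2)%:E)%E.
  have lt0 : (0 < (eta / 2)%:E)%E by rewrite lte_fin.
  exact: (leb_rest_cvg0 (open_ereal_lt' lt0)).
have [t [t0 t1 tL]] := ex_shrink_factor (L ^+ n) eta2.
pose gs := [seq k <- enum {: 'rV['I_N.+1]_n} | `[< good k >]].
have gsP k : k \in gs -> good k by rewrite mem_filter => /andP[/asboolP].
have tH : t * H N < H N by rewrite gtr_pMl.
have ugs : uniq gs by rewrite filter_uniq// enum_uniq.
exists (map (@cell N) gs), (t * H N); split.
- split; first exact: mulr_gt0.
  + by rewrite map_inj_uniq//; exact: gridpt_inj.
  + move=> _ /mapP[k /gsP[kO _] ->]; apply: subset_trans kO; apply: sub_ccube; exact: ltW.
  + move=> _ _ /mapP[k _ ->] /mapP[k' _ ->] [x [/(sub_ccube_hcube tH) xk /(sub_ccube_hcube tH) xk']].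
    by congr cell; exact: hcube_grid_inj xk xk'.
- by move=> _ /mapP[k /gsP[_ kG] ->]; exact: kG.
have mO : measurable O by exact: open_measurable_mx.
set borders := \big[setU/set0]_(k <- gs) (hcube (cell k) (H N) `\` ccube (cell k) (t * H N)).
have mborders : measurable borders.
  apply: bigsetU_measurable => k _.
  by apply: measurableD; [exact: measurable_hcube|exact: measurable_ccube].
apply: (@le_trans _ _ (leb_mx ((O `\` good_cells N) `|` borders))).
  apply: le_measure; rewrite ?inE.
  - by apply: measurableD => //; exact: measurable_cubes.
  - by apply: measurableU => //; exact: measurableD.
  move=> x [Ox xs]; have [[k gk xk]|] := pselect (good_cells N x); last by left.
  have kgs : k \in gs by rewrite mem_filter mem_enum andbT; exact/asboolP.
  right; rewrite /borders -bigcup_seq; exists k => //; split=> // xtk.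
  by apply: xs; exists (cell k) => //; exact: map_f.
apply: (le_trans (measureU2 _ _ _)) => //; first exact: measurableD.
rewrite (splitr eta) EFinD; apply: leeD; first exact: ltW.
by apply: le_trans (leb_borders ugs t0 t1) _; rewrite lee_fin.
Qed.

End packing_existence.

Lemma cube_packing n (O : set 'rV[R]_n) (G : 'rV[R]_n -> R -> Prop) (eta : R) :
  open O -> bounded_set O -> (forall x, O x -> \forall ah \near small_cubes x, G ah.1 ah.2) ->
  0 < eta -> exists s h, [/\ packing O s h,
    forall a, a \in s -> G a h & (leb_mx (O `\` cubes s h) <= eta%:E)%E].
Proof.
by move=> oO /bounded_sub_hcube[a [L [L0 OL]]] nearG; exact: grid_packing oO L0 OL nearG _.
Qed.

Lemma grid_net n (T : eqType) (Phi : T -> 'rV[R]_n) (A : set T) (a : 'rV[R]_n) (h : R) N :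
  0 < h -> Phi @` A `<=` hcube a (h * N%:R) ->
  exists s : seq T, [/\ (size s <= N ^ n)%N, [set` s] `<=` A &
    forall x, A x -> exists2 y, y \in s & `|Phi x - Phi y| <= h].
Proof.
move=> h0 Aa; have [[x0 Ax0]|A0] := pselect (A !=set0); last first.
  by exists [::]; split=> // x Ax; case: A0; exists x.
have /choice[f fP] (k : 'rV['I_N]_n) : exists y, A y /\
    ((exists2 x, A x & hcube (gridpt a h k) h (Phi x)) -> hcube (gridpt a h k) h (Phi y)).
  have [[y Ay yk]|empty_cell] := pselect (exists2 x, A x & hcube (gridpt a h k) h (Phi x)).
    by exists y.
  by exists x0.
exists (map f (enum {: 'rV['I_N]_n})); split.
- by rewrite size_map -cardE card_grid.
- by move=> _ /mapP[k _ ->]; have [] := fP k.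
move=> x Ax; have [k xk] : exists k : 'rV['I_N]_n, hcube (gridpt a h k) h (Phi x).
  by apply: hcube_grid => //; apply: Aa; exists x.
exists (f k); first by apply: map_f; rewrite mem_enum.
apply: (@ccube_dist_le _ _ (gridpt a h k)); [exact: ltW|exact: sub_hcube_ccube|].
by apply: sub_hcube_ccube; have [_] := fP k; apply; exists x.
Qed.

Lemma truncn_root n k : (0 < n)%N -> (0 < k)%N -> let N := Num.truncn (k%:R `^ n%:R^-1 : R) in
  [/\ (0 < N)%N, (N ^ n <= k)%N & N%:R^-1 <= 2 * k%:R `^ (- n%:R^-1) :> R].
Proof.
move=> n0 k0 N; set kr : R := k%:R `^ n%:R^-1.
have kr1 : 1 <= kr.
  have -> : 1 = 1 `^ n%:R^-1 :> R by rewrite powR1.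
  by apply: ge0_ler_powR; rewrite ?nnegrE ?invr_ge0 ?ler1n// ltW.
have N0 : (0 < N)%N by rewrite truncn_gt0.
have N1 : 1 <= N%:R :> R by rewrite ler1n.
split=> //.
  rewrite -(ler_nat R) natrX; apply: (@le_trans _ _ (kr ^+ n)).
    by apply: lerXn2r; rewrite ?nnegrE ?truncn_le//; lra.
  by rewrite -powR_mulrn ?powR_ge0// -powRrM mulVf ?powRr1// pnatr_eq0 -lt0n.
have := truncnS_gt kr; rewrite -/N -natr1 => krN.
rewrite powRN -/kr ler_pdivlMr; last by lra.
by rewrite mulrC ler_pdivrMr//; lra.
Qed.

Lemma ex_net n (T : eqType) (Phi : T -> 'rV[R]_n) (A : set T) : (0 < n)%N ->
  bounded_set (Phi @` A) -> exists2 C : R, 0 <= C & forall k : nat, (0 < k)%N ->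
    exists s : seq T, [/\ (size s <= k)%N, [set` s] `<=` A &
      forall x, A x -> exists2 y, y \in s & `|Phi x - Phi y| <= C * k%:R `^ (- n%:R^-1)].
Proof.
move=> n0 /bounded_sub_hcube[a [L [L0 AL]]]; exists (L * 2); first by rewrite mulr_ge0// ltW.
move=> k k0; have [N0 Nk invN] := truncn_root n0 k0; set N := Num.truncn _ in N0 Nk invN.
have N0' : 0 < N%:R :> R by rewrite ltr0n.
have [|| s [sN sA sh]] := @grid_net n T Phi A a (L / N%:R) N; first exact: divr_gt0.
  by rewrite mulfVK// gt_eqF.
exists s; split=> //; first exact: leq_trans Nk.
move=> x /sh[y ys xy]; exists y => //; apply: (le_trans xy).
by rewrite -mulrA ler_wpM2l// ltW.
Qed.

End grids.

(** * Inequalities and limits *)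

Section powR_inequalities.
Context {R : realType}.
Implicit Types (x y r : R).

Lemma powRK r x : 0 < r -> 0 <= x -> (x `^ r) `^ r^-1 = x.
Proof. by move=> r0 x0; rewrite -powRrM mulfV ?gt_eqF// powRr1. Qed.

Lemma powRVK r x : 0 < r -> 0 <= x -> (x `^ r^-1) `^ r = x.
Proof. by move=> r0 x0; rewrite -powRrM mulVf ?gt_eqF// powRr1. Qed.

Lemma powR_exprn x k r : 0 <= x -> (x ^+ k) `^ r = x `^ (k%:R * r).
Proof. by move=> x0; rewrite -powR_mulrn// -powRrM. Qed.

Lemma powRVN x r : 0 <= x -> x^-1 `^ (- r) = x `^ r.
Proof. by move=> x0; rewrite -powR_inv1// -powRrM mulN1r opprK. Qed.

Lemma powR_mulN x r : 0 < x -> x `^ r * x `^ (- r) = 1.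
Proof. by move=> x0; rewrite powRN mulfV// gt_eqF// powR_gt0. Qed.

Lemma le_powR x y r : 0 <= r -> 0 <= x -> x <= y -> x `^ r <= y `^ r.
Proof. by move=> r0 x0 xy; apply: ge0_ler_powR => //; rewrite nnegrE// (le_trans x0). Qed.

Lemma lt_powR x y r : 0 < r -> 0 <= x -> x < y -> x `^ r < y `^ r.
Proof. by move=> r0 x0 xy; apply: gt0_ltr_powR => //; rewrite nnegrE// (le_trans x0)// ltW. Qed.

Lemma le_powRN x y r : 0 <= r -> 0 < x -> x <= y -> y `^ (- r) <= x `^ (- r).
Proof.
move=> r0 x0 xy; rewrite !powRN lef_pV2 ?posrE ?powR_gt0 ?(lt_le_trans x0)//.
exact: le_powR (ltW x0) xy.
Qed.

Lemma continuous_powR r x : 0 < x -> {for x, continuous (fun y : R => y `^ r)}.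
Proof.
move=> x0; apply: differentiable_continuous; apply/derivable1_diffP.
by apply: derivable_powR; rewrite in_itv/= andbT.
Qed.

Lemma tangent_powR_le r x l : 0 < r -> 0 <= x -> 0 <= l ->
  (1 + r) * l `^ r * x <= x `^ (1 + r) + r * l `^ (1 + r).
Proof.
move=> r0 x0 l0; have r1 : 0 < 1 + r by rewrite addr_gt0.
have conj_exp : (1 + r)^-1 + ((1 + r) / r)^-1 = 1 by field; rewrite !gt_eqF.
have := conjugate_powR x0 (powR_ge0 l r) r1 (divr_gt0 r1 r0) conj_exp.
rewrite -powRrM (_ : r * ((1 + r) / r) = 1 + r); last by field; rewrite gt_eqF.
move=> /(ler_wpM2l (ltW r1)); rewrite mulrCA mulrC => /le_trans; apply.
by rewrite le_eqVlt; apply/orP; left; apply/eqP; field; rewrite !gt_eqF.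
Qed.

Lemma powR_perspective (d t r : R) : 0 <= d -> 0 < t ->
  (d / t) `^ (1 + r) * t = d `^ (1 + r) * t `^ (- r).
Proof.
move=> d0 t0; rewrite powRM ?invr_ge0 ?(ltW t0)// -mulrA; congr (_ * _).
rewrite -powR_inv1 ?(ltW t0)// -powRrM -[X in _ * X]powRr1 ?(ltW t0)//.
by rewrite -powRD ?(gt_eqF t0) ?implybT//; congr powR; ring.
Qed.

(* The convex function [t `^ (1 + r)] lies above its tangent at the ratio of the two sums. *)
Lemma radon (I : Type) (s : seq I) (d t : I -> R) r : 0 < r ->
  (forall i, 0 <= d i) -> (forall i, 0 < t i) ->
  (\sum_(i <- s) d i) `^ (1 + r) * (\sum_(i <- s) t i) `^ (- r) <=
  \sum_(i <- s) (d i) `^ (1 + r) * (t i) `^ (- r).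
Proof.
move=> r0 d0 t0; have r1 : 0 < 1 + r by rewrite addr_gt0.
case: s => [|j s']; first by rewrite !big_nil powR0 ?gt_eqF// mul0r.
set s := j :: s'; set D := \sum_(i <- s) d i; set T := \sum_(i <- s) t i.
have D0 : 0 <= D by exact: sumr_ge0.
have T0 : 0 < T.
  by rewrite /T big_cons ltr_pwDl//; apply: sumr_ge0 => i _; exact: ltW.
pose l := D / T; have l0 : 0 <= l by rewrite divr_ge0// ltW.
apply: (@le_trans _ _ (\sum_(i <- s) ((1 + r) * l `^ r * d i - r * l `^ (1 + r) * t i))); last first.
  apply: ler_sum => i _; rewrite -powR_perspective// lerBlDr.
  have := ler_wpM2r (ltW (t0 i)) (tangent_powR_le r0 (divr_ge0 (d0 i) (ltW (t0 i))) l0).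
  by rewrite [leRHS]mulrDl -[leLHS]mulrA divfK ?gt_eqF.
rewrite sumrB -!mulr_sumr -/D -/T -powR_perspective// -/l.
have lT : l * T = D by rewrite divfK ?gt_eqF.
have l1r : l `^ (1 + r) = l * l `^ r.
  have [->|l_neq0] := eqVneq l 0; first by rewrite powR0 ?gt_eqF// mul0r.
  by rewrite powRD ?l_neq0 ?implybT// powRr1.
by rewrite -lT l1r le_eqVlt; apply/orP; left; apply/eqP; ring.
Qed.

End powR_inequalities.

Section limits.
Context {R : realType}.

Lemma ex_gt0_mul_le (c e : R) : 0 <= c -> 0 < e -> exists2 t, 0 < t & c * t <= e.
Proof.
move=> c0 e0; have c1 : 0 < c + 1 by rewrite ltr_wpDl.
exists (e / (c + 1)); first exact: divr_gt0.
by rewrite mulrCA ger_pMr// ler_pdivrMr// mul1r lerDl.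
Qed.

Lemma filter_forall_seq (T : Type) (F : set_system T) {FF : Filter F} (I : eqType) (s : seq I)
    (Q : I -> T -> Prop) : (forall i, i \in s -> \forall x \near F, Q i x) ->
  \forall x \near F, forall i, i \in s -> Q i x.
Proof.
elim: s => [_|i s IH Qs]; first exact: nearW.
have Qi : \forall x \near F, Q i x by apply: Qs; rewrite mem_head.
have {}/IH IH : forall j, j \in s -> \forall x \near F, Q j x.
  by move=> j js; apply: Qs; rewrite inE js orbT.
apply: filterS2 Qi IH => x Qix Qsx j; rewrite inE => /predU1P[->//|]; exact: Qsx.
Qed.

Lemma cvg_EFin_leP (T : Type) (F : set_system T) {FF : Filter F} (f : T -> \bar R) (l : R) :
  f x @[x --> F] --> l%:E <->
  forall eps : R, 0 < eps -> \forall x \near F, ((l - eps)%:E <= f x <= (l + eps)%:E)%E.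
Proof.
split=> [fl eps eps0|fl].
  have lo : ((l - eps)%:E < l%:E)%E by rewrite lte_fin gtrBl.
  have hi : (l%:E < (l + eps)%:E)%E by rewrite lte_fin ltrDl.
  have near_lo : \forall x \near F, ((l - eps)%:E < f x)%E := fl _ (open_ereal_gt' lo).
  have near_hi : \forall x \near F, (f x < (l + eps)%:E)%E := fl _ (open_ereal_lt' hi).
  by apply: filterS2 near_lo near_hi => x /ltW-> /ltW.
apply/fine_cvgP; split.
  apply: filterS (fl 1 ltr01) => x /andP[lo hi]; rewrite fin_numE.
  by apply/andP; split; apply/eqP => fx; move: lo hi; rewrite fx ?leeNy_eq ?leye_eq.
apply/cvgrPdist_le => eps eps0; apply: filterS (fl eps eps0) => x /=.
case: (f x) => [z| |] //=; rewrite ?lee_fin//= ?leeNy_eq// ?leye_eq ?andbF//.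
by move=> /andP[? ?]; rewrite ler_norml; apply/andP; split; lra.
Qed.

Lemma le_add_ereal_inf (A B : set \bar R) (c : \bar R) :
  (forall x, A x -> 0 <= x)%E -> (forall y, B y -> 0 <= y)%E ->
  (forall x y, A x -> B y -> (c <= x + y)%E) -> (c <= ereal_inf A + ereal_inf B)%E.
Proof.
move=> A0 B0 cAB.
have iA0 : (0 <= ereal_inf A)%E by apply: le_ereal_inf_tmp => x; exact: A0.
have iB0 : (0 <= ereal_inf B)%E by apply: le_ereal_inf_tmp => y; exact: B0.
have [->|Aoo] := eqVneq (ereal_inf A) +oo%E; first by rewrite addye ?leey// gt_eqF// (lt_le_trans _ iB0).
have [->|Boo] := eqVneq (ereal_inf B) +oo%E; first by rewrite addey ?leey// gt_eqF// (lt_le_trans _ iA0).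
have finA : ereal_inf A \is a fin_num by rewrite ge0_fin_numE// lt_neqAle Aoo leey.
have finB : ereal_inf B \is a fin_num by rewrite ge0_fin_numE// lt_neqAle Boo leey.
apply/lee_addgt0Pr => eps eps0; have eps2 : 0 < eps / 2 by rewrite divr_gt0.
have [x Ax xA] := lb_ereal_inf_adherent eps2 finA.
have [y By yB] := lb_ereal_inf_adherent eps2 finB.
apply: (le_trans (cAB _ _ Ax By)); apply: (le_trans (leeD (ltW xA) (ltW yB))).
by rewrite addeACA -EFinD -splitr.
Qed.

Lemma cvg_truncn_natmul (c : R) : 0 < c -> Num.truncn (c * m%:R) @[m --> \oo] --> \oo.
Proof.
move=> c0; apply/cvgnyPge => k; near=> m.
rewrite truncn_ge_nat; last by rewrite mulr_ge0// ltW.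
by rewrite mulrC -ler_pdivrMr//; near: m; exact: nbhs_infty_ger.
Unshelve. all: end_near. Qed.

Lemma near_truncn_natmul_ge (c c' : R) : 0 < c -> c' < c ->
  \forall m \near \oo, c' * m%:R <= (Num.truncn (c * m%:R))%:R.
Proof.
move=> c0 c'c; near=> m; have := truncnS_gt (c * m%:R); rewrite -natr1.
have : 1 <= (c - c') * m%:R.
  rewrite mulrC -ler_pdivrMr ?subr_gt0//; near: m; exact: nbhs_infty_ger.
by lra.
Unshelve. all: end_near. Qed.

(* [m / (m + K)] tends to [1]. *)
Lemma near_powR_shift_ge (y A K r : R) : 0 < r -> 0 <= K -> 0 <= y -> y < A ->
  \forall m \near \oo, y <= m%:R `^ r * (A * (m%:R + K) `^ (- r)).
Proof.
move=> r0 K0 y0 yA; have A0 : 0 < A by exact: le_lt_trans yA.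
pose q := (y / A) `^ r^-1.
have yA0 : 0 <= y / A by rewrite divr_ge0// ltW.
have q1 : q < 1.
  have -> : 1 = 1 `^ r^-1 :> R by rewrite powR1.
  by apply: lt_powR; rewrite ?invr_gt0// ltr_pdivrMr// mul1r.
near=> m; have m0 : 0 < m%:R :> R by near: m; exact: nbhs_infty_gtr.
have mK : 0 < m%:R + K by rewrite ltr_wpDr.
have q_le : q <= m%:R / (m%:R + K).
  rewrite ler_pdivlMr//; have : K * q / (1 - q) <= m%:R by near: m; exact: nbhs_infty_ger.
  by rewrite ler_pdivrMr ?subr_gt0//; lra.
have {1}-> : y = A * (y / A) by rewrite mulrCA mulfV ?mulr1// gt_eqF.
rewrite [leRHS]mulrCA ler_wpM2l ?(ltW A0)// -(powRVK r0 yA0) -/q powRN.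
rewrite ler_pdivlMr ?powR_gt0// -powRM ?powR_ge0 ?(ltW mK)//.
by apply: le_powR; rewrite ?(ltW r0) ?mulr_ge0 ?powR_ge0 ?(ltW mK)// -ler_pdivlMr.
Unshelve. all: end_near. Qed.

End limits.

(** * Best approximation by finitely many pieces *)

Section integral_bounds.
Context d {X : measurableType d} {R : realType} (mu : {measure set X -> \bar R}).
Implicit Types (D : set X) (f : X -> \bar R).

Let measurable_patch D f : measurable D -> measurable_fun setT f -> measurable_fun setT (f \_ D).
Proof. by move=> mD mf; apply/(measurable_restrictT _ mD); exact: measurable_funTS. Qed.

Let patch_ge0 D f : (forall x, 0 <= f x)%E -> forall x, (0 <= (f \_ D) x)%E.
Proof. by move=> f0 x; rewrite /patch; case: ifPn. Qed.

Lemma ge0_integral_le_cover (I : eqType) (s : seq I) (Q : I -> set X) D f :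
  measurable D -> (forall i, measurable (Q i)) -> measurable_fun setT f -> (forall x, 0 <= f x)%E ->
  D `<=` \bigcup_(i in [set` s]) Q i ->
  (\int[mu]_(x in D) f x <= \sum_(i <- s) \int[mu]_(x in Q i) f x)%E.
Proof.
move=> mD mQ mf f0 DQ; have fD0 B x : (0 <= (f \_ B) x)%E by exact: patch_ge0.
under [leRHS]eq_bigr do rewrite integral_mkcond.
rewrite integral_mkcond -ge0_integral_sum//; last by move=> i; exact: measurable_patch.
apply: ge0_le_integral => //.
- exact: measurable_patch.
- by apply: emeasurable_sum => i; exact: measurable_patch.
move=> x _; rewrite [leLHS]/patch; case: ifPn => [|_]; last exact: sume_ge0.
rewrite inE => /DQ[i /= is_ Qix]; rewrite (big_rem i is_)/= {1}/patch mem_set// leeDl//.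
exact: sume_ge0.
Qed.

Lemma ge0_integral_ge_trivIset (I : eqType) (s : seq I) (Q : I -> set X) D f : uniq s ->
  measurable D -> (forall i, measurable (Q i)) -> measurable_fun setT f -> (forall x, 0 <= f x)%E ->
  (forall i, i \in s -> Q i `<=` D) -> trivIset [set` s] Q ->
  (\sum_(i <- s) \int[mu]_(x in Q i) f x <= \int[mu]_(x in D) f x)%E.
Proof.
move=> us mD mQ mf f0 QD tQ; have fD0 B x : (0 <= (f \_ B) x)%E by exact: patch_ge0.
under eq_bigr do rewrite integral_mkcond.
rewrite [leRHS]integral_mkcond -ge0_integral_sum//; last by move=> i; exact: measurable_patch.
apply: ge0_le_integral => //.
- by move=> x _; exact: sume_ge0.
- by apply: emeasurable_sum => i; exact: measurable_patch.
- exact: measurable_patch.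
move=> x _; have [[i is_ Qix]|xQ] := pselect (exists2 i, i \in s & Q i x); last first.
  rewrite big_seq big1 => [//|i is_].
  by rewrite /patch memNset// => Qix; apply: xQ; exists i.
rewrite (bigD1_seq i)//= big_seq_cond big1 ?adde0.
  by rewrite /patch !mem_set//; exact: QD Qix.
move=> j /andP[js ji]; rewrite /patch memNset// => Qjx.
by move/eqP: ji; apply; apply: tQ => //; exists x.
Qed.

Lemma ge0_integral_le_cst D f (c : R) : measurable D -> measurable_fun setT f ->
  (forall x, 0 <= f x)%E -> (forall x, D x -> f x <= c%:E)%E ->
  (\int[mu]_(x in D) f x <= c%:E * mu D)%E.
Proof.
move=> mD mf f0 fc; rewrite -integral_cst//; apply: ge0_le_integral => //.
exact: measurable_funTS.
Qed.

Lemma ge0_integral_ge_cst D f (c : R) : 0 <= c -> measurable D -> measurable_fun setT f ->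
  (forall x, D x -> c%:E <= f x)%E -> (c%:E * mu D <= \int[mu]_(x in D) f x)%E.
Proof.
move=> c0 mD mf fc; rewrite -integral_cst//; apply: ge0_le_integral => //.
exact: measurable_funTS.
Qed.

End integral_bounds.

Section err.
Context {X : Type} {R : realType} {P : eqType}.
Implicit Types (e : P -> X -> R) (s t : seq P).

Definition err e s x : \bar R := \big[mine/+oo%E]_(q <- s) (e q x)%:E.

Lemma err_le e s x q : q \in s -> (err e s x <= (e q x)%:E)%E.
Proof. by move=> qs; exact: ge_bigmin_seq. Qed.

Lemma le_err e s x (c : \bar R) : (forall q, q \in s -> c <= (e q x)%:E)%E -> (c <= err e s x)%E.
Proof.
by move=> ce; rewrite /err big_seq; apply: le_bigmin => [|q /ce//]; exact: leey.
Qed.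

Lemma sub_err e s t x : {subset s <= t} -> (err e t x <= err e s x)%E.
Proof. by move=> st; apply: le_err => q /st; exact: err_le. Qed.

Lemma err_ge0 e s x : (forall q x, 0 <= e q x) -> (0 <= err e s x)%E.
Proof. by move=> e0; apply: le_err => q _; rewrite lee_fin. Qed.

Lemma err_filter_cat e (p : pred P) (tau : R) s t x :
  (forall q, q \in s -> ~~ p q -> tau <= e q x) -> (err e t x <= tau%:E)%E ->
  (err e ([seq q <- s | p q] ++ t) x <= err e s x)%E.
Proof.
move=> ptau ttau; apply: le_err => q qs; have [pq|npq] := boolP (p q).
  by apply: err_le; rewrite mem_cat mem_filter pq qs.
apply: (@le_trans _ _ (err e t x)); last by apply: (le_trans ttau); rewrite lee_fin ptau.
by apply: sub_err => q' q't; rewrite mem_cat q't orbT.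
Qed.

End err.

Lemma le_err_map {X X' : Type} {R : realType} {P P' : eqType} (e : P -> X -> R) (e' : P' -> X' -> R)
    (phi : P' -> P) (c : R) s x x' : 0 < c ->
  (forall q, q \in s -> e (phi q) x <= c * e' q x') ->
  (err e (map phi s) x <= c%:E * err e' s x')%E.
Proof.
move=> c0 ee'; rewrite -lee_pdivrMl//; apply: le_err => q qs; rewrite lee_pdivrMl// -EFinM.
apply: (@le_trans _ _ (e (phi q) x)%:E); last by rewrite lee_fin ee'.
by apply: err_le; exact: map_f.
Qed.

Lemma err_map {X X' : Type} {R : realType} {P P' : eqType} (e : P -> X -> R) (e' : P' -> X' -> R)
    (phi : P' -> P) (c : R) s x x' : 0 < c ->
  (forall q, q \in s -> e (phi q) x = c * e' q x') ->
  err e (map phi s) x = (c%:E * err e' s x')%E.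
Proof.
move=> c0 eE; apply/eqP; rewrite eq_le le_err_map//=; last by move=> q /eE ->.
apply: le_err => _ /mapP[q qs ->]; rewrite eE// EFinM lee_pmul2l//; exact: err_le.
Qed.

Lemma measurable_err d {X : measurableType d} {R : realType} {P : eqType} (e : P -> X -> R) s :
  (forall q, measurable_fun setT (e q)) -> measurable_fun setT (err e s).
Proof.
move=> me; elim: s => [|q s IH].
  rewrite (_ : err e [::] = cst +oo%E); first exact: measurable_cst.
  by apply/funext => x; rewrite /err big_nil.
rewrite (_ : err e (q :: s) = fun x => mine (e q x)%:E (err e s x)).
  by apply: measurable_mine => //; apply/measurable_EFinP.
by apply/funext => x; rewrite /err big_cons.
Qed.

Definition best_err d {X : measurableType d} {R : realType} (mu : {measure set X -> \bar R})
    {P : eqType} (e : P -> X -> R) (A : set P) (D : set X) (m : nat) : \bar R :=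
  ereal_inf [set I | exists s, [/\ (size s <= m)%N, [set` s] `<=` A &
    I = (\int[mu]_(x in D) err e s x)%E]].

Section best_err.
Context d {X : measurableType d} {R : realType} (mu : {measure set X -> \bar R}) {P : eqType}.
Variables (e : P -> X -> R) (A : set P).
Hypothesis e0 : forall q x, 0 <= e q x.
Hypothesis me : forall q, measurable_fun setT (e q).
Implicit Types (D : set X) (s : seq P) (k m : nat).

Lemma best_err_le D m s : (size s <= m)%N -> [set` s] `<=` A ->
  (best_err mu e A D m <= \int[mu]_(x in D) err e s x)%E.
Proof. by move=> sm sA; apply: ereal_inf_lbound; exists s. Qed.

Lemma le_best_err D m (c : \bar R) :
  (forall s, (size s <= m)%N -> [set` s] `<=` A -> c <= \int[mu]_(x in D) err e s x)%E ->
  (c <= best_err mu e A D m)%E.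
Proof. by move=> cs; apply: le_ereal_inf_tmp => _ [s [sm sA ->]]; exact: cs. Qed.

Let integral_err_ge0 D s : (0 <= \int[mu]_(x in D) err e s x)%E.
Proof. by apply: integral_ge0 => x _; exact: err_ge0. Qed.

Lemma best_err_ge0 D m : (0 <= best_err mu e A D m)%E.
Proof. by apply: le_best_err => s _ _; exact: integral_err_ge0. Qed.

Lemma best_err_nonincreasing D k m : (k <= m)%N ->
  (best_err mu e A D m <= best_err mu e A D k)%E.
Proof.
by move=> km; apply: le_best_err => s sk sA; apply: best_err_le => //; exact: leq_trans km.
Qed.

Let le_integral_err D s t : measurable D -> {subset s <= t} ->
  (\int[mu]_(x in D) err e t x <= \int[mu]_(x in D) err e s x)%E.
Proof.
move=> mD st; apply: ge0_le_integral => //.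
- by move=> x _; exact: err_ge0.
- by apply: measurable_funTS; exact: measurable_err.
- by apply: measurable_funTS; exact: measurable_err.
- by move=> x _; exact: sub_err.
Qed.

Lemma best_err_setU D D1 D2 k m : measurable D -> measurable D1 -> measurable D2 ->
  D `<=` D1 `|` D2 ->
  (best_err mu e A D (k + m) <= best_err mu e A D1 k + best_err mu e A D2 m)%E.
Proof.
move=> mD mD1 mD2 D12; apply: le_add_ereal_inf => [_ [s [_ _ ->]]|_ [s [_ _ ->]]|] //.
move=> _ _ [s [sk sA ->]] [t [tm tA ->]].
apply: (@le_trans _ _ (\int[mu]_(x in D) err e (s ++ t) x)%E).
  apply: best_err_le; first by rewrite size_cat leq_add.
  by move=> q /=; rewrite mem_cat => /orP[/sA|/tA].
apply: (@le_trans _ _ (\sum_(b <- [:: true; false])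
    \int[mu]_(x in (if b then D1 else D2)) err e (s ++ t) x)%E).
  apply: ge0_integral_le_cover => //.
  - by case.
  - exact: measurable_err.
  - by move=> x; exact: err_ge0.
  - by move=> x /D12[]; [exists true|exists false]; rewrite //= !inE.
rewrite !big_cons big_nil adde0; apply: leeD; apply: le_integral_err => // q qst.
  by rewrite mem_cat qst.
by rewrite mem_cat qst orbT.
Qed.

Lemma best_err_bigcup (I : eqType) (s : seq I) (Q : I -> set X) D (k : I -> nat) :
  measurable D -> (forall i, measurable (Q i)) -> D `<=` \bigcup_(i in [set` s]) Q i ->
  (best_err mu e A D (\sum_(i <- s) k i)%N <= \sum_(i <- s) best_err mu e A (Q i) (k i))%E.
Proof.
move=> mD mQ; elim: s D mD => [|i s IH] D mD DQ.
  have -> : D = set0 by apply/seteqP; split=> // x /DQ[].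
  by rewrite !big_nil (le_trans (@best_err_le _ _ [::] _ _))// integral_set0.
rewrite !big_cons; apply: (@le_trans _ _
    (best_err mu e A (Q i) (k i) + best_err mu e A (D `\` Q i) (\sum_(j <- s) k j)%N)%E).
  apply: best_err_setU => //; first exact: measurableD.
  by move=> x Dx; have [?|?] := pselect (Q i x); [left|right].
apply: leeD => //; apply: IH; first exact: measurableD.
move=> x [/DQ[j /=]]; rewrite inE => /predU1P[->//|js] Qjx _; by exists j.
Qed.

End best_err.

Lemma le_best_err_map d {X : measurableType d} {R : realType} (mu : {measure set X -> \bar R})
    {P P' : eqType} (e : P -> X -> R) (e' : P' -> X -> R) (A : set P) (A' : set P')
    (phi : P' -> P) (c : R) D m : 0 < c -> measurable D ->
  (forall q x, 0 <= e q x) -> (forall q, measurable_fun setT (e q)) ->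
  (forall q x, 0 <= e' q x) -> (forall q, measurable_fun setT (e' q)) ->
  (forall q, A' q -> A (phi q)) ->
  (forall q x, A' q -> D x -> e (phi q) x <= c * e' q x) ->
  (best_err mu e A D m <= c%:E * best_err mu e' A' D m)%E.
Proof.
move=> c0 mD e0 me e'0 me' phiA ee'.
rewrite -lee_pdivrMl//; apply: le_best_err => s sm sA; rewrite lee_pdivrMl//.
apply: (@le_trans _ _ (\int[mu]_(x in D) err e (map phi s) x)%E).
  by apply: best_err_le; [rewrite size_map|move=> _ /mapP[q /sA A'q ->]; exact: phiA].
have merr' : measurable_fun D (err e' s) by apply: measurable_funTS; exact: measurable_err.
have err'0 x : (0 <= err e' s x)%E by exact: err_ge0.
rewrite -ge0_integralZl_EFin ?(ltW c0)//; apply: ge0_le_integral => //.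
- by move=> x _; exact: err_ge0.
- by apply: measurable_funTS; exact: measurable_err.
- exact: measurable_funeM.
- by move=> x Dx; apply: le_err_map => // q /sA A'q; exact: ee'.
Qed.

(** * Optimal allocation of the pieces *)

Definition separated {X : Type} {R : realType} {P : Type} (e : P -> X -> R) (A : set P)
    (D D' : set X) := exists2 tau : R, 0 < tau &
  forall q x y, A q -> D x -> D' y -> tau <= Num.max (e q x) (e q y).

Definition uniform_bound {X : Type} {R : realType} {P : eqType} (e : P -> X -> R) (A : set P)
    (O : set X) (r C : R) := forall k : nat, (0 < k)%N -> exists s : seq P,
  [/\ (size s <= k)%N, [set` s] `<=` A & forall x, O x -> (err e s x <= (C * k%:R `^ (- r))%:E)%E].

Section counting.
Variables (I T : eqType).

Lemma count_le1 (p : pred I) (s : seq I) : uniq s ->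
  {in s &, forall i j, p i -> p j -> i = j} -> (count p s <= 1)%N.
Proof.
move=> us p_eq; rewrite -size_filter.
case sE : [seq x <- s | p x] (filter_uniq p us) => [|i [|j l]] //= /andP[+ _].
have : i \in [seq x <- s | p x] by rewrite sE mem_head.
have : j \in [seq x <- s | p x] by rewrite sE !inE eqxx orbT.
rewrite !mem_filter => /andP[pj js] /andP[pi is_].
by rewrite (p_eq i j)// mem_head.
Qed.

Lemma sum_size_filter_le (s : seq I) (p : I -> pred T) (t : seq T) : uniq s ->
  (forall q, q \in t -> {in s &, forall i j, p i q -> p j q -> i = j}) ->
  (\sum_(i <- s) size [seq q <- t | p i q] <= size t)%N.
Proof.
move=> us; elim: t => [|q t IH] p_eq; first by rewrite big1.
under eq_bigr do rewrite size_filter /= -size_filter.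
rewrite big_split/= -[leqRHS]add1n leq_add//; last first.
  by apply: IH => q' q't; apply: p_eq; rewrite inE q't orbT.
have -> : (\sum_(i <- s) p i q)%N = count (fun i => p i q) s.
  by rewrite -sum1_count [RHS]big_mkcond/=; apply: eq_bigr => i _; case: (p i q).
by apply: count_le1 => //; apply: p_eq; rewrite mem_head.
Qed.

End counting.

Section allocation.
Context d {X : measurableType d} {R : realType} (mu : {measure set X -> \bar R}) {P : eqType}.
Variables (e : P -> X -> R) (A : set P) (O : set X) (r : R).
Hypotheses (r0 : 0 < r) (mO : measurable O).
Hypothesis e0 : forall q x, 0 <= e q x.
Hypothesis me : forall q, measurable_fun setT (e q).
Variable C : R.
Hypotheses (C0 : 0 <= C) (rate : uniform_bound e A O r C).
Local Notation E := (best_err mu e A).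

Let r1 : 0 < 1 + r. Proof. by rewrite addr_gt0. Qed.

Lemma ex_uniform_net (tau : R) : 0 < tau -> exists s : seq P,
  [set` s] `<=` A /\ forall x, O x -> (err e s x <= tau%:E)%E.
Proof.
move=> tau0; pose B := (C / tau) `^ r^-1.
have Ct : 0 <= C / tau by rewrite divr_ge0// ltW.
have [s [_ sA sC]] := rate (ltn0Sn (Num.truncn B)).
exists s; split=> // x /sC/le_trans; apply; rewrite lee_fin powRN ler_pdivrMr ?powR_gt0//.
rewrite mulrC -ler_pdivrMr// -(powRVK r0 Ct).
by apply: le_powR; rewrite ?powR_ge0 ?(ltW r0)//; apply/ltW; exact: truncnS_gt.
Qed.

Section lower.
Variables (I : eqType) (s : seq I) (Q : I -> set X) (w : I -> R).
Hypotheses (us : uniq s) (mQ : forall i, measurable (Q i)).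
Hypotheses (QO : forall i, i \in s -> Q i `<=` O) (tQ : trivIset [set` s] Q).
Hypothesis sepQ : {in s &, forall i j, i != j -> separated e A (Q i) (Q j)}.
Hypothesis w0 : forall i, 0 <= w i.
Hypothesis lowQ : forall i, i \in s ->
  \forall k \near \oo, (((w i) `^ (1 + r))%:E <= (k%:R `^ r)%:E * E (Q i) k)%E.

Let ex_separation : exists2 tau : R, 0 < tau & {in s &, forall i j, i != j ->
  forall q x y, A q -> Q i x -> Q j y -> tau <= Num.max (e q x) (e q y)}.
Proof.
have near_tau : \forall tau \near (0 : R)^'+, forall ij, ij \in [seq (i, j) | i <- s, j <- s] ->
    ij.1 != ij.2 -> forall q x y, A q -> Q ij.1 x -> Q ij.2 y -> tau <= Num.max (e q x) (e q y).
  apply: filter_forall_seq => _ /allpairsP[[i j] /= [is_ js ->]].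
  have [->|ij] := eqVneq i j; first exact: nearW.
  have [tau0 tau0_gt0 sep] := sepQ is_ js ij.
  near=> tau => _ q x y Aq Qx Qy; apply: le_trans (sep q x y Aq Qx Qy).
  by near: tau; exact: nbhs_right_le.
near (0 : R)^'+ => tau; exists tau => // i j is_ js ij.
by apply: (near near_tau tau _ (i, j)) => //; exact: allpairs_f.
Unshelve. all: end_near. Qed.

Let touching (tau : R) (sq : seq P) (i : I) :=
  [seq q <- sq | `[< exists2 x, Q i x & e q x < tau >]].

(* On [Q i], a piece that nowhere goes below [tau] can be replaced by the net. *)
Let best_err_touching (tau : R) (net sq : seq P) i : i \in s ->
  [set` net] `<=` A -> (forall x, O x -> (err e net x <= tau%:E)%E) -> [set` sq] `<=` A ->
  (E (Q i) (size (touching tau sq i) + size net) <= \int[mu]_(x in Q i) err e sq x)%E.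
Proof.
move=> is_ netA net_tau sqA.
apply: (@le_trans _ _ (\int[mu]_(x in Q i) err e (touching tau sq i ++ net) x)%E).
  apply: best_err_le; first by rewrite size_cat.
  by move=> q /=; rewrite mem_cat mem_filter => /orP[/andP[_ /sqA]|/netA].
apply: ge0_le_integral => //.
- by move=> x _; exact: err_ge0.
- by apply: measurable_funTS; exact: measurable_err.
- by apply: measurable_funTS; exact: measurable_err.
move=> x Qx; apply: (err_filter_cat (tau := tau)); last by apply: net_tau; exact: QO Qx.
by move=> q _ /asboolP nq; rewrite leNgt; apply/negP => qtau; apply: nq; exists x.
Qed.

Lemma allocation_lower_shifted : exists K : nat, forall m,
  (((\sum_(i <- s) w i) `^ (1 + r) * (m%:R + K%:R) `^ (- r))%:E <= E O m)%E.
Proof.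
have [tau tau0 sep] := ex_separation; have [net [netA net_tau]] := ex_uniform_net tau0.
have [k0 _ lowk0] : \forall k \near \oo, forall i, i \in s ->
    (((w i) `^ (1 + r))%:E <= (k%:R `^ r)%:E * E (Q i) k)%E by exact: filter_forall_seq.
pose N := (k0 + size net).+1; exists (size s * N)%N => m; apply: le_best_err => sq sqm sqA.
apply: le_trans (ge0_integral_ge_trivIset mu us mO mQ (measurable_err sq me) _ QO tQ); last first.
  by move=> x; exact: err_ge0.
pose t i : nat := (size (touching tau sq i) + N)%N.
have t0 i : 0 < (t i)%:R :> R by rewrite ltr0n ltn_addl.
have term i : i \in s ->
    ((w i `^ (1 + r) * (t i)%:R `^ (- r))%:E <= \int[mu]_(x in Q i) err e sq x)%E.
  move=> is_; apply: le_trans (best_err_touching is_ netA net_tau sqA).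
  apply: (@le_trans _ _ (E (Q i) (t i))); last first.
    by apply: best_err_nonincreasing; rewrite leq_add2l leqW// leq_addl.
  rewrite powRN mulrC EFinM lee_pdivrMl ?powR_gt0//; apply: lowk0 => //=.
  by rewrite (leq_trans _ (leq_addl _ _))// leqW// leq_addr.
apply: (@le_trans _ _ (\sum_(i <- s) (w i `^ (1 + r) * (t i)%:R `^ (- r))%:E)%E); last first.
  by rewrite big_seq [leRHS]big_seq; apply: lee_sum.
rewrite sumEFin lee_fin; apply: le_trans (radon s r0 w0 t0).
have [->|s0] := eqVneq s [::]; first by rewrite !big_nil powR0 ?gt_eqF// !mul0r.
rewrite ler_wpM2l ?powR_ge0//; apply: le_powRN; first exact: ltW.
  by case: (s) s0 => // i s' _; rewrite big_cons ltr_pwDl// sumr_ge0.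
rewrite -natr_sum -natrD ler_nat big_split/= leq_add//; last first.
  by rewrite big_const_seq count_predT iter_addn_0 mulnC.
apply: leq_trans sqm; apply: sum_size_filter_le => // q /sqA Aq i j is_ js.
move=> /asboolP[x Qx qx] /asboolP[y Qy qy]; apply/eqP/negPn/negP => ij.
by have := sep i j is_ js ij q x y Aq Qx Qy; rewrite leNgt gt_max qx qy.
Qed.

Lemma allocation_lower (y : R) : 0 <= y -> y < \sum_(i <- s) w i ->
  \forall m \near \oo, ((y `^ (1 + r))%:E <= (m%:R `^ r)%:E * E O m)%E.
Proof.
move=> y0 yw; have [K lowK] := allocation_lower_shifted.
have y1 : y `^ (1 + r) < (\sum_(i <- s) w i) `^ (1 + r) by exact: lt_powR.
apply: filterS (near_powR_shift_ge r0 (ler0n _ K) (powR_ge0 _ _) y1) => m ym.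
apply: le_trans (lee_wpmul2l _ (lowK m)); last by rewrite lee_fin powR_ge0.
by rewrite -EFinM lee_fin.
Qed.

End lower.

Section upper.

Lemma best_err_density (D : set X) (w c c' : R) : 0 <= w -> 0 < c' -> c' < c ->
  (\forall k \near \oo, ((k%:R `^ r)%:E * E D k <= (w `^ (1 + r))%:E)%E) ->
  \forall m \near \oo,
    ((m%:R `^ r)%:E * E D (Num.truncn (c * m%:R)) <= (w `^ (1 + r) * c' `^ (- r))%:E)%E.
Proof.
move=> w0 c'0 c'c upD; have c0 := lt_trans c'0 c'c; near=> m.
have m0 : 0 < m%:R :> R by near: m; exact: nbhs_infty_gtr.
set k := Num.truncn _.
have ck : c' * m%:R <= k%:R by rewrite /k; near: m; exact: near_truncn_natmul_ge.
have cm0 : 0 < c' * m%:R by rewrite mulr_gt0.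
have k0 : 0 < k%:R :> R by exact: lt_le_trans ck.
have upk : ((k%:R `^ r)%:E * E D k <= (w `^ (1 + r))%:E)%E.
  by rewrite /k; near: m; exact: (cvg_truncn_natmul c0 upD).
have -> : (m%:R `^ r = (m%:R / k%:R) `^ r * k%:R `^ r)%R.
  by rewrite -powRM ?divr_ge0 ?(ltW m0) ?(ltW k0)// divfK// gt_eqF.
rewrite EFinM -muleA.
apply: le_trans (lee_wpmul2l _ upk) _; first by rewrite lee_fin powR_ge0.
rewrite -EFinM lee_fin mulrC ler_wpM2l ?powR_ge0//.
rewrite -powRVN ?divr_ge0 ?(ltW m0) ?(ltW k0)// invf_div.
by apply: le_powRN; rewrite ?(ltW r0) ?ler_pdivlMr.
Unshelve. all: end_near. Qed.

Lemma best_err_rest (D : set X) (eta c c' : R) : measurable D -> D `<=` O ->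
  (mu D <= eta%:E)%E -> 0 < c' -> c' < c ->
  \forall m \near \oo,
    ((m%:R `^ r)%:E * E D (Num.truncn (c * m%:R)) <= (C * eta * c' `^ (- r))%:E)%E.
Proof.
move=> mD DO Deta c'0 c'c; have c0 := lt_trans c'0 c'c; near=> m.
have m0 : 0 < m%:R :> R by near: m; exact: nbhs_infty_gtr.
set k := Num.truncn _.
have ck : c' * m%:R <= k%:R by rewrite /k; near: m; exact: near_truncn_natmul_ge.
have cm0 : 0 < c' * m%:R by rewrite mulr_gt0.
have k0 : (0 < k)%N by rewrite -(ltr0n R); exact: lt_le_trans ck.
have eta0 : 0 <= eta by rewrite -lee_fin; exact: le_trans Deta.
have [s [sk sA sC]] := rate k0.
have bound : (E D k <= (C * (c' * m%:R) `^ (- r) * eta)%:E)%E.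
  apply: (@le_trans _ _ (\int[mu]_(x in D) err e s x)%E); first exact: best_err_le.
  apply: (@le_trans _ _ ((C * (c' * m%:R) `^ (- r))%:E * mu D)%E); last first.
    by rewrite [leRHS]EFinM lee_wpmul2l// lee_fin mulr_ge0// powR_ge0.
  apply: ge0_integral_le_cst => //; first exact: measurable_err.
    by move=> x; exact: err_ge0.
  move=> x /DO/sC/le_trans; apply; rewrite lee_fin ler_wpM2l//.
  by apply: le_powRN => //; exact: ltW.
apply: (le_trans (lee_wpmul2l _ bound)); first by rewrite lee_fin powR_ge0.
rewrite -EFinM lee_fin powRM ?(ltW c'0) ?(ltW m0)// le_eqVlt; apply/orP; left; apply/eqP.
transitivity (C * eta * c' `^ (- r) * (m%:R `^ r * m%:R `^ (- r))); first by ring.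
by rewrite powR_mulN// mulr1.
Unshelve. all: end_near. Qed.

Lemma sum_truncn_le (I : Type) (s : seq I) (c : I -> R) (m : nat) :
  (forall i, 0 <= c i) -> \sum_(i <- s) c i <= 1 ->
  (\sum_(i <- s) Num.truncn (c i * m%:R) <= m)%N.
Proof.
move=> c0 c1; rewrite -(ler_nat R) natr_sum.
apply: (@le_trans _ _ (\sum_(i <- s) c i * m%:R)).
  by apply: ler_sum => i _; rewrite truncn_le// mulr_ge0.
by rewrite -mulr_suml ler_piMl.
Qed.

Lemma sum_proportional (I : Type) (s : seq I) (w : I -> R) (c : R) : (forall i, 0 < w i) -> 0 < c ->
  let W := \sum_(i <- s) w i in
  \sum_(i <- s) w i `^ (1 + r) * (c * (w i / W)) `^ (- r) = W `^ (1 + r) * c `^ (- r).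
Proof.
move=> w0 c0 W; have [->|W_neq0] := eqVneq W 0.
  rewrite big1 ?powR0 ?gt_eqF// ?mul0r// => i _.
  by rewrite invr0 !mulr0 (@powR0 _ (- r)) ?mulr0// oppr_eq0 gt_eqF.
have W0 : 0 < W by rewrite lt_neqAle eq_sym W_neq0 sumr_ge0// => i _; exact: ltW.
under eq_bigr => i _.
  rewrite (_ : _ * _ = w i / W * (W `^ (1 + r) * c `^ (- r))); last first.
    have x0 : 0 < w i / W by exact: divr_gt0.
    have xr : (w i / W) `^ (1 + r) * (w i / W) `^ (- r) = w i / W.
      by rewrite -powRD ?(gt_eqF x0) ?implybT// addrK powRr1// ltW.
    rewrite -{1}[w i](divfK W_neq0); move: (w i / W) x0 xr => x x0 xr.
    rewrite !powRM ?(ltW x0) ?(ltW W0) ?(ltW c0)// -{3}xr.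
    by move: (x `^ (1 + r)) (x `^ (- r)) (W `^ _) (c `^ _) => a b v q; ring.
  over.
by rewrite -mulr_suml -mulr_suml mulfV// mul1r.
Qed.

Section explicit.
Variables (I : choiceType) (s : seq I) (Q : I -> set X) (w : I -> R) (t eta : R).
Hypotheses (t0 : 0 < t) (t2 : t < 2^-1) (mQ : forall i, measurable (Q i)) (w0 : forall i, 0 < w i).
Hypothesis upQ : forall i, i \in s ->
  \forall k \near \oo, ((k%:R `^ r)%:E * E (Q i) k <= (w i `^ (1 + r))%:E)%E.
Local Notation rest := (O `\` \bigcup_(i in [set` s]) Q i).
Hypothesis rest_eta : (mu rest <= eta%:E)%E.

Let mcup : measurable (\bigcup_(i in [set` s]) Q i).
Proof. by rewrite bigcup_seq; exact: bigsetU_measurable. Qed.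

Let mrest : measurable rest. Proof. exact: measurableD. Qed.

Let W := \sum_(i <- s) w i.

Let W0 : 0 <= W. Proof. by apply: sumr_ge0 => i _; exact: ltW. Qed.

Let wW i : i \in s -> 0 < w i / W.
Proof.
move=> is_; rewrite divr_gt0// /W (big_rem i is_)/= ltr_pwDl// sumr_ge0// => j _; exact: ltW.
Qed.

Let best_err_split (k : I -> nat) (k' m : nat) : (\sum_(i <- s) k i + k' <= m)%N ->
  (E O m <= \sum_(i <- s) E (Q i) (k i) + E rest k')%E.
Proof.
move=> km; apply: le_trans (best_err_nonincreasing mu e A O km) _.
apply: (@le_trans _ _ (E (\bigcup_(i in [set` s]) Q i) (\sum_(i <- s) k i) + E rest k')%E).
  apply: best_err_setU => // x Ox.
  by have [xQ|xQ] := pselect ((\bigcup_(i in [set` s]) Q i) x); [left|right].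
by apply: leeD => //; exact: best_err_bigcup.
Qed.

(* A proportion [t] of the pieces goes to the rest of [O], the others are distributed among the
   [Q i] in proportion to [w i]. *)
Lemma allocation_upper_explicit : \forall m \near \oo, ((m%:R `^ r)%:E * E O m <=
  (W `^ (1 + r) * (1 - 2 * t) `^ (- r) + C * eta * (t / 2) `^ (- r))%:E)%E.
Proof.
move: t0 t2 => t_gt0 t_lt2; pose c i := (1 - t) * (w i / W); pose c' i := (1 - 2 * t) * (w i / W).
have c0 i : 0 <= c i by apply: mulr_ge0; [lra|exact: divr_ge0 (ltW (w0 i)) W0].
have near_Q : \forall m \near \oo, forall i, i \in s ->
    ((m%:R `^ r)%:E * E (Q i) (Num.truncn (c i * m%:R)) <= (w i `^ (1 + r) * c' i `^ (- r))%:E)%E.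
  apply: filter_forall_seq => i is_; apply: best_err_density; [exact: ltW| | |exact: upQ].
    by rewrite mulr_gt0 ?wW//; lra.
  by rewrite ltr_pM2r ?wW//; lra.
have t4 : t / 2 < t by lra.
have near_rest := best_err_rest mrest (@subDsetl _ _ _) rest_eta (divr_gt0 t0 (ltr0n _ 2)) t4.
apply: filterS2 near_Q near_rest => m upQm up_rest.
have split_m : (\sum_(i <- s) Num.truncn (c i * m%:R) + Num.truncn (t * m%:R) <= m)%N.
  have := @sum_truncn_le _ (None :: map Some s) (fun i => if i is Some i then c i else t) m.
  rewrite !big_cons !big_map addnC; apply; first by case=> [i|] //; exact: ltW.
  rewrite -mulr_sumr -mulr_suml -/W; have [->|W_neq0] := eqVneq W 0; first by rewrite mul0r; lra.
  by rewrite mulfV//; lra.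
apply: le_trans (lee_wpmul2l _ (best_err_split split_m)) _; first by rewrite lee_fin powR_ge0.
rewrite ge0_muleDr; [|by apply: sume_ge0 => i _; exact: best_err_ge0|exact: best_err_ge0].
rewrite EFinD; apply: leeD up_rest.
rewrite ge0_sume_distrr; last by move=> i _; exact: best_err_ge0.
rewrite -sum_proportional//; last by lra.
by rewrite -sumEFin big_seq [leRHS]big_seq; apply: lee_sum => i is_; exact: upQm.
Qed.

End explicit.

Lemma allocation_upper (y Y : R) : 0 <= y -> y `^ (1 + r) < Y -> exists2 eta : R, 0 < eta &
  forall (I : choiceType) (s : seq I) (Q : I -> set X) (w : I -> R),
  (forall i, measurable (Q i)) -> (forall i, 0 < w i) -> \sum_(i <- s) w i <= y ->
  (forall i, i \in s ->
     \forall k \near \oo, ((k%:R `^ r)%:E * E (Q i) k <= (w i `^ (1 + r))%:E)%E) ->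
  (mu (O `\` \bigcup_(i in [set` s]) Q i) <= eta%:E)%E ->
  \forall m \near \oo, ((m%:R `^ r)%:E * E O m <= Y%:E)%E.
Proof.
move=> y0 yY.
have cvg_t : y `^ (1 + r) * (1 - 2 * t) `^ (- r) @[t --> (0 : R)^'+] --> y `^ (1 + r) * 1.
  apply: cvg_at_right_filter; apply: cvgM; first exact: cvg_cst.
  rewrite [X in _ --> X](_ : _ = (1 - 2 * 0) `^ (- r)); last by rewrite mulr0 subr0 powR1.
  apply: (@continuous_comp _ _ _ (fun t : R => 1 - 2 * t) (fun x : R => x `^ (- r)) 0).
    exact: (cvgB (cvg_cst _) (cvgM (cvg_cst _) cvg_id)).
  by apply: continuous_powR; rewrite mulr0 subr0.
rewrite mulr1 in cvg_t.
have [t [t0 t2 tY]] : exists t : R,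
    [/\ 0 < t, t < 2^-1 & y `^ (1 + r) * (1 - 2 * t) `^ (- r) < Y].
  near (0 : R)^'+ => t; exists t; split; near: t.
  - exact: nbhs_right_gt.
  - by apply: nbhs_right_lt; rewrite invr_gt0.
  - exact: (cvgr_lt _ cvg_t).
have [||eta eta0 eta_le] := @ex_gt0_mul_le R (C * (t / 2) `^ (- r))
  (Y - y `^ (1 + r) * (1 - 2 * t) `^ (- r)).
- by rewrite mulr_ge0// powR_ge0.
- by rewrite subr_gt0.
exists eta => // I s Q w mQ w0 wy upQ rest_eta.
apply: filterS (allocation_upper_explicit t0 t2 mQ w0 upQ rest_eta) => m /le_trans; apply.
rewrite lee_fin -lerBrDl mulrAC (le_trans eta_le)// lerB// ler_wpM2r ?powR_ge0//.
by apply: le_powR => //; [exact: ltW|apply: sumr_ge0 => i _; exact: ltW].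
Unshelve. all: end_near. Qed.

End upper.

End allocation.

(** * Local densities determine the asymptotic error *)

Definition local_density {R : realType} {n : nat} {P : eqType} (e : P -> 'rV[R]_n -> R) (A : set P)
    (r : R) (v : 'rV[R]_n -> R) (x : 'rV[R]_n) := forall eps : R, 0 < eps ->
  \forall ah \near small_cubes x, \forall k \near \oo,
  (((Num.max (v x - eps) 0 * ah.2 ^+ n) `^ (1 + r))%:E <=
   (k%:R `^ r)%:E * best_err (@leb_mx R n) e A (ccube ah.1 ah.2) k <=
   (((v x + eps) * ah.2 ^+ n) `^ (1 + r))%:E)%E.

Lemma local_density_powR {R : realType} {n : nat} {P : eqType} (e : P -> 'rV[R]_n -> R) (A : set P)
    (r : R) (w : 'rV[R]_n -> R) (x : 'rV[R]_n) : 0 < r -> 0 <= w x ->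
  (forall eps : R, 0 < eps -> \forall ah \near small_cubes x, \forall k \near \oo,
    (((w x - eps) * (ah.2 ^+ n) `^ (1 + r))%:E <=
     (k%:R `^ r)%:E * best_err (@leb_mx R n) e A (ccube ah.1 ah.2) k <=
     ((w x + eps) * (ah.2 ^+ n) `^ (1 + r))%:E)%E) ->
  (forall q x, 0 <= e q x) ->
  local_density e A r (fun x => w x `^ (1 + r)^-1) x.
Proof.
move=> r0 wx0 ew e0 eps eps0; have r1 : 0 < 1 + r by rewrite addr_gt0.
set v := w x `^ (1 + r)^-1; have v0 : 0 <= v by exact: powR_ge0.
have vw : v `^ (1 + r) = w x by rewrite powRVK.
have m0 : 0 <= Num.max (v - eps) 0 by rewrite le_max lexx orbT.
have up : w x < (v + eps) `^ (1 + r) by rewrite -vw lt_powR// ltrDl.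
have [d [d0 du dl]] : exists d, [/\ 0 < d, w x + d <= (v + eps) `^ (1 + r) &
    Num.max (v - eps) 0 `^ (1 + r) <= Num.max (w x - d) 0].
  have [v_eps|v_eps] := leP (v - eps) 0.
    exists ((v + eps) `^ (1 + r) - w x); rewrite subr_gt0 up addrC subrK lexx; split=> //.
    by rewrite powR0 ?gt_eqF// le_max lexx orbT.
  have lo : (v - eps) `^ (1 + r) < w x by rewrite -vw lt_powR// ?(ltW v_eps)// gtrBl.
  exists (Num.min ((v + eps) `^ (1 + r) - w x) (w x - (v - eps) `^ (1 + r))); split.
  - by rewrite lt_min !subr_gt0 up.
  - by rewrite -lerBrDl ge_min lexx.
  by rewrite le_max lerBrDl -lerBrDr ge_min lexx orbT.
apply: filterS2 (ew d d0) (near_small_cubes_sub (filterT : nbhs x setT)) => -[a h] /= kP [h0 _].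
have hn0 : 0 <= h ^+ n by rewrite exprn_ge0// ltW.
have ve0 : 0 <= v + eps by rewrite addr_ge0// ltW.
apply: filterS kP => k /andP[lo hi]; rewrite !powRM//; apply/andP; split; last first.
  by apply: (le_trans hi); rewrite lee_fin ler_wpM2r// powR_ge0.
apply: (@le_trans _ _ (Num.max (w x - d) 0 * (h ^+ n) `^ (1 + r))%:E).
  by rewrite lee_fin ler_wpM2r// powR_ge0.
have [_|wd0] := leP (w x - d) 0; last exact: lo.
by rewrite mul0r mule_ge0 ?lee_fin ?powR_ge0// best_err_ge0.
Qed.

Section riemann_sums.
Context {R : realType} {n : nat}.
Variables (O : set 'rV[R]_n) (v : 'rV[R]_n -> R).
Hypotheses (oO : open O) (bO : bounded_set O).
Hypotheses (cv : {in O, continuous v}) (v0 : forall x, O x -> 0 <= v x).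
Local Notation mu := (@leb_mx R n).

Definition sampled_by (s : seq 'rV[R]_n) (h : R) (c : 'rV[R]_n -> R) (eps : R) :=
  forall a x, a \in s -> ccube a h x -> `|v x - c a| <= eps.

Let mO : measurable O. Proof. exact: open_measurable_mx. Qed.
Let V := fine (mu O).
Let VE : mu O = V%:E.
Proof. by rewrite /V fineK// ge0_fin_numE//; exact: bounded_leb_mx_lty. Qed.
Let V0 : 0 <= V. Proof. by rewrite fine_ge0. Qed.
Let mv : measurable_fun O v. Proof. exact: open_continuous_measurable_fun_mx. Qed.

Let f (g : 'rV[R]_n -> R) : 'rV[R]_n -> \bar R := (EFin \o g) \_ O.

Let fE g x : O x -> f g x = (g x)%:E. Proof. by move=> Ox; rewrite /f /patch mem_set. Qed.

Let mf g : measurable_fun O g -> measurable_fun setT (f g).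
Proof. by move=> mg; apply/(measurable_restrictT _ mO); apply/measurable_EFinP. Qed.

Let f0 g : (forall x, O x -> 0 <= g x) -> forall x, (0 <= f g x)%E.
Proof. by move=> g0 x; rewrite /f /patch; case: ifPn => //; rewrite inE => /g0; rewrite lee_fin. Qed.

Let integral_f g : (\int[mu]_(x in O) f g x = \int[mu]_(x in O) (g x)%:E)%E.
Proof. by apply: eq_integral => x; rewrite inE => Ox; rewrite fE. Qed.

Lemma packing_volume_le s h : packing O s h -> \sum_(a <- s) h ^+ n <= V.
Proof.
move=> [h0 us sO ts]; rewrite -lee_fin -VE -sumEFin.
have := ge0_integral_ge_trivIset mu us mO (fun a => measurable_ccube a h)
  (measurable_cst 1%E) (fun _ => lee01) sO ts.
rewrite integral_cst// mul1e; apply: le_trans.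
rewrite le_eqVlt; apply/orP; left; apply/eqP; apply: eq_bigr => a _.
by rewrite (integral_cst mu (measurable_ccube a h)) mul1e; apply/esym/leb_mx_ccube/ltW.
Qed.

Lemma riemann_sum_upper (y : R) : (\int[mu]_(x in O) (v x)%:E < y%:E)%E ->
  \forall eps \near (0 : R)^'+, forall s h c, packing O s h -> sampled_by s h c eps ->
    \sum_(a <- s) (c a + eps) * h ^+ n <= y.
Proof.
move=> Wy; have W0 : (0 <= \int[mu]_(x in O) (v x)%:E)%E.
  by apply: integral_ge0 => x Ox; rewrite lee_fin v0.
have [W WE] : exists W : R, (\int[mu]_(x in O) (v x)%:E)%E = W%:E.
  by exists (fine (\int[mu]_(x in O) (v x)%:E)); rewrite fineK// ge0_fin_numE// (lt_trans Wy)// ltry.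
rewrite WE lte_fin in Wy.
have V2 : 0 <= 2 * V by rewrite mulr_ge0.
have yW0 : 0 < y - W by rewrite subr_gt0.
have [d d0 dV] := ex_gt0_mul_le V2 yW0.
near=> eps => s h c sh c_eps; have [h0 us sO ts] := sh.
have eps0 : 0 < eps by near: eps; exact: nbhs_right_gt.
have eps_d : eps <= d by near: eps; exact: nbhs_right_le.
rewrite -lee_fin -sumEFin.
apply: (@le_trans _ _ (\sum_(a <- s) \int[mu]_(x in ccube a h) f (fun x => v x + 2 * eps)%R x)%E).
  rewrite big_seq [leRHS]big_seq; apply: lee_sum => a as_.
  have ca : 0 <= c a + eps.
    have corner := ccube_corner a (ltW h0); have := c_eps a a as_ corner.
    by have := v0 (sO a as_ a corner); rewrite ler_norml => va /andP[_ ?]; lra.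
  rewrite EFinM -(leb_mx_ccube a (ltW h0)); apply: ge0_integral_ge_cst => //.
  - exact: measurable_ccube.
  - by apply: mf; exact: measurable_funD.
  move=> x ax; rewrite fE; last exact: sO ax.
  by rewrite lee_fin; have := c_eps a x as_ ax; rewrite ler_norml => /andP[? ?]; lra.
apply: le_trans (ge0_integral_ge_trivIset mu us mO (fun a => measurable_ccube a h) _ _ sO ts) _.
- by apply: mf; exact: measurable_funD.
- by apply: f0 => x Ox; rewrite addr_ge0 ?v0// mulr_ge0// ltW.
rewrite integral_f; under eq_integral do rewrite EFinD.
rewrite ge0_integralD//=; last 2 first.
- by apply/measurable_EFinP.
- by move=> x _; rewrite lee_fin mulr_ge0// ltW.
rewrite integral_cst// WE [X in (_ * X)%E]VE -EFinM -EFinD lee_fin -lerBrDl (le_trans _ dV)//.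
by rewrite mulrAC ler_wpM2l.
Unshelve. all: end_near. Qed.

Lemma ex_truncated_integral_gt (y : R) : (y%:E < \int[mu]_(x in O) (v x)%:E)%E ->
  exists2 M : R, 0 <= M & (y%:E < \int[mu]_(x in O) (Num.min (v x) M)%:E)%E.
Proof.
move=> yW.
have cvgW : (\int[mu]_(x in O) (Num.min (v x) k%:R)%:E)%E @[k --> \oo] -->
    (\int[mu]_(x in O) (v x)%:E)%E.
  rewrite [X in _ --> X](_ : _ = \int[mu]_(x in O) limn (fun k => (Num.min (v x) k%:R)%:E))%E.
    apply: cvg_monotone_convergence => //.
    - by move=> k; apply/measurable_EFinP; apply: measurable_minr.
    - by move=> k x Ox; rewrite lee_fin le_min v0/=.
    - by move=> x Ox a b ab; rewrite lee_fin le_min !ge_min lexx/= ler_nat ab orbT.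
  apply: eq_integral => x; rewrite inE => Ox; apply/esym/cvg_lim => //.
  apply: cvg_near_cst; near=> k; rewrite min_l//; near: k; exact: nbhs_infty_ger.
have [k _ /(_ k (leqnn k)) yk] := cvgW _ (open_ereal_gt' yW).
by exists k%:R.
Unshelve. all: end_near. Qed.

Let vM (M x : R) : R := Num.min x M.

Let integral_vM_le (M : R) (D : set 'rV[R]_n) : 0 <= M -> measurable D -> D `<=` O ->
  (\int[mu]_(x in D) f (vM M \o v) x <= M%:E * mu D)%E.
Proof.
move=> M0 mD DO; apply: ge0_integral_le_cst => //.
- by apply: mf; exact: measurable_minr.
- by apply: f0 => x Ox; rewrite /= /vM le_min v0.
- by move=> x /DO Ox; rewrite fE// lee_fin ge_min lexx orbT.
Qed.

Lemma truncated_integral_le (M eps h : R) s c : 0 <= M -> packing O s h ->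
  sampled_by s h c eps -> (mu (O `\` cubes s h) <= eps%:E)%E ->
  (\int[mu]_(x in O) (Num.min (v x) M)%:E <=
   (M * eps + \sum_(a <- s) (Num.max (c a - eps) 0 + 2 * eps) * h ^+ n)%:E)%E.
Proof.
move=> M0 [h0 us sO ts] c_eps rest_eps; rewrite -integral_f -/(vM M \o v).
have mfM : measurable_fun setT (f (vM M \o v)) by apply: mf; exact: measurable_minr.
have fM0 x : (0 <= f (vM M \o v) x)%E by apply: f0 => y Oy; rewrite /= /vM le_min v0.
have mU := measurable_cubes s h.
have mOU : measurable (O `\` cubes s h) by exact: measurableD.
have cube_le a : a \in s -> (\int[mu]_(x in ccube a h) f (vM M \o v) x <=
    ((Num.max (c a - eps) 0 + 2 * eps) * h ^+ n)%:E)%E.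
  move=> as_; rewrite EFinM -(leb_mx_ccube a (ltW h0)).
  apply: ge0_integral_le_cst => //; first exact: measurable_ccube.
  move=> x ax; rewrite fE; last exact: sO ax.
  have : c a - eps <= Num.max (c a - eps) 0 by rewrite le_max lexx.
  rewrite lee_fin ge_min; have := c_eps a x as_ ax; rewrite ler_norml => /andP[? ?] ?.
  by apply/orP; left; lra.
have := ge0_integral_le_cover mu (s := None :: map Some s)
  (Q := fun i => if i is Some a then ccube a h else O `\` cubes s h) mO _ mfM fM0 _.
rewrite big_cons big_map EFinD -sumEFin => cover; apply: le_trans (cover _ _) _.
- by case=> [a|]; [exact: measurable_ccube|].
- move=> x Ox; have [[a as_ ax]|xU] := pselect (cubes s h x); last by exists None => //=.
  by exists (Some a) => //=; rewrite inE /= map_f.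
apply: leeD; last by rewrite big_seq [leRHS]big_seq; exact: lee_sum.
by rewrite (le_trans (integral_vM_le M0 mOU _))// EFinM lee_wpmul2l.
Qed.

Lemma riemann_sum_lower (y : R) : (y%:E < \int[mu]_(x in O) (v x)%:E)%E ->
  \forall eps \near (0 : R)^'+, forall s h c, packing O s h -> sampled_by s h c eps ->
    (mu (O `\` cubes s h) <= eps%:E)%E -> y < \sum_(a <- s) Num.max (c a - eps) 0 * h ^+ n.
Proof.
move=> /ex_truncated_integral_gt[M M0].
have [W WE] : exists W : R, (\int[mu]_(x in O) (Num.min (v x) M)%:E)%E = W%:E.
  exists (fine (\int[mu]_(x in O) (Num.min (v x) M)%:E)); rewrite fineK// ge0_fin_numE.
    by rewrite -integral_f (le_lt_trans (integral_vM_le M0 mO _))// VE -EFinM ltry.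
  by apply: integral_ge0 => x Ox; rewrite lee_fin le_min v0.
rewrite WE lte_fin => yW.
have MV0 : 0 <= M + 2 * V by rewrite addr_ge0// mulr_ge0.
have Wy0 : 0 < (W - y) / 2 by rewrite divr_gt0// subr_gt0.
have [d d0 dMV] := ex_gt0_mul_le MV0 Wy0.
near=> eps => s h c sh c_eps rest_eps.
have eps0 : 0 < eps by near: eps; exact: nbhs_right_gt.
have eps_d : eps <= d by near: eps; exact: nbhs_right_le.
have := truncated_integral_le M0 sh c_eps rest_eps; rewrite WE lee_fin.
rewrite (_ : \sum_(a <- s) _ = \sum_(a <- s) Num.max (c a - eps) 0 * h ^+ n +
    2 * eps * \sum_(a <- s) h ^+ n); last first.
  by rewrite mulr_sumr -big_split; apply: eq_bigr => a _; rewrite mulrDl.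
have h_V := packing_volume_le sh.
have : M * eps + 2 * eps * \sum_(a <- s) h ^+ n <= (W - y) / 2.
  apply: le_trans dMV; apply: (@le_trans _ _ ((M + 2 * V) * eps)); last by rewrite ler_wpM2l.
  by rewrite [leRHS]mulrDl lerD2l [leRHS]mulrAC ler_wpM2l// mulr_ge0// ltW.
by lra.
Unshelve. all: end_near. Qed.

End riemann_sums.

Section density_limit.
Context {R : realType} {n : nat} {P : eqType}.
Variables (e : P -> 'rV[R]_n -> R) (A : set P) (O : set 'rV[R]_n) (r C : R) (v : 'rV[R]_n -> R).
Local Notation mu := (@leb_mx R n).
Local Notation E := (best_err mu e A).
Hypotheses (r0 : 0 < r) (oO : open O) (bO : bounded_set O).
Hypothesis e0 : forall q x, 0 <= e q x.
Hypothesis me : forall q, measurable_fun setT (e q).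
Hypotheses (cv : {in O, continuous v}) (v0 : forall x, O x -> 0 <= v x).
Hypothesis dv : forall x, O x -> local_density e A r v x.
Hypothesis sep : forall a b (h : R), 0 < h -> ccube a h `<=` O -> ccube b h `<=` O ->
  ccube a h `&` ccube b h = set0 -> separated e A (ccube a h) (ccube b h).
Hypotheses (C0 : 0 <= C) (rate : uniform_bound e A O r C).
Local Notation W := (\int[mu]_(x in O) (v x)%:E)%E.

Let r1 : 0 < 1 + r. Proof. by rewrite addr_gt0. Qed.
Let mO : measurable O. Proof. exact: open_measurable_mx. Qed.

Let ex_sampled_packing (eps : R) : 0 < eps -> exists s h c,
  [/\ packing O s h, (mu (O `\` cubes s h) <= eps%:E)%E, sampled_by v s h c eps,
    forall a, 0 <= c a & forall a, a \in s -> \forall k \near \oo,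
    (((Num.max (c a - eps) 0 * h ^+ n) `^ (1 + r))%:E <= (k%:R `^ r)%:E * E (ccube a h) k <=
     (((c a + eps) * h ^+ n) `^ (1 + r))%:E)%E].
Proof.
move=> eps0; pose G (a : 'rV[R]_n) (h : R) := exists c : R, [/\ 0 <= c,
  forall x, ccube a h x -> `|v x - c| <= eps & \forall k \near \oo,
    (((Num.max (c - eps) 0 * h ^+ n) `^ (1 + r))%:E <= (k%:R `^ r)%:E * E (ccube a h) k <=
     (((c + eps) * h ^+ n) `^ (1 + r))%:E)%E].
have [x Ox|s [h [sh sG rest]]] := @cube_packing R n O G eps oO bO _ eps0.
  have near_v : \forall y \near x, `|v y - v x| <= eps.
    by apply: cvgr_distC_le (cv (mem_set Ox)) _ _.
  apply: filterS2 (near_small_cubes_sub near_v) (dv Ox eps0) => -[a h] /= [_ osc] dens.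
  by exists (v x); split=> //; exact: v0.
have /choice[c cP] a : exists c : R, 0 <= c /\ (a \in s -> G a h -> [/\ 
    forall x, ccube a h x -> `|v x - c| <= eps & \forall k \near \oo,
    (((Num.max (c - eps) 0 * h ^+ n) `^ (1 + r))%:E <= (k%:R `^ r)%:E * E (ccube a h) k <=
     (((c + eps) * h ^+ n) `^ (1 + r))%:E)%E]).
  have [as_|nas] := boolP (a \in s); last by exists 0.
  by have [c [c0 osc dens]] := sG a as_; exists c; split.
exists s, h, c; split=> //.
- by move=> a x as_; have [_ /(_ as_ (sG a as_))[+ _]] := cP a; apply.
- by move=> a; have [] := cP a.
- by move=> a as_; have [_ /(_ as_ (sG a as_))[]] := cP a.
Qed.

Let limit_lower (y : R) : 0 <= y -> (y%:E < W)%E ->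
  \forall m \near \oo, ((y `^ (1 + r))%:E <= (m%:R `^ r)%:E * E O m)%E.
Proof.
move=> y0 yW; near (0 : R)^'+ => eps.
have eps0 : 0 < eps by near: eps; exact: nbhs_right_gt.
have [s [h [c [sh rest osc c0 dens]]]] := ex_sampled_packing eps0.
have y_sum : y < \sum_(a <- s) Num.max (c a - eps) 0 * h ^+ n.
  by move: s h c sh rest osc {c0 dens}; near: eps; apply: filterS (riemann_sum_lower oO bO cv v0 yW) =>
    eps y_sum s h c sh rest osc; exact: y_sum.
have [h0 us sO ts] := sh.
apply: (@allocation_lower _ _ R mu P e A O r r0 mO e0 me C C0 rate _ s (fun a => ccube a h)
  (fun a => Num.max (c a - eps) 0 * h ^+ n)) => //.
- by move=> a; exact: measurable_ccube.
- move=> a b as_ bs ab; apply: (sep h0 (sO _ as_) (sO _ bs)).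
  by apply/eqP/negPn/negP => /set0P/(ts a b as_ bs)/eqP; rewrite (negbTE ab).
- by move=> a; rewrite mulr_ge0 ?exprn_ge0 ?(ltW h0)// le_max lexx orbT.
- by move=> a /dens; apply: filterS => k /andP[].
Unshelve. all: end_near. Qed.

Let limit_upper (y : R) : (W < y%:E)%E ->
  \forall m \near \oo, ((m%:R `^ r)%:E * E O m <= (y `^ (1 + r))%:E)%E.
Proof.
move=> Wy; have W0 : (0 <= W)%E by apply: integral_ge0 => x Ox; rewrite lee_fin v0.
have [y1 Wy1 y1y] : exists2 y1 : R, (W < y1%:E)%E & y1 < y.
  have fW : W \is a fin_num by rewrite ge0_fin_numE// (lt_trans Wy)// ltry.
  rewrite -(fineK fW) lte_fin in Wy *; exists ((fine W + y) / 2); first by rewrite lte_fin; lra.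
  by lra.
have y1_ge0 : 0 <= y1 by rewrite -lee_fin (le_trans W0)// ltW.
have [eta eta0 alloc] := @allocation_upper _ _ R mu P e A O r r0 mO e0 me C C0 rate _ _ y1_ge0
  (lt_powR r1 y1_ge0 y1y).
near (0 : R)^'+ => eps.
have eps0 : 0 < eps by near: eps; exact: nbhs_right_gt.
have eps_eta : eps <= eta by near: eps; exact: nbhs_right_le.
have [s [h [c [sh rest osc c0 dens]]]] := ex_sampled_packing eps0.
have sum_y : \sum_(a <- s) (c a + eps) * h ^+ n <= y1.
  by move: s h c sh osc {rest c0 dens}; near: eps; exact: riemann_sum_upper.
have [h0 us sO ts] := sh.
apply: (alloc _ s (fun a => ccube a h) (fun a => (c a + eps) * h ^+ n)) => //.
- by move=> a; exact: measurable_ccube.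
- by move=> a; rewrite mulr_gt0 ?exprn_gt0// ltr_wpDl.
- by move=> a /dens; apply: filterS => k /andP[].
- rewrite (_ : \bigcup_(a in _) _ = cubes s h); last first.
    by apply/seteqP; split=> x [a as_ ax]; exists a.
  by rewrite (le_trans rest)// lee_fin.
Unshelve. all: end_near. Qed.

Let integral_density_fin : (W < +oo)%E.
Proof.
rewrite ltNge leye_eq; apply/negP => /eqP WE.
have VE : mu O = (fine (mu O))%:E by rewrite fineK// ge0_fin_numE//; exact: bounded_leb_mx_lty.
have rest_V : (mu (O `\` \bigcup_(a in [set` ([::] : seq 'rV[R]_n)]) ccube a 1) <= (fine (mu O))%:E)%E.
  by rewrite set_nil bigcup_set0 setD0 -VE.
have t0 : 0 < 4^-1 :> R by rewrite invr_gt0.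
have t2 : 4^-1 < 2^-1 :> R by rewrite ltf_pV2 ?posrE// ltr_nat.
have := allocation_upper_explicit r0 mO e0 me C0 rate t0 t2
  (fun a => measurable_ccube a 1) (fun _ => ltr01) _ rest_V.
rewrite big_nil powR0 ?gt_eqF// mul0r add0r; set B := C * _ * _ => upB.
have B0 : 0 <= B by rewrite !mulr_ge0 ?powR_ge0// fine_ge0.
have lowB := limit_lower (powR_ge0 (B + 1) (1 + r)^-1); rewrite WE ltry in lowB.
near \oo => m; have : ((((B + 1) `^ (1 + r)^-1) `^ (1 + r))%:E <= B%:E)%E.
  apply: (@le_trans _ _ ((m%:R `^ r)%:E * E O m)%E); near: m; first exact: lowB.
  by apply: upB => a; rewrite in_nil.
by rewrite powRVK ?lee_fin ?addr_ge0//; lra.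
Unshelve. all: end_near. Qed.

Theorem density_limit : (W < +oo)%E /\
  ((m%:R `^ r)%:E * E O m)%E @[m --> \oo] --> ((fine W) `^ (1 + r))%:E.
Proof.
split; first exact: integral_density_fin.
have W0 : (0 <= W)%E by apply: integral_ge0 => x Ox; rewrite lee_fin v0.
have fW : W \is a fin_num by rewrite ge0_fin_numE//; exact: integral_density_fin.
have w0 : 0 <= fine W by exact: fine_ge0.
apply/cvg_EFin_leP => eps eps0.
have upper : \forall m \near \oo, ((m%:R `^ r)%:E * E O m <= (fine W `^ (1 + r) + eps)%:E)%E.
  have pos : 0 <= fine W `^ (1 + r) + eps by rewrite addr_ge0 ?powR_ge0// ltW.
  rewrite -(powRVK r1 pos); apply: limit_upper.
  rewrite -[ltLHS](fineK fW) lte_fin -[ltLHS](powRK r1 w0).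
  by apply: lt_powR; rewrite ?invr_gt0 ?powR_ge0// ltrDl.
have [neg|pos] := ltP (fine W `^ (1 + r) - eps) 0.
  apply: filterS upper => m -> ; rewrite andbT (@le_trans _ _ 0%E)//; first by rewrite lee_fin ltW.
  by rewrite mule_ge0 ?lee_fin ?powR_ge0//; exact: best_err_ge0.
have lower := limit_lower (powR_ge0 (fine W `^ (1 + r) - eps) (1 + r)^-1).
rewrite powRVK// in lower; apply: filterS2 upper (lower _) => [m -> ->//|].
rewrite -[ltRHS](fineK fW) lte_fin -[ltRHS](powRK r1 w0).
by apply: lt_powR; rewrite ?invr_gt0// gtrBl.
Qed.

End density_limit.

(** * Quantization of the Lebesgue measure *)

Section dotr.
Context {R : realType} {n : nat}.
Implicit Types (x y : 'rV[R]_n).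

Lemma dotrC x y : dotr x y = dotr y x.
Proof. by apply: eq_bigr => i _; rewrite mulrC. Qed.

Let dotr_is_scalar x : scalar (dotr x).
Proof.
move=> c y z; rewrite /dotr mulr_sumr -big_split/=.
by apply: eq_bigr => i _; rewrite !mxE mulrDr mulrCA.
Qed.

HB.instance Definition _ x := GRing.isLinear.Build R 'rV[R]_n R *%R (dotr x) (dotr_is_scalar x).

Lemma dotr_ge0 x : 0 <= dotr x x.
Proof. by apply: sumr_ge0 => i _; rewrite -expr2 sqr_ge0. Qed.

Lemma dotrZZ (h : R) x : dotr (h *: x) (h *: x) = h ^+ 2 * dotr x x.
Proof. by rewrite linearZ/= dotrC linearZ/= mulrA -expr2. Qed.

Lemma sqr_dotrD x y : dotr (x + y) (x + y) = dotr x x + 2 * dotr x y + dotr y y.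
Proof. by rewrite linearD/= ![dotr (x + y) _]dotrC !linearD/= [dotr y x]dotrC; ring. Qed.

Lemma sqr_entry_le_dotr x j : (x 0 j) ^+ 2 <= dotr x x.
Proof.
rewrite /dotr (bigD1 j)//= -expr2 lerDl; apply: sumr_ge0 => i _.
by rewrite -expr2 sqr_ge0.
Qed.

Lemma norm_dotr_le x y : `|dotr x y| <= n%:R * (`|x| * `|y|).
Proof.
apply: (le_trans (ler_norm_sum _ _ _)).
apply: (@le_trans _ _ (\sum_(i < n) `|x| * `|y|)); last by rewrite sumr_const card_ord mulr_natl.
by apply: ler_sum => i _; rewrite normrM ler_pM// mx_entry_le_norm.
Qed.

Lemma dotr_le_norm x : dotr x x <= n%:R * `|x| ^+ 2.
Proof. by rewrite expr2; apply: le_trans (ler_norm _) (norm_dotr_le x x). Qed.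

Lemma sqr_norm_le_dotr x : `|x| ^+ 2 <= dotr x x.
Proof.
rewrite -[leRHS]sqr_sqrtr ?dotr_ge0// lerXn2r ?nnegrE ?sqrtr_ge0//.
apply/(mx_norm_leP _ (sqrtr_ge0 _)) => i j; rewrite (ord1 i) -sqrtr_sqr ler_wsqrtr//.
exact: sqr_entry_le_dotr.
Qed.

Lemma enorm_powR (p : R) x : 0 < p -> enorm x `^ (2 * p) = dotr x x `^ p.
Proof.
by move=> p0; rewrite /enorm -powR12_sqrt ?dotr_ge0// -powRrM; congr powR; field.
Qed.

Lemma measurable_dotr d (T : measurableType d) (f g : T -> 'rV[R]_n) :
  measurable_fun setT f -> measurable_fun setT g ->
  measurable_fun setT (fun t => dotr (f t) (g t)).
Proof.
move=> mf mg; apply: measurable_sum => i; apply: measurable_funM.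
- exact: (measurableT_comp (measurable_entry 0 i) mf).
- exact: (measurableT_comp (measurable_entry 0 i) mg).
Qed.

Definition dist_pow (p : R) (z x : 'rV[R]_n) : R := dotr (x - z) (x - z) `^ p.

Lemma dist_pow_ge0 p z x : 0 <= dist_pow p z x.
Proof. exact: powR_ge0. Qed.

Lemma measurable_dist_pow p z : measurable_fun setT (dist_pow p z).
Proof.
have msub : measurable_fun setT (fun x : 'rV[R]_n => x - z).
  by have := @measurable_mulmx_add R n n 1%:M (- z); under eq_fun do rewrite mulmx1.
apply: (measurableT_comp (measurable_powR p)); exact: measurable_dotr.
Qed.

End dotr.

Section best_err_changes.
Context {R : realType} {n : nat}.
Local Notation mu := (@leb_mx R n).

Lemma best_err_mulmx_trig {P P' : eqType} (e : P -> 'rV[R]_n -> R) (e' : P' -> 'rV[R]_n -> R)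
    (A : set P) (A' : set P') (phi : P' -> P) (psi : P -> P') (k : R)
    (B : 'M[R]_n) (c : 'rV[R]_n) (D : set 'rV[R]_n) m :
  is_trig_mx B^T -> B \in unitmx -> measurable D -> 0 < k ->
  (forall q x, 0 <= e q x) -> (forall q, measurable_fun setT (e q)) ->
  (forall q, A' q -> A (phi q)) -> (forall q, A q -> A' (psi q)) -> cancel psi phi ->
  (forall q x, e (phi q) (x *m B + c) = k * e' q x) ->
  best_err mu e A D m =
    ((`|\det B| * k)%:E * best_err mu e' A' [set x | D (x *m B + c)%R] m)%E.
Proof.
move=> tB uB mD k0 e0 me phiA psiA psiK eE.
have e'E q x : e' q x = k^-1 * e (phi q) (x *m B + c) by rewrite eE mulKf ?gt_eqF.
have e'0 q x : 0 <= e' q x by rewrite e'E mulr_ge0// invr_ge0 ltW.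
have me' q : measurable_fun setT (e' q).
  apply: (eq_measurable_fun (fun x => k^-1 * e (phi q) (x *m B + c))) => [x _|]; first exact/esym/e'E.
  by apply: measurable_funM => //; exact: (measurableT_comp (me _) (measurable_mulmx_add B c)).
set D' := [set x | _]; have mD' : measurable D'.
  by rewrite -[D']setTI; exact: measurable_mulmx_add.
have dB0 : 0 < `|\det B| by rewrite normr_gt0 -unitfE -unitmxE.
have dBk : 0 < `|\det B| * k by rewrite mulr_gt0.
have err_phi s x : err e (map phi s) (x *m B + c) = (k%:E * err e' s x)%E by exact: err_map.
have integral_phi s : (\int[mu]_(x in D) err e (map phi s) x =
    (`|\det B| * k)%:E * \int[mu]_(x in D') err e' s x)%E.
  have err0 t x : (0 <= err e t x)%E by exact: err_ge0.
  have merr t : measurable_fun setT (err e t) by exact: measurable_err.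
  rewrite (ge0_integral_mulmx_trig c tB uB mD (merr _) (err0 _)) EFinM -muleA; congr (_ * _)%E.
  under eq_integral do rewrite err_phi.
  rewrite ge0_integralZl//; last by rewrite lee_fin ltW.
  - by apply: measurable_funTS; exact: measurable_err.
  - by move=> x _; exact: err_ge0.
apply/eqP; rewrite eq_le; apply/andP; split.
  rewrite -lee_pdivrMl//; apply: le_best_err => s sm sA'; rewrite lee_pdivrMl// -integral_phi.
  by apply: best_err_le; rewrite ?size_map// => _ /mapP[q /sA' qA' ->]; exact: phiA.
apply: le_best_err => s sm sA; rewrite -[s](mapK psiK) integral_phi lee_pmul2l//.
by apply: best_err_le; rewrite ?size_map// => _ /mapP[q /sA qA ->]; exact: psiA.
Qed.

Lemma eq_best_err {P : eqType} (e : P -> 'rV[R]_n -> R) (A : set P) (D D' : set 'rV[R]_n) m :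
  (forall s, \int[mu]_(x in D) err e s x = \int[mu]_(x in D') err e s x)%E ->
  best_err mu e A D m = best_err mu e A D' m.
Proof. by move=> DD'; congr ereal_inf; apply/seteqP; split=> _ [s [? ? ->]]; exists s. Qed.

End best_err_changes.

Section self_similar.
Context {R : realType}.

Let near_truncn_ge (g : R) : g < 1 -> \forall t \near +oo, g * t <= (Num.truncn t)%:R.
Proof.
move=> g1; near=> t; have := truncnS_gt t; rewrite -natr1.
have : 1 <= (1 - g) * t.
  by rewrite mulrC -ler_pdivrMr ?subr_gt0//; near: t; exact: nbhs_pinfty_ge.
by lra.
Unshelve. all: end_near. Qed.

Variables (n : nat) (r : R) (a : nat -> \bar R).
Hypotheses (n0 : (0 < n)%N) (r0 : 0 < r).
Hypotheses (a0 : forall m, (0 <= a m)%E) (a1 : (a 1%N < +oo)%E).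
Hypothesis anoninc : forall k m, (k <= m)%N -> (a m <= a k)%E.
Hypothesis a_self_similar : forall K m, (0 < K)%N ->
  (a (K ^ n * m)%N <= (K%:R `^ (- (n%:R * r)))%:E * a m)%E.

Local Notation values := [set ((m%:R `^ r)%:E * a m)%E | m in [set m | (0 < m)%N]].

Lemma fine_self_similar_inf : ereal_inf values = (fine (ereal_inf values))%:E.
Proof.
rewrite fineK// ge0_fin_numE; last first.
  by apply: le_ereal_inf_tmp => _ [m _ <-]; rewrite mule_ge0 ?lee_fin ?powR_ge0.
apply: (@le_lt_trans _ _ (a 1%N)) => //; apply: ereal_inf_lbound; exists 1%N => //.
by rewrite powR1 mul1e.
Qed.

Lemma self_similar_root (g : R) (m M : nat) : (0 < m)%N -> (0 < M)%N -> 0 < g ->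
  let t : R := (M%:R / m%:R) `^ n%:R^-1 in g * t <= (Num.truncn t)%:R ->
  ((M%:R `^ r)%:E * a M <= (g `^ (- (n%:R * r)))%:E * ((m%:R `^ r)%:E * a m))%E.
Proof.
move=> m0 M0 g0 t gt; have n0' : 0 < n%:R :> R by rewrite ltr0n.
have m0' : 0 < m%:R :> R by rewrite ltr0n.
have M0' : 0 < M%:R :> R by rewrite ltr0n.
have t0 : 0 < t by rewrite powR_gt0// divr_gt0.
have tn : t `^ n%:R = M%:R / m%:R by rewrite powRVK// divr_ge0// ltW.
set K := Num.truncn t in gt.
have K0 : 0 < K%:R :> R by apply: lt_le_trans gt; rewrite mulr_gt0.
have KM : (K ^ n * m <= M)%N.
  rewrite -(ler_nat R) natrM natrX -ler_pdivlMr// -tn powR_mulrn ?(ltW t0)//.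
  by rewrite lerXn2r ?nnegrE ?(ltW t0)// truncn_le// ltW.
apply: (@le_trans _ _ ((M%:R `^ r)%:E * ((K%:R `^ (- (n%:R * r)))%:E * a m))%E).
  rewrite lee_wpmul2l ?lee_fin ?powR_ge0//.
  by apply: le_trans (anoninc KM) (a_self_similar _ _); rewrite -(ltr_nat R).
rewrite !muleA -!EFinM lee_wpmul2r// lee_fin.
apply: (@le_trans _ _ (M%:R `^ r * (g * t) `^ (- (n%:R * r)))).
  by rewrite ler_wpM2l ?powR_ge0// le_powRN ?mulr_gt0// ltW// mulr_gt0.
rewrite powRM ?(ltW g0) ?(ltW t0)// mulrCA ler_wpM2l ?powR_ge0//.
rewrite -mulrN powRrM tn powRM ?invr_ge0 ?(ltW M0') ?(ltW m0')//.
by rewrite powRVN ?(ltW m0')// mulrA powR_mulN// mul1r.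
Qed.

Lemma self_similar_cvg :
  ((m%:R `^ r)%:E * a m)%E @[m --> \oo] --> (fine (ereal_inf values))%:E.
Proof.
apply/cvg_EFin_leP => eps eps0; set d := fine _.
have [m m0 m_lt] : exists2 m, (0 < m)%N & ((m%:R `^ r)%:E * a m < (d + eps)%:E)%E.
  have : (ereal_inf values < (d + eps)%:E)%E by rewrite fine_self_similar_inf lte_fin ltrDl.
  by move=> /ereal_inf_lt[_ [m m0 <-] m_lt]; exists m.
have [v vE] : exists v : R, ((m%:R `^ r)%:E * a m)%E = v%:E.
  exists (fine ((m%:R `^ r)%:E * a m)); rewrite fineK// ge0_fin_numE; first exact: lt_trans m_lt (ltry _).
  by rewrite mule_ge0// lee_fin powR_ge0.
rewrite vE lte_fin in m_lt.
have [g [g0 g1 g_le]] : exists g : R, [/\ 0 < g, g < 1 & g `^ (- (n%:R * r)) * v <= d + eps].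
  have cvg1 : g `^ (- (n%:R * r)) * v @[g --> (1 : R)^'-] --> 1 `^ (- (n%:R * r)) * v.
    by apply: cvg_at_left_filter; apply: cvgMr_tmp; exact: continuous_powR.
  near (1 : R)^'- => g; exists g; split.
  - by near: g; exact: nbhs_left_gt.
  - by near: g; exact: nbhs_left_lt.
  by near: g; apply: (cvgr_le _ cvg1); rewrite powR1 mul1r.
have cvg_root : (M%:R / m%:R : R) `^ n%:R^-1 @[M --> \oo] --> +oo.
  apply/cvgryPge => A; near=> M; pose b := Num.max A 0; have b0 : 0 <= b by rewrite le_max lexx orbT.
  apply: (@le_trans _ _ b); first by rewrite le_max lexx.
  rewrite -[leLHS](powRK (r := n%:R)) ?ltr0n// le_powR ?powR_ge0 ?invr_ge0//.
  by rewrite ler_pdivlMr ?ltr0n//; near: M; exact: nbhs_infty_ger.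
near=> M; have M0 : (0 < M)%N by near: M; exact: nbhs_infty_gt.
apply/andP; split.
  apply: (@le_trans _ _ d%:E); first by rewrite lee_fin gerBl ltW.
  by rewrite -fine_self_similar_inf; apply: ereal_inf_lbound; exists M.
apply: le_trans (self_similar_root m0 M0 g0 _) _; last by rewrite vE -EFinM lee_fin.
by near: M; exact: cvg_root (near_truncn_ge g1).
Unshelve. all: end_near. Qed.

End self_similar.

Section cube_quantization.
Context {R : realType} (n : nat) (p : R).
Hypotheses (n0 : (0 < n)%N) (p0 : 0 < p).
Local Notation mu := (@leb_mx R n).
Local Notation e := (@dist_pow R n p).
Local Notation r := (2 * p / n%:R).
Local Notation unit_cube := (ccube (0 : 'rV[R]_n) 1).

Let nR0 : 0 < n%:R :> R. Proof. by rewrite ltr0n. Qed.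
Let r0 : 0 < r. Proof. by rewrite divr_gt0// mulr_gt0. Qed.

Lemma best_err_ccube (a : 'rV[R]_n) (h : R) m : 0 < h ->
  best_err mu e setT (ccube a h) m =
  (((h ^+ n) `^ (1 + r))%:E * best_err mu e setT unit_cube m)%E.
Proof.
move=> h0; have hn0 : 0 < h ^+ n by rewrite exprn_gt0.
have trig : is_trig_mx (h%:M : 'M[R]_n)^T by rewrite tr_scalar_mx scalar_mx_is_trig.
have unit : (h%:M : 'M[R]_n) \in unitmx by rewrite unitmxE det_scalar unitfE gt_eqF.
rewrite (@best_err_mulmx_trig _ _ _ _ _ e _ setT (fun z => h *: z + a) (fun z => h^-1 *: (z - a))
  ((h ^+ 2) `^ p) h%:M a _ m trig unit (measurable_ccube a h))//.
- have -> : [set x | ccube a h (x *m h%:M + a)] = unit_cube.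
    apply/seteqP; split=> x xa j; have := xa j; rewrite mul_mx_scalar !mxE => /andP[xl xr];
      by apply/andP; split; nra.
  congr (_%:E * _)%E.
    rewrite det_scalar gtr0_norm// powRD ?(gt_eqF hn0) ?implybT// powRr1 ?(ltW hn0)//.
    by congr (_ * _); rewrite !powR_exprn ?(ltW h0)//; congr powR; field; rewrite gt_eqF.
- by rewrite powR_gt0// exprn_gt0.
- exact: dist_pow_ge0.
- exact: measurable_dist_pow.
- by move=> z; rewrite scalerA mulfV ?gt_eqF// scale1r subrK.
move=> z x; rewrite /dist_pow -powRM ?sqr_ge0 ?dotr_ge0// -dotrZZ mul_mx_scalar.
by rewrite opprD addrACA subrr addr0 scalerBr.
Qed.

Lemma best_err_ccube_self_similar K m : (0 < K)%N ->
  (best_err mu e setT unit_cube (K ^ n * m) <=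
   (K%:R `^ (- (n%:R * r)))%:E * best_err mu e setT unit_cube m)%E.
Proof.
move=> K0; have K0' : 0 < K%:R :> R by rewrite ltr0n.
have Ki0 : 0 < K%:R^-1 :> R by rewrite invr_gt0.
have := @best_err_bigcup _ _ R mu _ e setT (@dist_pow_ge0 R n p) (@measurable_dist_pow R n p) _
  (enum {: 'rV['I_K]_n}) (fun k => ccube (gridpt (0 : 'rV[R]_n) K%:R^-1 k) K%:R^-1) unit_cube (fun=> m)
  (measurable_ccube _ _) (fun k => measurable_ccube _ _).
rewrite big_const_seq count_predT -cardE card_grid iter_addn_0 mulnC => cover.
apply: (le_trans (cover _)) => [x x1|].
  have xK : ccube 0 (K%:R^-1 * K%:R) x by rewrite mulVf ?gt_eqF.
  by have [k xk] := ccube_grid K0 Ki0 xK; exists k => //=; rewrite mem_enum.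
under eq_bigr do rewrite best_err_ccube//.
rewrite -ge0_sume_distrl => [|k _]; last by rewrite lee_fin powR_ge0.
rewrite sumEFin big_const_seq count_predT -cardE card_grid iter_addr_0 -[_ *+ (K ^ n)]mulr_natl.
rewrite lee_wpmul2r//; first exact: best_err_ge0 (@dist_pow_ge0 R n p) _ _.
rewrite lee_fin natrX powR_exprn ?(ltW Ki0)// -[n%:R * (1 + r)]opprK powRVN ?ler0n//.
rewrite -[K%:R ^+ n]powR_mulrn ?ler0n//.
rewrite -powRD ?(gt_eqF K0') ?implybT//.
by rewrite (_ : n%:R + - (n%:R * (1 + r)) = - (n%:R * r))//; ring.
Qed.

Definition quantization_constant : R := fine (ereal_inf
  [set ((m%:R `^ r)%:E * best_err mu e setT unit_cube m)%E | m in [set m | (0 < m)%N]]).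

Lemma quantization_constant_ge0 : 0 <= quantization_constant.
Proof.
apply/fine_ge0/le_ereal_inf_tmp => _ [m _ <-].
by rewrite mule_ge0 ?lee_fin ?powR_ge0//; exact: best_err_ge0 (@dist_pow_ge0 R n p) _ _.
Qed.

Lemma best_err_unit_cube_lty : (best_err mu e setT unit_cube 1 < +oo)%E.
Proof.
apply: (@le_lt_trans _ _ ((n%:R `^ p)%:E * mu unit_cube)%E); last first.
  by rewrite leb_mx_ccube// -EFinM ltry.
apply: le_trans (best_err_le mu e (s := [:: 0]) unit_cube _ _) _ => //.
apply: ge0_integral_le_cst => //.
- exact: measurable_ccube.
- exact: measurable_err (@measurable_dist_pow R n p).
- by move=> x; exact: err_ge0 (@dist_pow_ge0 R n p).
move=> x x1; apply: le_trans (err_le _ _ (mem_head _ _)) _.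
rewrite lee_fin; apply: le_powR; [exact: ltW|exact: dotr_ge0|].
apply: (le_trans (dotr_le_norm _)); rewrite ler_piMr// expr_le1//.
exact: ccube_dist_le ler01 x1 (ccube_corner 0 ler01).
Qed.

Lemma cube_quantization_cvg (a : 'rV[R]_n) (h : R) : 0 < h ->
  ((m%:R `^ r)%:E * best_err mu e setT (ccube a h) m)%E @[m --> \oo] -->
  (quantization_constant * (h ^+ n) `^ (1 + r))%:E.
Proof.
move=> h0; under eq_fun do rewrite best_err_ccube// muleCA.
rewrite mulrC EFinM; apply: cvgeZl => //.
apply: (self_similar_cvg n0 r0).
- by move=> m; exact: best_err_ge0 (@dist_pow_ge0 R n p) _ _.
- exact: best_err_unit_cube_lty.
- by move=> k m; exact: best_err_nonincreasing.
- by move=> K m; exact: best_err_ccube_self_similar.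
Qed.

Definition clamp (a : 'rV[R]_n) (h : R) (z : 'rV[R]_n) : 'rV[R]_n :=
  \row_j Num.min (Num.max (z 0 j) (a 0 j)) (a 0 j + h).

Lemma clamp_ccube a h z : 0 <= h -> ccube a h (clamp a h z).
Proof.
move=> h0 j; rewrite mxE ge_min lexx orbT andbT le_min le_max lexx orbT/=.
by rewrite lerDl.
Qed.

Lemma dist_pow_clamp_le a h z x : ccube a h x -> e (clamp a h z) x <= e z x.
Proof.
move=> xa; apply: le_powR; [exact: ltW|exact: dotr_ge0|].
apply: ler_sum => j _; rewrite !mxE -!expr2; have /andP[xl xr] := xa j.
by rewrite minElt maxElt; case: (ltP (z 0 j) (a 0 j)) => ?; case: ltP => ?; nra.
Qed.

Lemma best_err_ccube_sub (A : set 'rV[R]_n) (a : 'rV[R]_n) (h : R) m : 0 <= h ->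
  ccube a h `<=` A -> best_err mu e A (ccube a h) m = best_err mu e setT (ccube a h) m.
Proof.
move=> h0 aA.
have le_map A' A'' phi : (forall q, A'' q -> A' (phi q)) ->
    (forall q x, A'' q -> ccube a h x -> e (phi q) x <= e q x) ->
    (best_err mu e A' (ccube a h) m <= best_err mu e A'' (ccube a h) m)%E.
  move=> phiA phi_le; rewrite -[leRHS]mul1e.
  apply: (@le_best_err_map _ _ R mu _ _ e e A' A'' phi) => // [|z x|z|z x|z|z x /phi_le le_e /le_e].
  - exact: measurable_ccube.
  - exact: dist_pow_ge0.
  - exact: measurable_dist_pow.
  - exact: dist_pow_ge0.
  - exact: measurable_dist_pow.
  by rewrite mul1r.
apply/eqP; rewrite eq_le; apply/andP; split.
  apply: (le_map _ _ (clamp a h)) => z; first by move=> _; apply: aA; exact: clamp_ccube.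
  by move=> x _ xa; exact: dist_pow_clamp_le.
exact: (le_map _ _ id).
Qed.

Lemma ccube_disjoint_dist (a b : 'rV[R]_n) (h : R) : 0 < h -> ccube a h `&` ccube b h = set0 ->
  exists2 g : R, 0 < g &
    exists j, forall x y, ccube a h x -> ccube b h y -> g <= `|x 0 j - y 0 j|.
Proof.
move=> h0 ab; have [j hj] : exists j, h < `|a 0 j - b 0 j|.
  apply/not_existsP => near_ab; have : (ccube a h `&` ccube b h) !=set0; last by rewrite ab => -[].
  exists (\row_j Num.max (a 0 j) (b 0 j)); split=> j; rewrite mxE;
    have /negP := near_ab j; rewrite -leNgt ler_norml => /andP[? ?]; rewrite maxElt;
    by case: ltP => ?; apply/andP; split; lra.
exists (`|a 0 j - b 0 j| - h); first by rewrite subr_gt0.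
exists j => x y xa yb; have /andP[? ?] := xa j; have /andP[? ?] := yb j.
have [_|_] := ger0P (a 0 j - b 0 j); first by apply: le_trans (ler_norm _); lra.
by rewrite distrC; apply: le_trans (ler_norm _); lra.
Qed.

Lemma dist_pow_separated (A : set 'rV[R]_n) (a b : 'rV[R]_n) (h : R) : 0 < h ->
  ccube a h `&` ccube b h = set0 -> separated e A (ccube a h) (ccube b h).
Proof.
move=> h0 /(ccube_disjoint_dist h0)[g g0 [j gj]].
exists (((g / 2) ^+ 2) `^ p) => [|z x y _ xa yb]; first by rewrite powR_gt0// exprn_gt0// divr_gt0.
have far (w : 'rV[R]_n) : g / 2 <= `|w 0 j - z 0 j| -> ((g / 2) ^+ 2) `^ p <= e z w.
  move=> gw; apply: le_powR; [exact: ltW|exact: sqr_ge0|].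
  apply: le_trans (sqr_entry_le_dotr (w - z) j); rewrite !mxE.
  by rewrite -[leRHS]real_normK ?num_real// lerXn2r ?nnegrE// divr_ge0// ltW.
rewrite le_max; have := gj x y xa yb.
have [/far -> //|xz] := leP (g / 2) `|x 0 j - z 0 j|.
have [/far ->|yz xy] := leP (g / 2) `|y 0 j - z 0 j|; first by rewrite orbT.
by have := ler_distD (z 0 j) (x 0 j) (y 0 j); rewrite (distrC (z 0 j)); lra.
Qed.

Lemma dist_pow_uniform_bound (J : set 'rV[R]_n) : bounded_set J ->
  exists2 C : R, 0 <= C & uniform_bound e J J r C.
Proof.
move=> bJ; have [|C C0 net] := @ex_net R n _ id J n0; first by rewrite image_id.
exists ((n%:R * C ^+ 2) `^ p); first exact: powR_ge0.
move=> k k0; have [s [sk sJ s_net]] := net k k0; exists s; split=> // x /s_net[z zs xz].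
apply: (le_trans (err_le _ _ zs)); rewrite lee_fin.
set d : R := k%:R `^ (- n%:R^-1) in xz; have d0 : 0 <= d by exact: powR_ge0.
have -> : k%:R `^ (- r) = (d ^+ 2) `^ p.
  by rewrite powR_exprn// /d -powRrM; congr powR; field; rewrite gt_eqF.
rewrite -powRM ?mulr_ge0 ?sqr_ge0//; apply: le_powR; [exact: ltW|exact: dotr_ge0|].
apply: (le_trans (dotr_le_norm _)); rewrite -mulrA ler_wpM2l// -exprMn.
by rewrite lerXn2r ?nnegrE// mulr_ge0.
Qed.

(* The pieces may lie on the boundary of [J], which is where Zador's theorem allows them. *)
Lemma bounded_quantization_cvg (J : set 'rV[R]_n) : bounded_set J ->
  ((m%:R `^ r)%:E * best_err mu e J J° m)%E @[m --> \oo] -->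
  (quantization_constant * (fine (mu J°)) `^ (1 + r))%:E.
Proof.
move=> bJ; have JJ := @interior_subset _ J; have oJ : open J° by exact: open_interior.
have bJ' : bounded_set J° by exact: sub_bounded_set bJ.
have delta0 := quantization_constant_ge0.
have [C C0 rate] := dist_pow_uniform_bound bJ.
have rate' : uniform_bound e J J° r C.
  by move=> k /rate[s [sk sJ s_err]]; exists s; split=> // x /JJ; exact: s_err.
have dens x : J° x -> local_density e J r (fun=> quantization_constant `^ (1 + r)^-1) x.
  move=> Jx; apply: (local_density_powR (w := fun=> quantization_constant)) => // [eps eps0|];
    last exact: dist_pow_ge0.
  apply: filterS (near_small_cubes_sub Jx) => -[a h] /= [h0 aJ].
  have hn0 : 0 < (h ^+ n) `^ (1 + r) by rewrite powR_gt0// exprn_gt0.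
  have /cvg_EFin_leP/(_ _ (mulr_gt0 eps0 hn0)) near_delta := cube_quantization_cvg a h0.
  by apply: filterS near_delta => k; rewrite -mulrBl -mulrDl (best_err_ccube_sub _ (ltW h0) aJ).
have [_] := density_limit r0 oJ bJ' (@dist_pow_ge0 R n p) (@measurable_dist_pow R n p)
  (fun x _ => @cst_continuous _ _ (quantization_constant `^ (1 + r)^-1) x) (fun _ _ => powR_ge0 _ _) dens
  (fun a b h h0 _ _ => @dist_pow_separated J a b h h0) C0 rate'.
rewrite integral_cst; last exact: open_measurable_mx.
rewrite -[X in (_ * X)%E](@fineK _ (mu J°)) -?EFinM; last first.
  by rewrite ge0_fin_numE//; exact: bounded_leb_mx_lty (open_measurable_mx oJ) bJ'.
by rewrite /= powRM ?fine_ge0 ?powR_ge0// powRVK// addr_gt0.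
Qed.

End cube_quantization.

Lemma bigmin_err {X : Type} {R : realType} {P : eqType} (e : P -> X -> R) k
    (Q : 'I_k.+1 -> P) x :
  (\big[Num.min/e (Q ord0) x]_(i < k.+1) e (Q i) x)%:E = err e (codom Q) x.
Proof.
apply/eqP; rewrite eq_le; apply/andP; split.
  by apply: le_err => _ /codomP[i ->]; rewrite lee_fin; exact: bigmin_le_cond.
have err_Q i : (err e (codom Q) x <= (e (Q i) x)%:E)%E by apply: err_le; exact: codom_f.
by elim/big_ind : _ => // y z ? ?; rewrite minEle; case: ifP.
Qed.

Section zador.
Context {R : realType} (n : nat) (p : R).
Hypotheses (n0 : (0 < n)%N) (p0 : 0 < p).
Local Notation mu := (@leb_mx R n).
Local Notation e := (@dist_pow R n p).
Local Notation r := (2 * p / n%:R).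

Lemma ex_notin_seq (J : set 'rV[R]_n) (s : seq 'rV[R]_n) : measurable J -> (0 < mu J)%E ->
  exists2 z, J z & z \notin s.
Proof.
move=> mJ J0; apply: contrapT => /forall2NP J_s.
have : (mu J <= mu (cubes s 0))%E.
  apply: le_measure; rewrite ?inE//; first exact: measurable_cubes.
  move=> z Jz; exists z; last exact: ccube_corner.
  by have [//|/negP/negPn] := J_s z.
rewrite leNgt => /negP; apply; rewrite cubesE.
suff -> : mu (\big[setU/set0]_(a <- s) ccube a 0) = 0%E by [].
elim: s {J_s} => [|a s IH]; first by rewrite big_nil measure0.
have mcubes : measurable (\big[setU/set0]_(a <- s) ccube a 0).
  by rewrite -cubesE; exact: measurable_cubes.
apply/eqP; rewrite eq_le measure_ge0 andbT big_cons.
apply: le_trans (measureU2 _ (measurable_ccube a 0) mcubes) _.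
by rewrite [X in (_ + X)%E]IH adde0 [leLHS]leb_mx_ccube// expr0n gtn_eqF.
Qed.

Lemma extend_uniq (J : set 'rV[R]_n) k (s : seq 'rV[R]_n) : measurable J -> (0 < mu J)%E ->
  uniq s -> [set` s] `<=` J -> (size s <= k)%N ->
  exists t, [/\ uniq t, size t = k, [set` t] `<=` J & {subset s <= t}].
Proof.
move=> mJ J0; move Ed : (k - size s)%N => d; elim: d s Ed => [|d IH] s Ed us sJ sk.
  by exists s; split=> //; apply/eqP; rewrite eqn_leq sk -subn_eq0 Ed.
have [z Jz zs] := ex_notin_seq s mJ J0.
have [| | | |t [ut st tJ sub]] := IH (z :: s).
- by rewrite /= subnS Ed.
- by rewrite /= zs.
- by move=> y /=; rewrite inE => /orP[/eqP->|/sJ].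
- by rewrite /= -subn_gt0 Ed.
by exists t; split=> // y ys; apply: sub; rewrite inE ys orbT.
Qed.

Let err0 s x : (0 <= err e s x)%E. Proof. exact: err_ge0 (@dist_pow_ge0 R n p). Qed.

Let merr s : measurable_fun setT (err e s).
Proof. exact: measurable_err (@measurable_dist_pow R n p). Qed.

Lemma quant_errE (J : set 'rV[R]_n) m : measurable J -> (0 < mu J)%E ->
  quant_err p J m = best_err mu e J J m.+1.
Proof.
move=> mJ J0.
have intE (S : 'I_m.+1 -> 'rV[R]_n) :
  iint_on J (fun x => (\big[Num.min/enorm (x - S ord0) `^ (2 * p)]_(i < m.+1)
                               (enorm (x - S i) `^ (2 * p)))%:E) =
  (\int[mu]_(x in J) err e (codom S) x)%E.
  rewrite -iint_onE//; last exact: measurable_funTS.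
  congr iint_on; apply/funext => x; rewrite -bigmin_err enorm_powR//.
  by congr EFin; apply: eq_bigr => i _; rewrite enorm_powR.
apply/eqP; rewrite eq_le; apply/andP; split.
  apply: le_best_err => // s ss sJ.
  have [||t [ut st tJ sub]] := @extend_uniq J m.+1 (undup s) mJ J0 (undup_uniq _).
  - by move=> z /=; rewrite mem_undup; exact: sJ.
  - by rewrite (leq_trans (size_undup _)).
  pose S (i : 'I_m.+1) := nth 0 t i.
  apply: (@le_trans _ _ (\int[mu]_(x in J) err e (codom S) x)%E).
    apply: ereal_inf_lbound; exists S; split; last split=> [i|].
    - by move=> i j /eqP; rewrite nth_uniq ?st// => /eqP/val_inj.
    - by apply: tJ; rewrite /= mem_nth// st.
    - by rewrite intE.
  apply: ge0_le_integral => //; [exact: measurable_funTS|exact: measurable_funTS|].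
  move=> x _; apply: sub_err => z zs; have zt : z \in t by apply: sub; rewrite mem_undup.
  have it : (index z t < m.+1)%N by rewrite -st index_mem.
  by apply/codomP; exists (Ordinal it); rewrite /S /= nth_index.
apply: le_ereal_inf_tmp => _ [S [_ [SJ ->]]]; rewrite intE.
by apply: best_err_le; [rewrite size_codom card_ord|move=> _ /codomP[i ->]].
Qed.

Lemma best_err_interior (A J : set 'rV[R]_n) m : measurable J -> mu (J `\` J°) = 0%E ->
  best_err mu e A J m = best_err mu e A J° m.
Proof.
move=> mJ N0; apply: eq_best_err => s.
by apply: ge0_integral_interior => //; exact: measurable_funTS.
Qed.

Theorem zador_quantization_constant : zador_constant n p (quantization_constant n p).
Proof.
move=> J [cJ vJ] J0; have nR0 : n%:R != 0 :> R by rewrite pnatr_eq0 -lt0n.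
have mJ := compact_measurable_mx cJ.
have clJ : closure J = J by apply/esym/closure_id; apply: compact_closed => //; exact: norm_hausdorff.
have mJ' : measurable J° by apply: open_measurable_mx; exact: open_interior.
have N0 : mu (J `\` J°) = 0%E by move: vJ; rewrite clJ volE//; exact: measurableD.
rewrite volE// in J0 *; rewrite leb_mx_interior//.
have -> : (n%:R + 2 * p) / n%:R = 1 + r by field.
under eq_fun do rewrite quant_errE// best_err_interior//.
have := bounded_quantization_cvg n0 p0 (compact_bounded cJ).
by rewrite -(cvg_shiftS (fun m => (m%:R `^ r)%:E * best_err mu e J J° m)%E).
Qed.

End zador.

Section ellipsoid.
Context {R : realType}.
Implicit Types (n : nat).

Lemma norm_mulmx_le m n k (A : 'M[R]_(m, n)) (B : 'M[R]_(n, k)) : `|A *m B| <= n%:R * (`|A| * `|B|).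
Proof.
apply/mx_norm_leP => [|i j]; first by rewrite !mulr_ge0.
rewrite mxE (le_trans (ler_norm_sum _ _ _))//.
apply: (@le_trans _ _ (\sum_(l < n) `|A| * `|B|)); last by rewrite sumr_const card_ord mulr_natl.
by apply: ler_sum => l _; rewrite normrM ler_pM// mx_entry_le_norm.
Qed.

Lemma bounded_mulmx m n k (A : set 'M[R]_(m, n)) (B : 'M[R]_(n, k)) : bounded_set A ->
  bounded_set (mulmx^~ B @` A).
Proof.
move=> /ex_strict_bound_gt0[M M0 AM]; rewrite /= /bounded_near; near=> N => _ [x Ax <-] /=.
apply: (le_trans (norm_mulmx_le x B)); apply: (@le_trans _ _ (n%:R * (M * `|B|))).
  by rewrite ler_wpM2l// ler_wpM2r// ltW//; exact: AM.
by near: N; apply: nbhs_pinfty_ge; rewrite num_real.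
Unshelve. all: end_near. Qed.

Variables (n : nat) (p : R) (B : 'M[R]_n).
Hypotheses (n0 : (0 < n)%N) (p0 : 0 < p) (tB : is_trig_mx B^T) (uB : B \in unitmx).
Local Notation mu := (@leb_mx R n).
Local Notation r := (2 * p / n%:R).

Definition ellipsoid_pow (z x : 'rV[R]_n) : R := dist_pow p (z *m B) (x *m B).

Lemma ellipsoid_pow_ge0 z x : 0 <= ellipsoid_pow z x.
Proof. exact: dist_pow_ge0. Qed.

Lemma measurable_ellipsoid_pow z : measurable_fun setT (ellipsoid_pow z).
Proof.
apply: (measurableT_comp (measurable_dist_pow p (z *m B))).
by have := measurable_mulmx_add B 0; under eq_fun do rewrite addr0.
Qed.

Variables (a : 'rV[R]_n) (h : R).
Hypothesis h0 : 0 < h.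
Let J := mulmx^~ B @` ccube a h.

Let JE : J = [set y | ccube a h (y *m invmx B)].
Proof.
apply/seteqP; split=> [_ [x xa <-]|y ya]; first by rewrite /= mulmxK.
by exists (y *m invmx B) => //=; rewrite mulmxKV.
Qed.

Let mulJ : [set x | J (x *m B + 0)] = ccube a h.
Proof. by rewrite JE; apply/seteqP; split=> x /=; rewrite addr0 mulmxK. Qed.

Let mJ : measurable J.
Proof.
rewrite JE -[X in measurable X]setTI (_ : [set y | _] = (fun y => y *m invmx B + 0) @^-1` ccube a h).
  by apply: measurable_mulmx_add => //; exact: measurable_ccube.
by apply/seteqP; split=> y; rewrite /= addr0.
Qed.

Let bJ : bounded_set J.
Proof. by apply: bounded_mulmx; apply: compact_bounded; exact: compact_ccube. Qed.

Let convJ : convex_set J.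
Proof.
rewrite JE; apply/convex_setP => x y t xa ya t01; rewrite /= mulmxDl -!scalemxAl.
by move/convex_setP : (@convex_ccube R n a h); exact.
Qed.

Let leb_J : mu J = (`|\det B| * h ^+ n)%:E.
Proof.
have := ge0_integral_mulmx_trig 0 tB uB mJ (measurable_cst 1%E) (fun _ => lee01).
rewrite integral_cst// mul1e => ->; rewrite mulJ EFinM; congr (_ * _)%E.
by rewrite (integral_cst mu (measurable_ccube a h)) mul1e; apply: leb_mx_ccube; exact: ltW.
Qed.

Lemma ellipsoid_quantization_cvg :
  ((m%:R `^ r)%:E * best_err mu ellipsoid_pow (ccube a h) (ccube a h) m)%E @[m --> \oo] -->
  (quantization_constant n p * `|\det B| `^ r * (h ^+ n) `^ (1 + r))%:E.
Proof.
have dB0 : 0 < `|\det B| by rewrite normr_gt0 -unitfE -unitmxE.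
have N0 := convex_boundary_null convJ.
have best_J m : best_err mu (dist_pow p) J J° m =
    (`|\det B|%:E * best_err mu ellipsoid_pow (ccube a h) (ccube a h) m)%E.
  rewrite -best_err_interior// -[`|\det B|]mulr1 -mulJ.
  apply: (@best_err_mulmx_trig _ _ _ _ _ ellipsoid_pow _ _ (mulmx^~ B) (mulmx^~ (invmx B))) => //.
  - exact: dist_pow_ge0.
  - exact: measurable_dist_pow.
  - by move=> z; rewrite mulJ => za; exists z.
  - by move=> _ [z za <-]; rewrite mulJ mulmxK.
  - by move=> z; rewrite mulmxKV.
  - by move=> z x; rewrite addr0 mul1r.
have best_ellipsoid m : best_err mu ellipsoid_pow (ccube a h) (ccube a h) m =
    (`|\det B|^-1%:E * best_err mu (dist_pow p) J J° m)%E.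
  by rewrite best_J muleA -EFinM mulVf ?mul1e// gt_eqF.
under eq_fun do rewrite best_ellipsoid muleCA.
rewrite (_ : _ * _ * _ = `|\det B|^-1 * (quantization_constant n p * fine (mu J°) `^ (1 + r))).
  by rewrite EFinM; apply: cvgeZl => //; exact: bounded_quantization_cvg.
rewrite -leb_mx_interior// leb_J /= powRM ?exprn_ge0 ?(ltW h0)//.
rewrite [`|\det B| `^ (1 + r)]powRD ?(gt_eqF dB0) ?implybT// powRr1//.
by field; rewrite gt_eqF.
Qed.

End ellipsoid.

(** * Calculus in several variables *)

Lemma cvg_sumr {R : realType} (T I : Type) (F : set_system T) {FF : Filter F} (s : seq I)
    (f : I -> T -> R) (l : I -> R) : (forall i, f i x @[x --> F] --> l i) ->
  \sum_(i <- s) f i x @[x --> F] --> \sum_(i <- s) l i.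
Proof.
have add_cont : continuous (fun z : R * R => z.1 + z.2) by exact: add_continuous.
by move=> fl; apply: (cvg_big add_cont) => i _; exact: fl.
Qed.

Lemma cvg_prodr {R : realType} (T I : Type) (F : set_system T) {FF : Filter F} (s : seq I)
    (f : I -> T -> R) (l : I -> R) : (forall i, f i x @[x --> F] --> l i) ->
  \prod_(i <- s) f i x @[x --> F] --> \prod_(i <- s) l i.
Proof.
have mul_cont : continuous (fun z : R * R => z.1 * z.2) by exact: mul_continuous.
by move=> fl; apply: (cvg_big mul_cont) => i _; exact: fl.
Qed.

Section one_variable.
Context {R : realType}.
Implicit Types (g dg : R -> R).

Lemma MVT_derivable g dg (a b : R) : a < b ->
  (forall s, a <= s <= b -> is_derive s 1 g (dg s)) ->
  exists2 c, a < c < b & g b - g a = dg c * (b - a).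
Proof.
move=> ab dgP; have [s||c cab ->] := @MVT R g dg a b ab; last by exists c.
- by rewrite in_itv/= => /andP[/ltW as_ /ltW sb]; apply: dgP; rewrite as_.
by apply: derivable_within_continuous => s; rewrite in_itv/= => /dgP[].
Qed.

Lemma taylor_lagrange2 g g' g'' :
  (forall s : R, 0 <= s <= 1 -> is_derive s 1 g (g' s)) ->
  (forall s : R, 0 <= s <= 1 -> is_derive s 1 g' (g'' s)) ->
  exists2 xi, 0 <= xi <= 1 & g 1 = g 0 + g' 0 + g'' xi / 2.
Proof.
move=> dg dg'; pose K := g 1 - g 0 - g' 0.
pose h : R -> R := g - g' 0 *: @id R - K *: (@id R * @id R).
pose h' : R -> R := g' - cst (g' 0) - (2 * K) *: @id R.
have dh (s : R) : 0 <= s <= 1 -> is_derive s 1 h (h' s).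
  by move=> /dg ?; apply: is_derive_eq; rewrite /h' !fctE /GRing.scale/=; ring.
have dh' (s : R) : 0 <= s <= 1 -> is_derive s 1 h' (g'' s - 2 * K).
  by move=> /dg' ?; apply: is_derive_eq; rewrite subr0 /GRing.scale/= mulr1.
have [c /andP[c0 c1] hc] := MVT_derivable ltr01 dh.
have dh'c (s : R) : 0 <= s <= c -> is_derive s 1 h' (g'' s - 2 * K).
  by move=> /andP[s0 sc]; apply: dh'; rewrite s0 (le_trans sc)// ltW.
have [xi /andP[xi0 xic] hxi] := MVT_derivable c0 dh'c.
exists xi; first by rewrite (ltW xi0) (le_trans (ltW xic))// ltW.
have h'c : h' c = 0.
  by move: hc; rewrite subr0 mulr1 => <-; rewrite /h /K !fctE /GRing.scale/=; ring.
have : (g'' xi - 2 * K) * (c - 0) = 0 by rewrite -hxi h'c /h' !fctE /GRing.scale/=; ring.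
move=> /eqP; rewrite subr0 mulf_eq0 (gt_eqF c0) orbF subr_eq0 => /eqP ->.
by rewrite mulrAC mulfV// mul1r /K; ring.
Qed.

Lemma is_derive_ge g (x d c : R) : is_derive x 1 g d ->
  (\forall t \near 0^'+, t * c <= g (x + t) - g x) -> c <= d.
Proof.
move=> [/cvg_ex[l gl] gd] le_g; have {gd} <- : l = d by rewrite -gd; apply/esym/cvg_lim.
apply: (cvgr_to_ge (cvg_dnbhs_at_right gl)); near=> t.
have t0 : 0 < t by near: t; exact: nbhs_right_gt.
by rewrite /GRing.scale/= mulr1 [t + x]addrC ler_pdivlMl//; near: t; exact: le_g.
Unshelve. all: end_near. Qed.

Lemma is_derive_le g (x d c : R) : is_derive x 1 g d ->
  (\forall t \near 0^'+, g (x + t) - g x <= t * c) -> d <= c.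
Proof.
move=> gd le_g; rewrite -lerN2; apply: (@is_derive_ge (- g) x) => //.
by apply: filterS le_g => t; rewrite !fctE mulrN -opprD lerN2.
Qed.

End one_variable.

Section several_variables.
Context {R : realType} {n : nat}.
Implicit Types (f : 'rV[R]_n -> R) (x y v : 'rV[R]_n) (O : set 'rV[R]_n).

Lemma is_derive_line f x v (s : R) : derivable f (x + s *: v) v ->
  is_derive s 1 (fun t : R => f (x + t *: v)) ('D_v f (x + s *: v)).
Proof.
move=> df.
have lineE : (fun h : R => h^-1 *: (((fun t : R => f (x + t *: v)) \o shift s) (h *: 1) - f (x + s *: v))) =
   (fun h : R => h^-1 *: ((f \o shift (x + s *: v)) (h *: v) - f (x + s *: v))).
  by apply/funext => h; congr (_ *: (f _ - _)); rewrite /= [h *: 1]mulr1 scalerDl addrCA.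
by apply: DeriveDef; rewrite /derivable /derive lineE.
Qed.

Lemma line_mean_value f x v (s : R) :
  (forall t, 0 <= t <= 1 -> derivable f (x + (t * s) *: v) v) ->
  exists2 t, 0 < t < 1 & f (x + s *: v) - f x = s * 'D_v f (x + (t * s) *: v).
Proof.
move=> df; pose g (t : R) := f (x + t *: v).
have dg (t : R) : 0 <= t <= 1 -> is_derive t 1 (g \o (fun t => t * s)) ('D_v f (x + (t * s) *: v) * s).
  by move=> /df/is_derive_line dgt; apply: is_derive_eq; rewrite /GRing.scale/= mulr0 add0r mulr1.
have [t t01] := MVT_derivable ltr01 dg; rewrite /g /= mul1r mul0r scale0r addr0 subr0 mulr1 => E.
by exists t; rewrite // E mulrC.
Qed.

Lemma continuous_dotr v : continuous (dotr v).
Proof.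
move=> x; apply: (cvg_sumr (F := nbhs x)) => i.
by apply: cvgM; [exact: cvg_cst|exact: coord_continuous].
Qed.

Definition C1_on f O :=
  (forall i x, O x -> derivable f x (ebase R i)) /\ (forall i, {in O, continuous (pderiv f i)}).

Definition grad f x : 'rV[R]_n := \row_i pderiv f i x.

Let row_prefix (k : nat) v : 'rV[R]_n := \row_j (if (j < k)%N then v 0 j else 0).

Let row_prefixS (i : 'I_n) v : row_prefix i.+1 v = row_prefix i v + v 0 i *: ebase R i.
Proof.
apply/rowP => j; rewrite !mxE ltnS leq_eqVlt eqxx/=.
have [->|ji] := eqVneq j i; first by rewrite eqxx ltnn/= mulr1 add0r.
by rewrite val_eqE (negbTE ji) mulr0 addr0.
Qed.

Let norm_row_prefix_le (i : 'I_n) v (t : R) : 0 <= t <= 1 ->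
  `|row_prefix i v + (t * v 0 i) *: ebase R i| <= `|v|.
Proof.
move=> /andP[t0 t1]; apply/(mx_norm_leP _ (normr_ge0 _)) => a j; rewrite (ord1 a) !mxE eqxx/=.
have [->|ji] := eqVneq j i.
  rewrite ltnn add0r mulr1 normrM ger0_norm//.
  by apply: le_trans (mx_entry_le_norm v 0 i); rewrite ler_piMl.
by rewrite mulr0 addr0; case: ifP => _; rewrite ?normr0// mx_entry_le_norm.
Qed.

Lemma increment_pderiv f x v :
  (forall i w, `|w| <= `|v| -> derivable f (x + w) (ebase R i)) ->
  exists2 w : 'I_n -> 'rV[R]_n, forall i, `|w i| <= `|v| &
    f (x + v) - f x = \sum_(i < n) v 0 i * pderiv f i (x + w i).
Proof.
move=> df; have /choice[t tP] (i : 'I_n) : exists t : R, 0 <= t <= 1 /\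
    f (x + row_prefix i.+1 v) - f (x + row_prefix i v) =
    v 0 i * pderiv f i (x + (row_prefix i v + (t * v 0 i) *: ebase R i)).
  have [s s01|t /andP[t0 t1] E] := @line_mean_value f (x + row_prefix i v) (ebase R i) (v 0 i).
    by rewrite -addrA; apply: df; exact: norm_row_prefix_le.
  by exists t; rewrite !ltW// row_prefixS addrA E addrA.
exists (fun i : 'I_n => row_prefix i v + (t i * v 0 i) *: ebase R i) => [i|].
  by apply: norm_row_prefix_le; have [] := tP i.
have -> : f (x + v) - f x = f (x + row_prefix n v) - f (x + row_prefix 0 v).
  by congr (f (_ + _) - f _); [|rewrite -[LHS]addr0; congr (_ + _)];
    apply/rowP => j; rewrite !mxE ?ltn_ord.
rewrite -(telescope_sumr (fun k => f (x + row_prefix k v)))// big_mkord.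
by apply: eq_bigr => i _; have [] := tP i.
Qed.

Lemma C1_first_order f O x (eps : R) : open O -> C1_on f O -> O x -> 0 < eps ->
  \forall v \near (0 : 'rV[R]_n), `|f (x + v) - f x - dotr (grad f x) v| <= eps * `|v|.
Proof.
move=> oO [df cf] Ox eps0; have n1 : 0 < n%:R + 1 :> R by rewrite ltr_wpDl.
pose ep := eps / (n%:R + 1); have ep0 : 0 < ep by rewrite divr_gt0.
have near_x : \forall y \near x, O y /\ forall i, `|pderiv f i y - pderiv f i x| <= ep.
  have near_pderiv : \forall y \near x, forall i, `|pderiv f i y - pderiv f i x| <= ep.
    apply: (@filter_forall _ _ (fun i y => `|pderiv f i y - pderiv f i x| <= ep) (nbhs x)) => i.
    exact: cvgr_distC_le (cf i x (mem_set Ox)) _ ep0.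
  by apply: filterI near_pderiv; exact: open_nbhs_nbhs.
have /nbhs_ballP[rho /= rho0 rho_x] := near_x.
apply: filterS (nbhs0_lt rho0) => v v_rho.
have ball_x w : `|w| <= `|v| -> ball x rho (x + w).
  by move=> wv; rewrite -ball_normE /= opprD addNKr normrN (le_lt_trans wv).
have [i w wv|w wv ->] := @increment_pderiv f x v.
  by apply: df; have [] := rho_x _ (ball_x _ wv).
rewrite /dotr -sumrB; apply: (le_trans (ler_norm_sum _ _ _)).
apply: (@le_trans _ _ (\sum_(i < n) `|v| * ep)).
  apply: ler_sum => i _; rewrite mxE [X in _ - X]mulrC -mulrBr normrM.
  by rewrite ler_pM ?mx_entry_le_norm//; have [_] := rho_x _ (ball_x _ (wv i)).
rewrite sumr_const card_ord -mulr_natr -mulrA mulrC ler_wpM2r// mulrAC ler_pdivrMr//.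
by rewrite ler_pM2l//; lra.
Qed.

Lemma C1_is_diff f O x : open O -> C1_on f O -> O x -> is_diff x f (dotr (grad f x)).
Proof.
move=> oO cf Ox.
have o_rem : f \o shift x = cst (f x) + dotr (grad f x) +o_ (0 : 'rV[R]_n) id.
  apply/eqaddoP => eps eps0; apply: filterS (C1_first_order oO cf Ox eps0) => v.
  by rewrite /= !fctE opprD addrA [v + x]addrC.
have df := diff_unique (@continuous_dotr (grad f x)) o_rem.
split; last exact: df.
by apply/diff_locallyP; rewrite df; split=> //; exact: continuous_dotr.
Qed.

Lemma C1_continuous f O x : open O -> C1_on f O -> O x -> {for x, continuous f}.
Proof. by move=> oO cf Ox; have [df _] := C1_is_diff oO cf Ox; exact: differentiable_continuous. Qed.

Lemma C1_is_derive_line f O x v (s : R) : open O -> C1_on f O -> O (x + s *: v) ->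
  is_derive s 1 (fun t : R => f (x + t *: v)) (dotr (grad f (x + s *: v)) v).
Proof.
move=> oO cf Ox; have [df <-] := C1_is_diff oO cf Ox.
by rewrite -deriveE//; apply: is_derive_line; exact: diff_derivable.
Qed.

Lemma C2_C1 f O : C2_on f O -> C1_on f O.
Proof. by case=> _ [? [? _]]. Qed.

Lemma C2_C1_pderiv f O j : C2_on f O -> C1_on (pderiv f j) O.
Proof. by case=> _ [_ [_ [d2 c2]]]; split=> i; [exact: d2|exact: c2]. Qed.

Lemma hessian_is_derive_line f O x v (s : R) : C2_on f O -> O (x + s *: v) ->
  is_derive s 1 (fun t : R => dotr (grad f (x + t *: v)) v)
    ((v *m hessian f (x + s *: v) *m v^T) 0 0).
Proof.
move=> c2f Ox; have oO := c2f.1.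
have dj j := C1_is_derive_line oO (C2_C1_pderiv j c2f) Ox.
have : is_derive s 1 (\sum_(j < n) (v 0 j *: (fun t : R => pderiv f j (x + t *: v))))
   (\sum_(j < n) (v 0 j *: dotr (grad (pderiv f j) (x + s *: v)) v)).
  by apply: is_derive_sum => j.
rewrite (_ : \sum_(j < n) _ = (fun t : R => dotr (grad f (x + t *: v)) v)); last first.
  by apply/funext => t; rewrite fct_sumE /dotr; apply: eq_bigr => j _; rewrite mxE mulrC.
rewrite (_ : \sum_(j < n) _ = (v *m hessian f (x + s *: v) *m v^T) 0 0)//.
rewrite !mxE; apply: eq_bigr => j _; rewrite mulrC !mxE; congr (_ * _).
by apply: eq_bigr => i _; rewrite !mxE mulrC.
Qed.

Lemma taylor2 f O x y : C2_on f O -> (forall s : R, 0 <= s <= 1 -> O (x + s *: (y - x))) ->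
  exists2 s, 0 <= s <= 1 & f y = f x + dotr (grad f x) (y - x) +
    ((y - x) *m hessian f (x + s *: (y - x)) *m (y - x)^T) 0 0 / 2.
Proof.
move=> c2f seg; have := @taylor_lagrange2 R (fun s => f (x + s *: (y - x)))
  (fun s => dotr (grad f (x + s *: (y - x))) (y - x))
  (fun s => ((y - x) *m hessian f (x + s *: (y - x)) *m (y - x)^T) 0 0).
rewrite scale0r addr0 scale1r [x + (y - x)]addrC subrK; apply=> s /seg Os.
- exact: C1_is_derive_line c2f.1 (C2_C1 c2f) Os.
- exact: hessian_is_derive_line c2f Os.
Qed.

Let second_difference f x i j (h : R) := f (x + h *: ebase R i + h *: ebase R j) -
  f (x + h *: ebase R i) - f (x + h *: ebase R j) + f x.

Let second_differenceC f x i j h : second_difference f x i j h = second_difference f x j i h.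
Proof.
rewrite /second_difference [_ + h *: ebase R j]addrAC; congr (_ + _).
by rewrite [LHS]addrAC.
Qed.

Let second_difference_mean_value f O x i j (h : R) : C2_on f O -> 0 < h ->
  (forall a b, 0 <= a <= h -> 0 <= b <= h -> O (x + a *: ebase R i + b *: ebase R j)) ->
  exists a b, [/\ 0 <= a <= h, 0 <= b <= h & second_difference f x i j h =
    h ^+ 2 * pderiv (pderiv f i) j (x + a *: ebase R i + b *: ebase R j)].
Proof.
move=> c2f h0 cO; have [df _] := C2_C1 c2f; have [ddf _] := C2_C1_pderiv i c2f.
have hh : 0 <= h <= h by rewrite (ltW h0) lexx.
have zh : 0 <= (0 : R) <= h by rewrite lexx (ltW h0).
pose g : R -> R := (fun a : R => f (x + h *: ebase R j + a *: ebase R i)) -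
  (fun a : R => f (x + a *: ebase R i)).
have dg a : 0 <= a <= h -> is_derive a 1 g (pderiv f i (x + h *: ebase R j + a *: ebase R i) -
    pderiv f i (x + a *: ebase R i)).
  move=> ah; have d1 : derivable f (x + h *: ebase R j + a *: ebase R i) (ebase R i).
    by apply: df; rewrite addrAC; exact: cO.
  have d2 : derivable f (x + a *: ebase R i) (ebase R i).
    by apply: df; rewrite -[X in O X]addr0 -(scale0r (ebase R j)); exact: cO.
  by have ? := is_derive_line d1; have ? := is_derive_line d2; exact: is_deriveB.
have [a /andP[a0 ah] gE] := MVT_derivable h0 dg; have a_h : 0 <= a <= h by rewrite !ltW.
have [t t01|t /andP[t0 t1] tE] := @line_mean_value (pderiv f i) (x + a *: ebase R i) (ebase R j) h.
  apply: ddf; apply: cO => //; move: t01 => /andP[t0 t1].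
  by rewrite mulr_ge0 ?(ltW h0)//= ler_piMl// ltW.
exists a, (t * h); split=> //; first by rewrite mulr_ge0 ?ltW//= gtr_pMl.
have -> : h ^+ 2 * pderiv (pderiv f i) j (x + a *: ebase R i + (t * h) *: ebase R j) = g h - g 0.
  by rewrite gE subr0 expr2 -mulrA -tE mulrC [x + h *: ebase R j + _]addrAC.
by rewrite /second_difference /g !fctE scale0r !addr0 [x + h *: ebase R j + _]addrAC; ring.
Qed.

Lemma norm_scale_ebase_le (s : R) (i : 'I_n) : `|s *: ebase R i| <= `|s|.
Proof.
apply/(mx_norm_leP _ (normr_ge0 _)) => a b; rewrite !mxE.
by case: eqP; case: eqP => _ _; rewrite /= ?mulr1 ?mulr0 ?normr0.
Qed.

Let second_difference_cvg f O x i j : C2_on f O -> O x ->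
  second_difference f x i j h / h ^+ 2 @[h --> 0^'+] --> pderiv (pderiv f i) j x.
Proof.
move=> c2f Ox; have [oO [_ [_ [_ ddc]]]] := c2f; apply/cvgrPdist_le => eps eps0.
have near_x : \forall y \near x, O y /\ `|pderiv (pderiv f i) j x - pderiv (pderiv f i) j y| <= eps.
  apply: filterI; first exact: open_nbhs_nbhs.
  exact: cvgr_dist_le (ddc j i x (mem_set Ox)) _ eps0.
have /nbhs_ballP[rho /= rho0 rho_x] := near_x.
near=> h; have h0 : 0 < h by near: h; exact: nbhs_right_gt.
have h_rho : h < rho / 2 by near: h; apply: nbhs_right_lt; rewrite divr_gt0.
have in_ball a b : 0 <= a <= h -> 0 <= b <= h -> ball x rho (x + a *: ebase R i + b *: ebase R j).
  move=> /andP[a0 ah] /andP[b0 bh]; rewrite -ball_normE /= -addrA opprD addNKr normrN.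
  apply: le_lt_trans (ler_normD _ _) _.
  apply: le_lt_trans (lerD (norm_scale_ebase_le _ _) (norm_scale_ebase_le _ _)) _.
  by rewrite !ger0_norm//; lra.
have [|a [b [ah bh ->]]] := @second_difference_mean_value f O x i j h c2f h0.
  by move=> a b ah bh; have [] := rho_x _ (in_ball a b ah bh).
by rewrite mulrAC mulfV ?mul1r ?expf_neq0 ?gt_eqF//; have [] := rho_x _ (in_ball a b ah bh).
Unshelve. all: end_near. Qed.

Lemma hessian_sym f O x : C2_on f O -> O x -> (hessian f x)^T = hessian f x.
Proof.
move=> c2f Ox; apply/matrixP => i j; rewrite !mxE.
have cvg_ij := second_difference_cvg (i := i) (j := j) c2f Ox.
have cvg_ji := second_difference_cvg (i := j) (j := i) c2f Ox.
rewrite (_ : second_difference f x i j = second_difference f x j i) in cvg_ij; last first.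
  by apply/funext => h; exact: second_differenceC.
by rewrite -(cvg_lim (@Rhausdorff R) cvg_ij) (cvg_lim (@Rhausdorff R) cvg_ji).
Qed.

End several_variables.

(** * Quadratic models of a C2 function *)

Section quadratic_model.
Context {R : realType} {n : nat}.
Implicit Types (f : 'rV[R]_n -> R) (x y z v : 'rV[R]_n) (O : set 'rV[R]_n) (B : 'M[R]_n).

Lemma quad_formE (M : 'M[R]_n) v : (v *m M *m v^T) 0 0 = dotr (v *m M) v.
Proof. by rewrite mxE; apply: eq_bigr => i _; rewrite [v^T _ _]mxE. Qed.

Lemma quad_form_gram B v : (v *m (B *m B^T) *m v^T) 0 0 = dotr (v *m B) (v *m B).
Proof. by rewrite mulmxA -mulmxA -trmx_mul mxE; apply: eq_bigr => i _; rewrite [X in _ * X]mxE. Qed.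

Lemma norm_quad_form_le B (M : 'M[R]_n) v : B \in unitmx ->
  `|(v *m M *m v^T) 0 0| <=
  n%:R ^+ 2 * (n%:R * `|invmx B|) ^+ 2 * `|M| * dotr (v *m B) (v *m B).
Proof.
move=> uB; have vB : `|v| <= n%:R * `|invmx B| * `|v *m B|.
  by rewrite -[v in leLHS](mulmxK uB) -mulrA [`|invmx B| * _]mulrC; exact: norm_mulmx_le.
have vB2 : `|v| ^+ 2 <= (n%:R * `|invmx B|) ^+ 2 * dotr (v *m B) (v *m B).
  apply: (@le_trans _ _ ((n%:R * `|invmx B| * `|v *m B|) ^+ 2)).
    by rewrite lerXn2r ?nnegrE ?mulr_ge0.
  by rewrite exprMn ler_wpM2l ?sqr_ge0// sqr_norm_le_dotr.
rewrite quad_formE; apply: (le_trans (norm_dotr_le _ _)).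
apply: (@le_trans _ _ (n%:R * ((n%:R * (`|v| * `|M|)) * `|v|))).
  by rewrite ler_wpM2l// ler_wpM2r// norm_mulmx_le.
rewrite (_ : n%:R * _ = n%:R ^+ 2 * `|M| * `|v| ^+ 2); last by ring.
rewrite [leRHS](_ : _ = n%:R ^+ 2 * `|M| * ((n%:R * `|invmx B|) ^+ 2 * dotr (v *m B) (v *m B)));
  last by ring.
by rewrite ler_wpM2l ?mulr_ge0 ?sqr_ge0.
Qed.

Lemma hessian_continuous f O x : C2_on f O -> O x -> {for x, continuous (hessian f)}.
Proof.
move=> [_ [_ [_ [_ ddc]]]] Ox; apply/(cvgrPdist_le (F := nbhs x)) => eps eps0.
have near_ij : \forall y \near x, forall ij : 'I_n * 'I_n,
    `|pderiv (pderiv f ij.2) ij.1 x - pderiv (pderiv f ij.2) ij.1 y| <= eps.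
  apply: (@filter_forall _ _ (fun (ij : 'I_n * 'I_n) y =>
    `|pderiv (pderiv f ij.2) ij.1 x - pderiv (pderiv f ij.2) ij.1 y| <= eps) (nbhs x)) => ij.
  exact: cvgr_dist_le (ddc ij.1 ij.2 x (mem_set Ox)) _ eps0.
apply: filterS near_ij => y near_ij; apply/(mx_norm_leP _ (ltW eps0)) => i j.
by rewrite !mxE; exact: near_ij (i, j).
Qed.

Definition hessian_between f B (eps : R) z := forall v,
  (1 - eps) * dotr (v *m B) (v *m B) <= (v *m hessian f z *m v^T) 0 0 <=
  (1 + eps) * dotr (v *m B) (v *m B).

Lemma near_hessian_between f O x B (eps : R) : C2_on f O -> O x ->
  hessian f x = B *m B^T -> B \in unitmx -> 0 < eps ->
  \forall z \near x, hessian_between f B eps z.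
Proof.
move=> c2f Ox HB uB eps0; pose C : R := n%:R ^+ 2 * (n%:R * `|invmx B|) ^+ 2.
have C0 : 0 <= C by rewrite mulr_ge0 ?sqr_ge0.
have [d d0 Cd] := ex_gt0_mul_le C0 eps0.
have near_H : \forall z \near x, `|hessian f z - hessian f x| <= d.
  exact: (cvgr_distC_le (F := nbhs x)) (hessian_continuous c2f Ox) _ d0.
apply: filterS near_H => z zd v.
have := norm_quad_form_le (hessian f z - hessian f x) v uB; rewrite -/C.
rewrite mulmxBr mulmxBl mxE [X in _ + X]mxE {1}HB quad_form_gram.
have vB0 := dotr_ge0 (v *m B); move=> /le_trans/(_ (ler_wpM2r vB0 (ler_wpM2l C0 zd))).
move=> /le_trans/(_ (ler_wpM2r vB0 Cd)).
by rewrite ler_norml => /andP[? ?]; apply/andP; split; lra.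
Qed.

Lemma convex_segment (Q : set 'rV[R]_n) x y (s : R) : convex_set Q -> Q x -> Q y -> 0 <= s <= 1 ->
  Q (x + s *: (y - x)).
Proof.
move=> /convex_setP cQ Qx Qy /andP[]; rewrite !le_eqVlt => /predU1P[<-|s0].
  by rewrite scale0r addr0.
move=> /predU1P[->|s1]; first by rewrite scale1r addrC subrK.
have -> : x + s *: (y - x) = s *: y + (1 - s) *: x by apply/rowP => j; rewrite !mxE; ring.
by apply: cQ => //; rewrite s0.
Qed.

Section local_quadratic.
Variables (f : 'rV[R]_n -> R) (O Q : set 'rV[R]_n) (B : 'M[R]_n) (eps : R).
Hypotheses (c2f : C2_on f O) (QO : Q `<=` O) (cQ : convex_set Q).
Hypothesis QB : forall z, Q z -> hessian_between f B eps z.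
Local Notation sqB v := (dotr (v *m B) (v *m B)).

Lemma tangent_gap_between x z : Q x -> Q z ->
  (1 - eps) / 2 * sqB (x - z) <= f x - f z - dotr (grad f z) (x - z) <= (1 + eps) / 2 * sqB (x - z).
Proof.
move=> Qx Qz; have [s s01 ->] : exists2 s, 0 <= s <= 1 & f x = f z + dotr (grad f z) (x - z) +
    ((x - z) *m hessian f (z + s *: (x - z)) *m (x - z)^T) 0 0 / 2.
  by apply: taylor2 c2f _ => s s01; apply: QO; exact: convex_segment.
by have /andP[? ?] := QB (convex_segment cQ Qz Qx s01) (x - z); apply/andP; split; lra.
Qed.

Lemma minimizer_gap_ge (q : 'rV[R]_n * R) x z : Q x -> Q z ->
  (forall y, Q y -> f z - (dotr q.1 z + q.2) <= f y - (dotr q.1 y + q.2)) ->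
  0 <= f z - (dotr q.1 z + q.2) ->
  (1 - eps) / 2 * sqB (x - z) <= f x - (dotr q.1 x + q.2).
Proof.
move=> Qx Qz z_min fz0; have /andP[gap _] := tangent_gap_between Qx Qz.
suff : dotr q.1 (x - z) <= dotr (grad f z) (x - z) by rewrite linearB/=; lra.
have Oz0 : O (z + 0 *: (x - z)) by rewrite scale0r addr0; exact: QO.
have := C1_is_derive_line c2f.1 (C2_C1 c2f) Oz0; rewrite scale0r addr0 => dz.
apply: (is_derive_ge dz); near=> t; rewrite add0r scale0r addr0.
have t0 : 0 < t by near: t; exact: nbhs_right_gt.
have t1 : t < 1 by near: t; exact: nbhs_right_lt.
have t01 : 0 <= t <= 1 by rewrite !ltW.
have := z_min _ (convex_segment cQ Qz Qx t01); rewrite [dotr _ (z + _)]linearD/= linearZ/=; lra.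
Unshelve. all: end_near. Qed.

End local_quadratic.

Lemma midpoint_gt0 f O x y : C2plus_on f O -> convex_set O -> O x -> O y -> x != y ->
  0 < f x + f y - 2 * f (2^-1 *: (x + y)).
Proof.
move=> [c2f pd] cO Ox Oy xy; set m := 2^-1 *: (x + y); pose v := 2^-1 *: (y - x).
have ym : y - m = v by apply/rowP => j; rewrite !mxE; field.
have xm : x - m = - v by apply/rowP => j; rewrite !mxE; field.
have v0 : v != 0 by rewrite scaler_eq0 invr_eq0 pnatr_eq0/= subr_eq0 eq_sym.
have Om : O m.
  have -> : m = x + 2^-1 *: (y - x) by apply/rowP => j; rewrite !mxE; field.
  by apply: convex_segment => //; rewrite invr_ge0 ler0n/= invf_le1 ?ler1n.
have [s s01 ->] : exists2 s, 0 <= s <= 1 & f y = f m + dotr (grad f m) v +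
    (v *m hessian f (m + s *: v) *m v^T) 0 0 / 2.
  by rewrite -ym; apply: taylor2 c2f _ => s s01; exact: convex_segment.
have [t t01 ->] : exists2 t, 0 <= t <= 1 & f x = f m + dotr (grad f m) (- v) +
    ((- v) *m hessian f (m + t *: (- v)) *m (- v)^T) 0 0 / 2.
  by rewrite -xm; apply: taylor2 c2f _ => t t01; exact: convex_segment.
have Os : O (m + s *: v) by rewrite -ym; exact: convex_segment.
have Ot : O (m + t *: - v) by rewrite -xm; exact: convex_segment.
have := pd _ Os v v0; have := pd _ Ot (- v); rewrite oppr_eq0 linearN/= => /(_ v0).
by move: (_ 0 0) (_ 0 0) => a b; lra.
Qed.

End quadratic_model.

(** * Affine minorants of a C2 convex function *)

Section gap.
Context {R : realType} {n : nat}.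
Variables (p : R) (f om : 'rV[R]_n -> R) (O : set 'rV[R]_n) (A : set ('rV[R]_n * R)).
Hypotheses (n0 : (0 < n)%N) (p0 : 0 < p).
Hypotheses (c2f : C2plus_on f O) (convO : convex_set O) (bO : bounded_set O) (lipf : lip_on f O).
Hypothesis A_le : forall q x, A q -> O x -> dotr q.1 x + q.2 <= f x.
Hypothesis A_tangent : forall z, O z -> A (grad f z, f z - dotr (grad f z) z).
Hypotheses (om_cont : {in O, continuous om}) (om_gt0 : forall x, O x -> 0 < om x).
Hypothesis om_bounded : exists M : R, forall x, O x -> om x <= M.
Local Notation mu := (@leb_mx R n).
Local Notation r := (2 * p / n%:R).
Local Notation delta := (quantization_constant n p).

Let nR0 : 0 < n%:R :> R. Proof. by rewrite ltr0n. Qed.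
Let r0 : 0 < r. Proof. by rewrite divr_gt0// mulr_gt0. Qed.
Let C2f : C2_on f O. Proof. by case: c2f. Qed.
Let oO : open O. Proof. by case: C2f. Qed.
Let mO : measurable O. Proof. exact: open_measurable_mx. Qed.
Let f_cont x : O x -> {for x, continuous f}. Proof. exact: (C1_continuous oO (C2_C1 C2f)). Qed.

Definition gap (q : 'rV[R]_n * R) (x : 'rV[R]_n) : R := f x - (dotr q.1 x + q.2).

Definition gap_err (q : 'rV[R]_n * R) : 'rV[R]_n -> R := (fun x => gap q x `^ p * om x) \_ O.

Definition tangent (z : 'rV[R]_n) : 'rV[R]_n * R := (grad f z, f z - dotr (grad f z) z).

Let tangentA z : O z -> A (tangent z). Proof. exact: A_tangent. Qed.

Lemma gap_tangent z x : gap (tangent z) x = f x - f z - dotr (grad f z) (x - z).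
Proof. by rewrite /gap linearB/=; ring. Qed.

Let gap_ge0 q x : A q -> O x -> 0 <= gap q x.
Proof. by move=> Aq Ox; rewrite subr_ge0; exact: A_le. Qed.

Let gap_continuous q x : O x -> {for x, continuous (gap q)}.
Proof.
move=> Ox; apply: (continuousB (f_cont Ox)).
by apply: (continuousD (@continuous_dotr _ _ q.1 x)); exact: cst_continuous.
Qed.

Lemma gap_errE q x : O x -> gap_err q x = gap q x `^ p * om x.
Proof. by move=> Ox; rewrite /gap_err patchE mem_set. Qed.

Lemma gap_err_ge0 q x : 0 <= gap_err q x.
Proof.
rewrite /gap_err patchE; case: ifPn => //; rewrite inE => Ox.
by rewrite mulr_ge0 ?powR_ge0// ltW// om_gt0.
Qed.

Lemma measurable_gap_err q : measurable_fun setT (gap_err q).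
Proof.
apply/(measurable_restrictT _ mO); apply: measurable_funM; last exact: open_continuous_measurable_fun_mx.
apply: (measurableT_comp (measurable_powR p)); apply: open_continuous_measurable_fun_mx => // x.
by rewrite inE; exact: gap_continuous.
Qed.

Lemma ex_hessian_factor x : O x -> exists B : 'M[R]_n,
  [/\ is_trig_mx B^T, B \in unitmx, hessian f x = B *m B^T, 0 < \det (hessian f x) &
    \det (hessian f x) `^ (p / n%:R) = `|\det B| `^ r].
Proof.
move=> Ox; have [B [tB uB HB]] := cholesky (hessian_sym C2f Ox) (c2f.2 x Ox).
have dB : 0 < `|\det B| by rewrite normr_gt0 -unitfE -unitmxE.
have detH : \det (hessian f x) = `|\det B| ^+ 2.
  by rewrite HB det_mulmx det_tr -expr2 real_normK ?num_real.
exists B; split=> //; first by rewrite detH exprn_gt0.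
by rewrite detH powR_exprn ?(ltW dB)//; congr powR; field; rewrite gt_eqF.
Qed.

Definition weight x : R := delta / 2 `^ p * \det (hessian f x) `^ (p / n%:R) * om x.

Lemma weight_ge0 x : O x -> 0 <= weight x.
Proof.
move=> Ox; rewrite !mulr_ge0 ?powR_ge0 ?invr_ge0 ?powR_ge0 ?(ltW (om_gt0 Ox))//.
exact: quantization_constant_ge0.
Qed.

Lemma continuous_det k (M : 'rV[R]_n -> 'M[R]_k) x :
  (forall i j, {for x, continuous (fun y => M y i j)}) -> {for x, continuous (fun y => \det (M y))}.
Proof.
move=> M_cont; apply: (cvg_sumr (F := nbhs x)) => s; apply: cvgM; first exact: cvg_cst.
by apply: (cvg_prodr (F := nbhs x)) => i; exact: M_cont.
Qed.

Definition limit_density x : R :=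
  \det (hessian f x) `^ (p / (n%:R + 2 * p)) * om x `^ (n%:R / (n%:R + 2 * p)).

Lemma weight_powR x : O x ->
  weight x `^ (1 + r)^-1 = (delta / 2 `^ p) `^ (1 + r)^-1 * limit_density x.
Proof.
move=> Ox; have np : n%:R + 2 * p != 0 by rewrite gt_eqF// addr_gt0// mulr_gt0.
have delta0 : 0 <= delta / 2 `^ p.
  by rewrite divr_ge0 ?powR_ge0//; exact: quantization_constant_ge0.
rewrite /weight [LHS](powRM _ (mulr_ge0 delta0 (powR_ge0 _ _)) (ltW (om_gt0 Ox))).
rewrite [X in X * _ = _]powRM ?powR_ge0// -mulrA; congr (_ * _).
by rewrite -powRrM; congr (_ `^ _ * _ `^ _); field; rewrite np gt_eqF.
Qed.

Let det_hessian_powR_continuous x (s : R) : O x ->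
  {for x, continuous (fun y => \det (hessian f y) `^ s)}.
Proof.
move=> Ox; have [B [_ _ _ d0 _]] := ex_hessian_factor Ox.
apply: (@continuous_comp _ _ _ (fun y => \det (hessian f y)) (fun d : R => d `^ s) x).
  apply: continuous_det => i j; under [X in {for _, continuous X}]eq_fun do rewrite mxE.
  by case: C2f => _ [_ [_ [_ ddc]]]; apply: ddc; rewrite inE.
exact: continuous_powR.
Qed.

Definition model_factor (x : 'rV[R]_n) (s : R) : R := ((1 + s) / 2) `^ p * (1 + s) * om x.

Lemma ex_model_factor_lt x (K eps : R) : 0 < eps -> exists t, [/\ 0 < t, t < 1,
  model_factor x t * K < (2 `^ p)^-1 * om x * K + eps &
  (2 `^ p)^-1 * om x * K - eps < model_factor x (- t) * K].
Proof.
move=> eps0.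
have half : (2^-1) `^ p = (2 `^ p)^-1 :> R.
  have pow2 : 2 `^ p != 0 :> R by rewrite gt_eqF// powR_gt0.
  by apply: (mulfI pow2); rewrite mulfV// -powRM// mulfV// powR1.
have cvg0 : model_factor x s * K @[s --> (0 : R)] --> (2 `^ p)^-1 * om x * K.
  have -> : (2 `^ p)^-1 * om x * K = ((1 + 0) / 2) `^ p * (1 + 0) * om x * K.
    by rewrite addr0 mul1r mulr1 half.
  have cvg_add : (1 + s : R) @[s --> (0 : R)] --> (1 + 0 : R) by apply: cvgD; [exact: cvg_cst|exact: cvg_id].
  do 2 (apply: cvgMr_tmp); apply: cvgM => //.
  apply: (@continuous_cvg _ _ _ (nbhs (0 : R)) _ (fun s : R => (1 + s) / 2) (fun y : R => y `^ p)).
    by apply: continuous_powR; rewrite addr0 mul1r invr_gt0.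
  exact: cvgMr_tmp.
have near_eps : \forall s \near (0 : R), `|model_factor x s * K - (2 `^ p)^-1 * om x * K| < eps.
  exact: cvgr_distC_lt cvg0 _ eps0.
have /nbhs_ballP[rho /= rho0 near0] := near_eps.
have [t0 tr t2] : [/\ 0 < Num.min (rho / 2) 2^-1, Num.min (rho / 2) 2^-1 <= rho / 2 &
    Num.min (rho / 2) 2^-1 <= 2^-1].
  by rewrite lt_min divr_gt0// invr_gt0 ltr0n !ge_min !lexx orbT.
set t := Num.min _ _ in t0 tr t2; exists t.
have near_t s : `|s| <= t -> `|model_factor x s * K - (2 `^ p)^-1 * om x * K| < eps.
  by move=> st; apply: near0; rewrite -ball_normE /= sub0r normrN (le_lt_trans st)//; lra.
have := near_t t; have := near_t (- t); rewrite normrN gtr0_norm// => /(_ (lexx _)) + /(_ (lexx _)).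
by rewrite !ltr_norml => /andP[? ?] /andP[? ?]; split; lra.
Qed.

Lemma continuous_limit_density : {in O, continuous limit_density}.
Proof.
move=> x; rewrite inE => Ox.
have om_pow : {for x, continuous (fun y => om y `^ (n%:R / (n%:R + 2 * p)))}.
  apply: (@continuous_comp _ _ _ om (fun y : R => y `^ _) x); first by apply: om_cont; rewrite inE.
  exact: continuous_powR (om_gt0 Ox).
exact: (continuousM (det_hessian_powR_continuous Ox) om_pow).
Qed.

Section local_model.
Variables (x0 : 'rV[R]_n) (B : 'M[R]_n) (t : R).
Hypotheses (Ox0 : O x0) (uB : B \in unitmx) (t0 : 0 < t) (t1 : t < 1).

Let t_gtN1 : -1 < t. Proof. exact: lt_trans (ltrN10 R) t0. Qed.
Let tN_gtN1 : -1 < - t. Proof. by rewrite ltrN2. Qed.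
Let t1B : 0 <= 1 - t. Proof. by rewrite subr_ge0 ltW. Qed.

Local Notation c := (model_factor x0).

Let c_gt0 s : -1 < s -> 0 < c s.
Proof. by move=> s1; rewrite !mulr_gt0 ?powR_gt0 ?divr_gt0 ?om_gt0//; lra. Qed.

Let scaled_sq (s d : R) : -1 < s -> 0 <= d ->
  ((1 + s) / 2 * d) `^ p * ((1 + s) * om x0) = c s * d `^ p.
Proof. by move=> s1 d0; rewrite powRM ?divr_ge0//; [rewrite /c; ring|lra]. Qed.

Let ellipsoid_powE z x : ellipsoid_pow p B z x = dotr ((x - z) *m B) ((x - z) *m B) `^ p.
Proof. by rewrite /ellipsoid_pow /dist_pow mulmxBl. Qed.

Definition quadratic_region : set 'rV[R]_n :=
  [set z | [/\ O z, hessian_between f B t z & `|om z - om x0| <= t * om x0]].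

Lemma near_quadratic_region : hessian f x0 = B *m B^T -> nbhs x0 quadratic_region.
Proof.
move=> HB; have nearO : \forall z \near x0, O z by exact: open_nbhs_nbhs.
have near_om : \forall z \near x0, `|om z - om x0| <= t * om x0.
  by apply: cvgr_distC_le (om_cont (mem_set Ox0)) _ _; rewrite mulr_gt0// om_gt0.
have near_H := near_hessian_between C2f Ox0 HB uB t0.
by apply: filterS3 nearO near_H near_om.
Qed.

Variable Q : set 'rV[R]_n.
Hypotheses (cQ : convex_set Q) (QU : Q `<=` quadratic_region).

Let QO : Q `<=` O. Proof. by move=> z /QU[]. Qed.
Let QB z : Q z -> hessian_between f B t z. Proof. by move=> /QU[]. Qed.
Let om_between z : Q z -> (1 - t) * om x0 <= om z <= (1 + t) * om x0.
Proof. by move=> /QU[_ _]; rewrite ler_norml => /andP[? ?]; apply/andP; split; lra. Qed.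

Lemma gap_err_tangent_le z x : Q z -> Q x ->
  gap_err (tangent z) x <= c t * ellipsoid_pow p B z x.
Proof.
move=> Qz Qx; have Ox := QO Qx; have Oz := QO Qz.
have /andP[_ gap_le] := tangent_gap_between C2f QO cQ QB Qx Qz.
have /andP[_ om_le] := om_between Qx.
rewrite gap_errE// ellipsoid_powE -scaled_sq ?dotr_ge0//.
apply: ler_pM => //; [exact: powR_ge0|exact: ltW (om_gt0 Ox)|].
by apply: le_powR; [exact: ltW|exact: gap_ge0 (tangentA Oz) Ox|rewrite gap_tangent].
Qed.

Lemma ex_gap_err_ge q : compact Q -> Q !=set0 -> A q -> exists z, Q z /\
  forall x, Q x -> c (- t) * ellipsoid_pow p B z x <= gap_err q x.
Proof.
move=> compQ Q0 Aq; have [z zQ z_min] : exists2 z, z \in Q & forall y, y \in Q -> gap q z <= gap q y.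
  apply: EVT_min_rV => //; apply: continuous_in_subspaceT => y; rewrite inE => /QO.
  exact: gap_continuous.
rewrite inE in zQ; exists z; split=> // x Qx; have Ox := QO Qx.
have gap_ge : (1 - t) / 2 * dotr ((x - z) *m B) ((x - z) *m B) <= gap q x.
  apply: (minimizer_gap_ge C2f QO cQ QB) => //; last exact: gap_ge0 Aq (QO zQ).
  by move=> y Qy; apply: z_min; rewrite inE.
have /andP[om_ge _] := om_between Qx.
have sq0 : 0 <= (1 - t) / 2 * dotr ((x - z) *m B) ((x - z) *m B).
  by rewrite mulr_ge0 ?dotr_ge0// divr_ge0.
rewrite gap_errE// ellipsoid_powE -scaled_sq ?dotr_ge0//.
apply: ler_pM => //; [exact: powR_ge0| |exact: le_powR (ltW p0) sq0 gap_ge].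
by rewrite mulr_ge0 ?(ltW (om_gt0 Ox0)).
Qed.

Lemma best_gap_err_between k : measurable Q -> compact Q -> Q !=set0 ->
  ((c (- t))%:E * best_err mu (ellipsoid_pow p B) Q Q k <= best_err mu gap_err A Q k <=
   (c t)%:E * best_err mu (ellipsoid_pow p B) Q Q k)%E.
Proof.
move=> mQ compQ Q0; have ct : 0 < c t by exact: c_gt0.
have cNt : 0 < c (- t) by exact: c_gt0.
apply/andP; split; last first.
  apply: (@le_best_err_map _ _ R mu _ _ _ _ A Q tangent) => //.
  - exact: gap_err_ge0.
  - exact: measurable_gap_err.
  - exact: ellipsoid_pow_ge0.
  - exact: measurable_ellipsoid_pow.
  - by move=> z /QO; exact: tangentA.
  - exact: gap_err_tangent_le.
have /choice[phi phiP] q : exists z, A q -> Q z /\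
    forall x, Q x -> c (- t) * ellipsoid_pow p B z x <= gap_err q x.
  have [Aq|nAq] := pselect (A q); last by exists 0.
  by have [z zP] := ex_gap_err_ge compQ Q0 Aq; exists z.
rewrite -lee_pdivlMl//; apply: (@le_best_err_map _ _ R mu _ _ _ _ Q A phi) => //.
- by rewrite invr_gt0.
- exact: ellipsoid_pow_ge0.
- exact: measurable_ellipsoid_pow.
- exact: gap_err_ge0.
- exact: measurable_gap_err.
- by move=> q /phiP[].
- by move=> q x Aq Qx; rewrite ler_pdivlMl//; have [_] := phiP q Aq; apply.
Qed.

End local_model.

Lemma gap_local_density x : O x ->
  local_density gap_err A r (fun x => (delta / 2 `^ p) `^ (1 + r)^-1 * limit_density x) x.
Proof.
move=> Ox; rewrite /local_density -weight_powR//.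
apply: (local_density_powR (w := weight)) => // [|eps eps0|]; [exact: weight_ge0| |exact: gap_err_ge0].
have [B [tB uB HB _ detB]] := ex_hessian_factor Ox.
pose L := delta * `|\det B| `^ r.
have -> : weight x = (2 `^ p)^-1 * om x * L by rewrite /weight detB /L; ring.
have [t [t0 t1 up lo]] := ex_model_factor_lt x L eps0.
apply: filterS (near_small_cubes_sub (near_quadratic_region Ox uB t0 HB)) => -[a h] /= [h0 aU].
have hn0 : 0 < (h ^+ n) `^ (1 + r) by rewrite powR_gt0// exprn_gt0.
have cvgL := ellipsoid_quantization_cvg n0 p0 tB uB a h0; rewrite -/L in cvgL.
have upL : ((model_factor x t)%:E * (L * (h ^+ n) `^ (1 + r))%:E <
    (((2 `^ p)^-1 * om x * L + eps) * (h ^+ n) `^ (1 + r))%:E)%E.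
  by rewrite -EFinM lte_fin [ltLHS]mulrA ltr_pM2r.
have loL : ((((2 `^ p)^-1 * om x * L - eps) * (h ^+ n) `^ (1 + r))%:E <
    (model_factor x (- t))%:E * (L * (h ^+ n) `^ (1 + r))%:E)%E.
  by rewrite -EFinM lte_fin [ltRHS]mulrA ltr_pM2r.
set best := fun k => ((k%:R `^ r)%:E * _)%E in cvgL.
have near_up : \forall k \near \oo, ((model_factor x t)%:E * best k <
    (((2 `^ p)^-1 * om x * L + eps) * (h ^+ n) `^ (1 + r))%:E)%E.
  exact: (cvgeZl (y := (model_factor x t)%:E) isT cvgL) _ (open_ereal_lt' upL).
have near_lo : \forall k \near \oo, ((((2 `^ p)^-1 * om x * L - eps) * (h ^+ n) `^ (1 + r))%:E <
    (model_factor x (- t))%:E * best k)%E.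
  exact: (cvgeZl (y := (model_factor x (- t))%:E) isT cvgL) _ (open_ereal_gt' loL).
apply: filterS2 near_lo near_up => k /ltW lo_k /ltW up_k.
have cube0 : ccube a h !=set0 by exists a; exact: ccube_corner (ltW h0).
have /andP[le_best best_le] := best_gap_err_between Ox t0 t1 (@convex_ccube R n a h) aU k
  (measurable_ccube a h) (@compact_ccube R n a h) cube0.
apply/andP; split.
  by apply: (le_trans lo_k); rewrite muleCA lee_wpmul2l ?lee_fin ?powR_ge0.
by apply: le_trans up_k; rewrite [leRHS]muleCA lee_wpmul2l ?lee_fin ?powR_ge0.
Qed.

Let midO x y : O x -> O y -> O (2^-1 *: (x + y)).
Proof.
move=> Ox Oy; have -> : 2^-1 *: (x + y) = x + 2^-1 *: (y - x).
  by apply/rowP => j; rewrite !mxE; field.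
by apply: convex_segment => //; rewrite invr_ge0 ler0n/= invf_le1 ?ler1n.
Qed.

Let midpoint_gap (xy : 'rV[R]_n * 'rV[R]_n) : R := f xy.1 + f xy.2 - 2 * f (2^-1 *: (xy.1 + xy.2)).

Let midpoint_gap_continuous xy : O xy.1 -> O xy.2 -> {for xy, continuous midpoint_gap}.
Proof.
move=> O1 O2; apply: continuousB.
  apply: continuousD.
    by apply: (@continuous_comp _ _ _ fst f); [exact: cvg_fst|exact: f_cont].
  by apply: (@continuous_comp _ _ _ snd f); [exact: cvg_snd|exact: f_cont].
apply: continuousM; first exact: cst_continuous.
apply: (@continuous_comp _ _ _ (fun z : 'rV[R]_n * 'rV[R]_n => 2^-1 *: (z.1 + z.2)) f).
  by apply: cvgZr; apply: cvgD; [exact: cvg_fst|exact: cvg_snd].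
by apply: f_cont; exact: midO.
Qed.

Lemma ex_midpoint_gap (K K' : set 'rV[R]_n) : compact K -> compact K' -> K `<=` O -> K' `<=` O ->
  K !=set0 -> K' !=set0 -> K `&` K' = set0 ->
  exists2 g : R, 0 < g & forall x y, K x -> K' y -> g <= f x + f y - 2 * f (2^-1 *: (x + y)).
Proof.
move=> cK cK' KO KO' [x Kx] [y Ky] dis.
have [[z1 z2] z_in z_min] : exists2 z, z \in K `*` K' &
    forall y, y \in K `*` K' -> midpoint_gap z <= midpoint_gap y.
  apply: compact_EVT_min; [by exists (x, y)|exact: compact_setX|].
  apply: continuous_in_subspaceT => -[y1 y2]; rewrite inE => -[/= /KO O1 /KO' O2].
  exact: midpoint_gap_continuous.
move: z_in; rewrite inE => -[/= Kz1 Kz2].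
exists (midpoint_gap (z1, z2)) => [|a b Ka Kb]; last by apply: (z_min (a, b)); rewrite inE.
apply: (midpoint_gt0 c2f convO (KO _ Kz1) (KO' _ Kz2)).
apply/eqP => z12; have : (K `&` K') z1 by split=> //; rewrite z12.
by rewrite dis.
Qed.

Lemma ex_om_ge (K : set 'rV[R]_n) : compact K -> K `<=` O -> K !=set0 ->
  exists2 w : R, 0 < w & forall x, K x -> w <= om x.
Proof.
move=> cK KO K0; have [z zK z_min] : exists2 z, z \in K & forall y, y \in K -> om z <= om y.
  apply: EVT_min_rV => //; apply: continuous_in_subspaceT => y; rewrite inE => /KO Oy.
  by apply: om_cont; rewrite inE.
rewrite inE in zK; exists (om z); first by apply: om_gt0; exact: KO.
by move=> x Kx; apply: z_min; rewrite inE.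
Qed.

(* An affine minorant close to [f] at both [x] and [y] would violate strict convexity at their midpoint. *)
Lemma gap_err_separated (K K' : set 'rV[R]_n) : compact K -> compact K' -> K `<=` O -> K' `<=` O ->
  K !=set0 -> K' !=set0 -> K `&` K' = set0 -> separated gap_err A K K'.
Proof.
move=> cK cK' KO KO' K0 K0' dis.
have [g g0 g_le] := ex_midpoint_gap cK cK' KO KO' K0 K0' dis.
have [w w0 w_le] : exists2 w : R, 0 < w & forall x, (K `|` K') x -> w <= om x.
  apply: ex_om_ge; [exact: compactU|by move=> x [/KO|/KO']|].
  by have [x Kx] := K0; exists x; left.
exists ((g / 2) `^ p * w) => [|q x y Aq Kx Ky]; first by rewrite mulr_gt0 ?powR_gt0 ?divr_gt0.
have large z : O z -> w <= om z -> g / 2 <= gap q z -> (g / 2) `^ p * w <= gap_err q z.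
  move=> Oz wz gz; rewrite gap_errE//; apply: ler_pM => //; [exact: powR_ge0|exact: ltW|].
  by apply: le_powR gz; [exact: ltW|rewrite divr_ge0 ?ltW].
have sum_ge : g <= gap q x + gap q y.
  apply: (le_trans (g_le _ _ Kx Ky)); have := A_le Aq (midO (KO _ Kx) (KO' _ Ky)).
  by rewrite linearZ/= linearD/= /gap; lra.
have [gx|gx] := leP (g / 2) (gap q x).
  by rewrite le_max large//; [exact: KO|apply: w_le; left].
have gy : g / 2 <= gap q y by lra.
by rewrite le_max (large y) ?orbT//; [exact: KO'|apply: w_le; right].
Qed.

Lemma pderiv_le_lip (L : R) z i : (forall x y, O x -> O y -> `|f x - f y| <= L * `|x - y|) ->
  O z -> `|pderiv f i z| <= `|L|.
Proof.
move=> lipL Oz; have [df _] := C2_C1 C2f.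
have df0 : derivable f (z + 0 *: ebase R i) (ebase R i) by rewrite scale0r addr0; exact: df.
have := is_derive_line df0; rewrite scale0r addr0 -/(pderiv f i z) => dz.
have /nbhs_ballP[rho /= rho0 rho_O] : nbhs z O by exact: open_nbhs_nbhs.
have near_lip : \forall t \near 0^'+, `|f (z + t *: ebase R i) - f z| <= t * `|L|.
  near=> t; have t0 : 0 < t by near: t; exact: nbhs_right_gt.
  have t_rho : t < rho by near: t; exact: nbhs_right_lt.
  have te : `|t *: ebase R i| <= t by rewrite -[leRHS](gtr0_norm t0); exact: norm_scale_ebase_le.
  have Ot : O (z + t *: ebase R i).
    by apply: rho_O; rewrite -ball_normE /= opprD addNKr normrN (le_lt_trans te).
  apply: (le_trans (lipL _ _ Ot Oz)); rewrite addrC addKr mulrC.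
  apply: (@le_trans _ _ (`|t *: ebase R i| * `|L|)); first by rewrite ler_wpM2l// ler_norm.
  by rewrite ler_wpM2r.
rewrite ler_norml; apply/andP; split.
  apply: (is_derive_ge dz); apply: filterS near_lip => t; rewrite add0r scale0r addr0.
  by rewrite ler_norml mulrN => /andP[].
apply: (is_derive_le dz); apply: filterS near_lip => t; rewrite add0r scale0r addr0.
by rewrite ler_norml => /andP[].
Unshelve. all: end_near. Qed.

Lemma bounded_grad : bounded_set (grad f @` O).
Proof.
have [L lipL] := lipf; rewrite /= /bounded_near; near=> M => _ [z Oz <-] /=.
apply: (@le_trans _ _ `|L|); last by near: M; apply: nbhs_pinfty_ge; rewrite num_real.
by apply/(mx_norm_leP _ (normr_ge0 _)) => i j; rewrite mxE pderiv_le_lip.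
Unshelve. all: end_near. Qed.

(* For monotone [grad f] the tangent error is controlled by the distance of the points [z + grad f z]. *)
Lemma gap_tangent_le x z : O x -> O z ->
  gap (tangent z) x <= dotr (x + grad f x - (z + grad f z)) (x + grad f x - (z + grad f z)).
Proof.
move=> Ox Oz; have := gap_ge0 (tangentA Ox) Oz; rewrite !gap_tangent.
set a := x - z; set b := grad f x - grad f z.
have -> : x + grad f x - (z + grad f z) = a + b by rewrite opprD addrACA.
have -> : dotr (grad f z) a = dotr (grad f x) a - dotr a b.
  by rewrite ![dotr _ a]dotrC /b linearB/=; ring.
rewrite -[z - x]opprB -/a linearN/= => tangent_x.
have := dotr_ge0 a; have := dotr_ge0 b; have := dotr_ge0 (a + b).
rewrite sqr_dotrD; lra.
Qed.

Lemma gap_err_uniform_bound : exists2 C : R, 0 <= C & uniform_bound gap_err A O r C.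
Proof.
have [M om_le] := om_bounded; pose Phi z := z + grad f z.
have bPhi : bounded_set (Phi @` O).
  have /ex_strict_bound_gt0[a _ a_le] := bO; have /ex_strict_bound_gt0[b _ b_le] := bounded_grad.
  rewrite /= /bounded_near; near=> N => _ [z Oz <-] /=.
  apply: (@le_trans _ _ (a + b)); last by near: N; apply: nbhs_pinfty_ge; rewrite num_real.
  apply: (le_trans (ler_normD _ _)); apply: lerD; apply: ltW; first exact: a_le.
  by apply: b_le; exists z.
have [C C0 net] := ex_net n0 bPhi.
exists ((n%:R * C ^+ 2) `^ p * `|M|); first by rewrite mulr_ge0// powR_ge0.
move=> k k0; have [s [sk sO s_net]] := net k k0.
exists (map tangent s); split; first by rewrite size_map.
  by move=> _ /mapP[z zs ->]; apply: tangentA; exact: sO.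
move=> x Ox; have [z zs xz] := s_net x Ox; have Oz := sO _ zs.
apply: (le_trans (err_le _ _ (map_f _ zs))); rewrite lee_fin gap_errE//.
set d : R := k%:R `^ (- n%:R^-1) in xz; have d0 : 0 <= d by exact: powR_ge0.
have -> : k%:R `^ (- r) = (d ^+ 2) `^ p.
  by rewrite powR_exprn// /d -powRrM; congr powR; field; rewrite gt_eqF.
rewrite mulrAC -powRM ?mulr_ge0 ?sqr_ge0//.
apply: ler_pM; [exact: powR_ge0|exact: ltW (om_gt0 Ox)| |exact: le_trans (om_le _ Ox) (ler_norm _)].
apply: le_powR; [exact: ltW|exact: gap_ge0 (tangentA Oz) Ox|].
apply: (le_trans (gap_tangent_le Ox Oz)); apply: (le_trans (dotr_le_norm _)).
by rewrite -mulrA -exprMn ler_wpM2l// lerXn2r ?nnegrE// mulr_ge0.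
Unshelve. all: end_near. Qed.

Let fine_EFinMl (c : R) (y : \bar R) : 0 <= c -> fine (c%:E * y) = c * fine y.
Proof.
rewrite le_eqVlt => /predU1P[<-|c0]; first by rewrite mul0e mul0r.
by case: y => [y| |]; rewrite ?gt0_muley ?gt0_muleNy ?lte_fin//= mulr0.
Qed.

Theorem gap_limit :
  ((m%:R `^ r)%:E * best_err mu gap_err A O m)%E @[m --> \oo] -->
  (delta / 2 `^ p * fine (\int[mu]_(x in O) (limit_density x)%:E) `^ (1 + r))%:E.
Proof.
have [C C0 rate] := gap_err_uniform_bound; set c := (delta / 2 `^ p) `^ (1 + r)^-1.
have c0 : 0 <= c by exact: powR_ge0.
have dens0 x : O x -> 0 <= c * limit_density x by move=> _; rewrite !mulr_ge0 ?powR_ge0.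
have dens_cont : {in O, continuous (fun x => c * limit_density x)}.
  move=> x Ox; have c_cont : {for x, continuous (fun _ : 'rV[R]_n => c)} by exact: cst_continuous.
  exact: (continuousM c_cont (continuous_limit_density Ox)).
have [|_] := density_limit r0 oO bO gap_err_ge0 measurable_gap_err dens_cont dens0 gap_local_density _
    C0 rate.
  move=> a b h h0 aO bO' dis; apply: gap_err_separated => //; try exact: compact_ccube.
  - by exists a; exact: ccube_corner (ltW h0).
  - by exists b; exact: ccube_corner (ltW h0).
under eq_integral do rewrite EFinM.
rewrite ge0_integralZl//; last 2 first.
- by apply/measurable_EFinP; exact: open_continuous_measurable_fun_mx oO continuous_limit_density.
- by move=> x _; rewrite lee_fin mulr_ge0 ?powR_ge0.
rewrite fine_EFinMl// powRM ?fine_ge0//; last first.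
  by apply: integral_ge0 => x _; rewrite lee_fin mulr_ge0 ?powR_ge0.
by rewrite /c powRVK ?addr_gt0 ?divr_ge0 ?powR_ge0 ?quantization_constant_ge0.
Qed.

End gap.

(** * Convex functions *)

Section convex_functions.
Context {R : realType} {n : nat}.
Implicit Types (K : set 'rV[R]_n) (f : 'rV[R]_n -> R) (x y : 'rV[R]_n).

Definition convex_on K f := forall x y (t : R), K x -> K y -> 0 < t < 1 ->
  f (t *: x + (1 - t) *: y) <= t * f x + (1 - t) * f y.

Lemma convex_sublevel K f (M : R) : convex_set K -> convex_on K f ->
  convex_set [set x | K x /\ f x <= M].
Proof.
move=> /convex_setP cK cf; apply/convex_setP => x y t [Kx fx] [Ky fy] t01; split; first exact: cK.
have /andP[t0 t1] := t01; apply: (le_trans (cf _ _ _ Kx Ky t01)).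
have -> : M = t * M + (1 - t) * M by ring.
by apply: lerD; rewrite ler_wpM2l ?subr_ge0 ?(ltW t0) ?(ltW t1).
Qed.

(* The induction carries a point of positive weight, so that no division by zero occurs. *)
Lemma convex_set_wsum K (I : Type) (s : seq I) (c : I -> R) (y : I -> 'rV[R]_n) x (T : R) :
  convex_set K -> (forall i, 0 <= c i) -> (forall i, K (y i)) -> K x -> 0 < T ->
  T + \sum_(i <- s) c i = 1 -> K (T *: x + \sum_(i <- s) c i *: y i).
Proof.
move=> /convex_setP cK c0 Ky; elim: s x T => [|i s IH] x T Kx T0.
  by rewrite !big_nil !addr0 => ->; rewrite scale1r.
rewrite !big_cons !addrA => tot.
have [ci|ci] := eqVneq (c i) 0.
  by rewrite ci scale0r addr0; apply: IH => //; rewrite -tot ci addr0.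
have ci0 : 0 < c i by rewrite lt_neqAle eq_sym ci c0.
have Tc : 0 < T + c i by rewrite addr_gt0.
pose t := T / (T + c i).
have t01 : 0 < t < 1 by rewrite divr_gt0//= ltr_pdivrMr// mul1r ltrDl.
have -> : T *: x + c i *: y i = (T + c i) *: (t *: x + (1 - t) *: y i).
  by rewrite scalerDr !scalerA /t; congr (_ *: _ + _ *: _); field; rewrite gt_eqF.
by apply: IH => //; exact: cK.
Qed.

Lemma spanning_points K x0 : K x0 -> exists N (y : 'I_N -> 'rV[R]_n), (forall i, K (y i)) /\
  forall x, K x -> (x - x0 <= \matrix_i (y i - x0))%MS.
Proof.
move=> Kx0.
pose P d := `[< exists N (y : 'I_N -> 'rV[R]_n), (forall i, K (y i)) /\
  \rank (\matrix_i (y i - x0)) = d >].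
have P0 : exists d, P d.
  by eexists; apply/asboolP; exists 0%N, (fun _ => x0); split.
have Pn d : P d -> (d <= n)%N by move=> /asboolP[N [y [_ <-]]]; exact: rank_leq_col.
have [d /asboolP[N [y [Ky rE]]] dmax] := ex_maxnP P0 Pn.
exists N, y; split=> // x Kx.
pose y' (j : 'I_N.+1) := if unlift ord0 j is Some i then y i else x.
pose M := \matrix_i (y i - x0); pose M' := \matrix_i (y' i - x0).
have MM' : (M <= M')%MS.
  apply/row_subP => i; have -> : row i M = row (lift ord0 i) M' by rewrite !rowK /y' liftK.
  exact: row_sub.
have rM : (\rank M' <= \rank M)%N.
  rewrite [X in (_ <= X)%N]rE; apply: dmax; apply/asboolP; exists N.+1, y'; split=> // j.
  by rewrite /y'; case: unliftP.
have M'M : (M' <= M)%MS by rewrite -(mxrank_leqif_sup MM') eqn_leq rM mxrankS.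
apply: submx_trans M'M.
have -> : x - x0 = row ord0 M' by rewrite rowK /y' unlift_none.
exact: row_sub.
Qed.

Lemma bounded_affine_coordinates K : bounded_set K -> K !=set0 ->
  exists N (y : 'I_N.+1 -> 'rV[R]_n) (D : R), (forall j, K (y j)) /\
  forall x, K x -> exists l : 'I_N.+1 -> R,
    [/\ \sum_j l j = 1, x = \sum_j l j *: y j & forall j, l j <= D].
Proof.
move=> /ex_strict_bound_gt0[M M0 KM] [x0 Kx0]; have [N [y [Ky span]]] := spanning_points Kx0.
pose A := \matrix_i (y i - x0); pose l x : 'rV[R]_N := (x - x0) *m pinvmx A.
pose L := n%:R * ((M + M) * `|pinvmx A|).
have l_le x i : K x -> `|l x 0 i| <= L.
  move=> Kx; apply: (le_trans (mx_entry_le_norm _ _ _)); apply: (le_trans (norm_mulmx_le _ _)).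
  rewrite ler_wpM2l// ler_wpM2r// (le_trans (ler_normB _ _))// lerD// ltW//; exact: KM.
have NL0 : 0 <= N%:R * L by rewrite !mulr_ge0// ?addr_ge0// ltW.
pose ext (V : Type) (v : V) (w : 'I_N -> V) (j : 'I_N.+1) := if unlift ord0 j is Some i then w i else v.
have ext0 (V : Type) (v : V) w : ext V v w ord0 = v by rewrite /ext unlift_none.
have extS (V : Type) (v : V) w i : ext V v w (lift ord0 i) = w i by rewrite /ext liftK.
exists N, (ext _ x0 y), (1 + N%:R * L + L); split=> [j|x Kx].
  by rewrite /ext; case: unliftP.
have suml : `|\sum_i l x 0 i| <= N%:R * L.
  apply: (le_trans (ler_norm_sum _ _ _)); apply: (@le_trans _ _ (\sum_(i < N) L)).
    by apply: ler_sum => i _; exact: l_le.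
  by rewrite sumr_const card_ord mulr_natl.
exists (ext _ (1 - \sum_i l x 0 i) (fun i => l x 0 i)); split.
- by rewrite big_ord_recl ext0 (eq_bigr _ (fun i _ => extS _ _ _ i)) subrK.
- rewrite big_ord_recl !ext0 (eq_bigr (fun i => l x 0 i *: y i)) => [|i _]; last by rewrite !extS.
  have xE : x - x0 = \sum_i l x 0 i *: y i - (\sum_i l x 0 i) *: x0.
    rewrite -[LHS](mulmxKpV (span x Kx)) mulmx_sum_row scaler_suml -sumrB.
    by apply: eq_bigr => i _; rewrite rowK scalerBr.
  by rewrite scalerBl scale1r addrAC -addrA -xE addrC subrK.
move=> j; rewrite /ext; case: unliftP => [i _|_].
  by have := l_le x i Kx; rewrite ler_norml => /andP[_ ?]; lra.
have L0 : 0 <= L by rewrite mulr_ge0// mulr_ge0// addr_ge0// ltW.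
by move: suml; rewrite ler_norml => /andP[? _]; lra.
Qed.

(* The barycenter of the spanning points is a combination of any [x] in [K], with a fixed weight,
   and of a point of the simplex, where [f] is bounded above. *)
Lemma convex_bounded_below K f : bounded_set K -> convex_set K -> convex_on K f ->
  exists m : R, forall x, K x -> m <= f x.
Proof.
move=> bK cK cf; have [K0|K0] := pselect (K !=set0); last first.
  by exists 0 => x Kx; case: K0; exists x.
have [N [y [D [Ky coord]]]] := bounded_affine_coordinates bK K0.
pose N1 : R := N.+1%:R; have N10 : 0 < N1 by rewrite ltr0n.
pose D1 := `|D| + 2; have D10 : 0 < D1 by rewrite ltr_wpDl.
pose eps := (N1 * D1)^-1; have eps0 : 0 < eps by rewrite invr_gt0 mulr_gt0.
have eps1 : eps < 1.
  have N11 : 1 <= N1 by rewrite ler1n.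
  rewrite invf_lt1 ?mulr_gt0//; apply: (@lt_le_trans _ _ D1); last by rewrite ler_peMl// ltW.
  by rewrite ltr_wpDl// ltr1n.
have eps1B : 0 < 1 - eps by rewrite subr_gt0.
pose M := \sum_j `|f (y j)|; pose b := \sum_j N1^-1 *: y j.
exists (eps^-1 * (f b - (1 - eps) * M)) => x Kx; rewrite ler_pdivrMl//.
have [l [l1 xE lD]] := coord x Kx.
pose w j := (N1^-1 - eps * l j) / (1 - eps); pose z := \sum_j w j *: y j.
have bE : b = eps *: x + (1 - eps) *: z.
  rewrite {1}xE /b /z !scaler_sumr -big_split/=; apply: eq_bigr => j _.
  by rewrite !scalerA -scalerDl [(1 - eps) * _]mulrC divfK ?gt_eqF// addrC subrK.
have w0 j : 0 < w j.
  rewrite divr_gt0// subr_gt0 /eps invfM -mulrA gtr_pMr ?invr_gt0// mulrC ltr_pdivrMr// mul1r.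
  by rewrite (le_lt_trans (lD j))// (le_lt_trans (ler_norm D))// ltrDl.
have sumw : \sum_j w j = 1.
  rewrite -mulr_suml sumrB -mulr_sumr l1 mulr1 sumr_const card_ord -mulr_natl mulfV ?gt_eqF//.
  by rewrite mulfV// gt_eqF.
have [Kz fz] : [set x | K x /\ f x <= M] z.
  move: sumw; rewrite /z !big_ord_recl => sumw.
  apply: (convex_set_wsum (convex_sublevel cK cf) _ _ _ _ sumw) => //.
  - by move=> i; exact: ltW.
  - move=> i; split=> //; apply: (le_trans (ler_norm _)); rewrite /M (bigD1 (lift ord0 i))//= lerDl.
    by apply: sumr_ge0.
  - split=> //; apply: (le_trans (ler_norm _)); rewrite /M (bigD1 ord0)//= lerDl.
    by apply: sumr_ge0.
rewrite bE; have eps01 : 0 < eps < 1 by rewrite eps0.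
rewrite lerBlDr; apply: (le_trans (cf _ _ _ Kx Kz eps01)).
by rewrite lerD2l ler_wpM2l// ltW.
Qed.

End convex_functions.

(** * Proof of the theorem *)

Section main.
Context {R : realType} {n : nat}.
Variables (p : R) (u : 'rV[R]_n -> \bar R) (omega : 'rV[R]_n * R -> R).
Hypotheses (n0 : (0 < n)%N) (p0 : 0 < p).
Hypotheses (u_ninfty : forall x, (-oo < u x)%E) (convu : convex_ext u) (cdom : compact (dom u)).
Local Notation f := (fun x => fine (u x)).
Hypotheses (lipu : lip_on f (dom u)°) (c2u : C2plus_on f (dom u)°).
Hypotheses (omega_cont : continuous omega) (omega_gt0 : forall z, 0 < omega z).
Local Notation mu := (@leb_mx R n).
Local Notation r := (2 * p / n%:R).
Local Notation K := (dom u).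
Local Notation O := ((dom u)° : set 'rV[R]_n).
Local Notation om := (fun x => omega (x, fine (u x))).

Let oO : open O. Proof. exact: open_interior. Qed.
Let mO : measurable O. Proof. exact: open_measurable_mx. Qed.
Let OK : O `<=` K. Proof. exact: interior_subset. Qed.
Let bK : bounded_set K. Proof. exact: compact_bounded. Qed.
Let bO : bounded_set O. Proof. exact: sub_bounded_set bK. Qed.

Let uE x : K x -> u x = (f x)%:E.
Proof. by move=> Kx; rewrite fineK// fin_numE; rewrite gt_eqF//= lt_eqF. Qed.

Let convex_u x y (t : R) : K x -> K y -> 0 < t < 1 ->
  K (t *: x + (1 - t) *: y) /\ f (t *: x + (1 - t) *: y) <= t * f x + (1 - t) * f y.
Proof.
move=> Kx Ky t01; have := convu x y t01; rewrite (uE Kx) (uE Ky) -!EFinM -EFinD => le_u.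
have Kz : K (t *: x + (1 - t) *: y) by exact: le_lt_trans le_u (ltry _).
by split=> //; move: le_u; rewrite (uE Kz) lee_fin.
Qed.

Let convK : convex_set K.
Proof. by apply/convex_setP => x y t Kx Ky t01; have [] := convex_u Kx Ky t01. Qed.

Let convex_f : convex_on K f.
Proof. by move=> x y t Kx Ky t01; have [] := convex_u Kx Ky t01. Qed.

Definition affine_minorants : set ('rV[R]_n * R) :=
  [set q | forall x, K x -> ((dotr q.1 x + q.2)%:E <= u x)%E].
Local Notation A := affine_minorants.
Local Notation e := (gap_err p f om O).

Let A_leK q x : A q -> K x -> dotr q.1 x + q.2 <= f x.
Proof. by move=> Aq Kx; have := Aq x Kx; rewrite (uE Kx) lee_fin. Qed.

Let A_le q x : A q -> O x -> dotr q.1 x + q.2 <= f x.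
Proof. by move=> Aq /OK; exact: A_leK. Qed.

Lemma tangent_affine_minorant z : O z -> A (grad f z, f z - dotr (grad f z) z).
Proof.
move=> Oz x Kx /=; rewrite (uE Kx) lee_fin.
suff : dotr (grad f z) (x - z) <= f x - f z by rewrite linearB/=; lra.
have Oz0 : O (z + 0 *: (x - z)) by rewrite scale0r addr0.
have := C1_is_derive_line oO (C2_C1 c2u.1) Oz0; rewrite scale0r addr0 => dz.
apply: (is_derive_le dz); near=> t; rewrite add0r scale0r addr0.
have t0 : 0 < t by near: t; exact: nbhs_right_gt.
have t1 : t < 1 by near: t; exact: nbhs_right_lt.
have -> : z + t *: (x - z) = t *: x + (1 - t) *: z by apply/rowP => j; rewrite !mxE; ring.
have t01 : 0 < t < 1 by rewrite t0.
by have := convex_f Kx (OK Oz) t01; lra.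
Unshelve. all: end_near. Qed.

Lemma affine_minorants_nonempty : A !=set0.
Proof.
have [m m_le] := convex_bounded_below bK convK convex_f.
by exists (0, m) => x Kx; rewrite (uE Kx) lee_fin dotrC linear0 add0r m_le.
Qed.

Let f_cont x : O x -> {for x, continuous f}.
Proof. exact: (C1_continuous oO (C2_C1 c2u.1)). Qed.

Let om_cont : {in O, continuous om}.
Proof.
move=> x; rewrite inE => Ox.
apply: (@continuous_comp _ _ _ (fun y => (y, fine (u y))) omega x); last exact: omega_cont.
have id_cont : y @[y --> x] --> x by exact: cvg_id.
exact: (cvg_pair id_cont (f_cont Ox)).
Qed.

Let om_gt0 x : O x -> 0 < om x. Proof. by []. Qed.

Let f_bounded : exists b : R, forall x, O x -> `|f x| <= b.
Proof.
have [[x1 Ox1]|O0] := pselect (O !=set0); last by exists 0 => x Ox; case: O0; exists x.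
have [L lipL] := lipu; have /ex_strict_bound_gt0[M _ KM] := bK.
exists (`|f x1| + `|L| * (M + M)) => x Ox; have -> : f x = f x1 + (f x - f x1) by ring.
apply: (le_trans (ler_normD _ _)); rewrite lerD2l.
apply: (le_trans (lipL _ _ Ox Ox1)); apply: (@le_trans _ _ (`|L| * `|x - x1|)).
  by rewrite ler_wpM2r// ler_norm.
rewrite ler_wpM2l//; apply: (le_trans (ler_normB _ _)).
by apply: lerD; apply: ltW; apply: KM; exact: OK.
Qed.

Let om_bounded : exists M : R, forall x, O x -> om x <= M.
Proof.
have [[x1 Ox1]|O0] := pselect (O !=set0); last by exists 0 => x Ox; case: O0; exists x.
have [b fb] := f_bounded.
have graph x : O x -> (K `*` `[- b, b]%classic) (x, f x).
  by move=> Ox; split; [exact: OK|rewrite /= in_itv/= -ler_norml fb].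
have [z _ z_max] : exists2 z, z \in K `*` `[- b, b]%classic &
    forall y, y \in K `*` `[- b, b]%classic -> omega y <= omega z.
  apply: compact_EVT_max; first by exists (x1, f x1); exact: graph.
    by apply: compact_setX => //; exact: segment_compact.
  exact: continuous_subspaceT.
by exists (omega z) => x Ox; apply: z_max; rewrite inE; exact: graph.
Qed.

Lemma iint_on_dom (F g : 'rV[R]_n -> \bar R) : (forall x, 0 <= F x)%E -> (forall x, O x -> F x = g x) ->
  (forall x, 0 <= g x)%E -> measurable_fun O g -> iint_on K F = (\int[mu]_(x in O) g x)%E.
Proof.
move=> F0 Fg g0 mg; rewrite -iint_onE//.
apply: (eq_iint_iterated_null (convex_boundary_iterated_null convK)).
- by move=> x; case: ifP.
- by move=> x; case: ifP.
move=> x Nx; case: asboolP => Kx; case: asboolP => Ox //.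
- exact: Fg.
- by exfalso; apply: Nx.
- by exfalso; apply: Kx; exact: OK.
Qed.

Let err0 s x : (0 <= err e s x)%E. Proof. by apply: err_ge0 => q y; exact: gap_err_ge0. Qed.

Let merr s : measurable_fun setT (err e s).
Proof. by apply: measurable_err => q; exact: (measurable_gap_err p c2u om_cont). Qed.

Lemma err_maxaff k (Q : 'I_k.+1 -> 'rV[R]_n * R) x : (forall i, A (Q i)) -> O x ->
  err e (codom Q) x =
  ((f x - maxaff (fun i => (Q i).1) (fun i => (Q i).2) x) `^ p * om x)%:E.
Proof.
move=> AQ Ox; set l := maxaff _ _ x; apply/eqP; rewrite eq_le; apply/andP; split.
  have [i lE] : exists i, l = dotr (Q i).1 x + (Q i).2.
    rewrite /l /maxaff; elim/big_ind : _; first by exists ord0.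
      by move=> _ _ [i ->] [j ->]; rewrite maxEle; case: ifP => _; [exists j|exists i].
    by move=> i _; exists i.
  by apply: le_trans (err_le _ _ (codom_f Q i)) _; rewrite gap_errE// /gap -lE.
apply: le_err => _ /codomP[i ->]; rewrite gap_errE// lee_fin ler_pM2r ?om_gt0//.
apply: le_powR; first exact: ltW.
  by rewrite subr_ge0; apply/bigmax_leP; split=> [|j _]; exact: A_le.
by rewrite lerD2l lerN2; exact: (bigmax_sup i).
Qed.

Lemma iint_maxaff k (Q : 'I_k.+1 -> 'rV[R]_n * R) : (forall i, A (Q i)) ->
  let l := maxaff (fun i => (Q i).1) (fun i => (Q i).2) in
  iint_on K (fun x => ((fine (u x) - l x) `^ p * omega (x, fine (u x)))%:E) =
  (\int[mu]_(x in O) err e (codom Q) x)%E.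
Proof.
move=> AQ l; apply: iint_on_dom => //.
- by move=> x; rewrite lee_fin mulr_ge0 ?powR_ge0// ltW.
- by move=> x Ox; rewrite err_maxaff.
- exact: measurable_funTS.
Qed.

Lemma tri_best_err m : (0 < m)%N -> tri p u m omega = best_err mu e A O m.
Proof.
move=> m0; apply/eqP; rewrite eq_le; apply/andP; split.
  apply: le_best_err => s sm sA; have [q0 Aq0] := affine_minorants_nonempty.
  wlog s0 : s sm sA / (0 < size s)%N.
    move=> wlog_s; case: s sm sA => [_ _|q s sm sA]; last exact: wlog_s.
    apply: (@le_trans _ _ (\int[mu]_(x in O) err e [:: q0] x)%E).
      by apply: wlog_s => // q; rewrite /= inE => /eqP ->.
    apply: ge0_le_integral => //; try exact: measurable_funTS.
    by move=> x _; exact: sub_err.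
  case sE : (size s) s0 => [//|k] _; pose Q (i : 'I_k.+1) := nth q0 s i.
  have AQ i : A (Q i) by apply: sA; rewrite /= mem_nth// sE.
  apply: (@le_trans _ _ (\int[mu]_(x in O) err e (codom Q) x)%E); last first.
    apply: ge0_le_integral => //; try exact: measurable_funTS.
    move=> x _; apply: sub_err => q qs; apply/codomP.
    have qk : (index q s < k.+1)%N by rewrite -sE index_mem.
    by exists (Ordinal qk); rewrite /Q /= nth_index.
  rewrite -iint_maxaff//; apply: ereal_inf_lbound.
  exists (maxaff (fun i => (Q i).1) (fun i => (Q i).2)); split=> //.
  exists k, (fun i => (Q i).1), (fun i => (Q i).2); split; first by rewrite -sE.
  split=> // x Kx; rewrite (uE Kx) lee_fin.
  by apply/bigmax_leP; split=> [|j _]; exact: A_leK.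
apply: le_ereal_inf_tmp => _ [_ [[k [a [b [km [-> lu]]]]] ->]].
have AQ i : A (a i, b i).
  by move=> x Kx /=; apply: le_trans (lu x Kx); rewrite lee_fin; exact: (bigmax_sup i).
rewrite (iint_maxaff AQ); apply: best_err_le; rewrite ?size_codom ?card_ord//.
by move=> _ /codomP[i ->].
Qed.

Theorem tri_limit :
  ((fun m : nat => ((m%:R `^ r)%:E * tri p u m omega)) @ \oo
        --> ((quantization_constant n p / 2 `^ p) *
             fine (iint_on (dom u)
               (fun x => ((\det (hessian (fun y => fine (u y)) x)) `^ (p / (n%:R + 2 * p))
                          * omega (x, fine (u x)) `^ (n%:R / (n%:R + 2 * p)))%:E))
             `^ ((n%:R + 2 * p) / n%:R))%:E)%E.
Proof.
have nR0 : n%:R != 0 :> R by rewrite pnatr_eq0 -lt0n.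
have dens0 x : 0 <= limit_density p f om x by rewrite mulr_ge0 ?powR_ge0.
rewrite (iint_on_dom (g := fun x => (limit_density p f om x)%:E))//; last first.
  apply/measurable_EFinP; apply: open_continuous_measurable_fun_mx => //.
  exact: (continuous_limit_density n0 c2u om_cont om_gt0).
have -> : (n%:R + 2 * p) / n%:R = 1 + r by field.
have := gap_limit n0 p0 c2u (convex_interior convK) bO lipu A_le tangent_affine_minorant om_cont om_gt0
  om_bounded.
by apply: cvg_trans; apply: near_eq_cvg; exists 1%N => // m /= m1; rewrite tri_best_err.
Qed.

End main.

Theorem theorem1 (R : realType) (n : nat) (p : R) :
  (0 < n)%N -> 0 < p ->
  exists delta : R,
    zador_constant n p delta /\
    forall (u : 'rV[R]_n -> \bar R) (omega : 'rV[R]_n * R -> R),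
      (forall x, (-oo < u x)%E) ->
      convex_ext u ->
      compact (dom u) ->
      lip_on (fun x => fine (u x)) (interior (dom u)) ->
      C2plus_on (fun x => fine (u x)) (interior (dom u)) ->
      continuous omega ->
      (forall z, 0 < omega z) ->
      ((fun m : nat => ((m%:R `^ (2 * p / n%:R))%:E * tri p u m omega)) @ \oo
        --> ((delta / 2 `^ p) *
             fine (iint_on (dom u)
               (fun x => ((\det (hessian (fun y => fine (u y)) x)) `^ (p / (n%:R + 2 * p))
                          * omega (x, fine (u x)) `^ (n%:R / (n%:R + 2 * p)))%:E))
             `^ ((n%:R + 2 * p) / n%:R))%:E)%E.

Proof.
move=> n0 p0; exists (quantization_constant n p); split; first exact: zador_quantization_constant.
by move=> *; exact: tri_limit.
Qed.
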